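(* Let $\mu$ be a compactly supported nontrivial probability measure on $\mathbb{R}$ whose Jacobi parameters $a_n>0$, $b_n\in\mathbb{R}$ satisfy, for some $N_0$, $$a_n=1-\sum_{j=1}^Jc_jn^{-\tau_j}+o(n^{-1-\tau_1})\ \ \forall n\ge N_0\quad\text{or}\quad a_n\equiv1\ \ \forall n\ge N_0,$$ $$b_n=-\sum_{j=1}^Kd_jn^{-\sigma_j}+o(n^{-1-\sigma_1})\ \ \forall n\ge N_0\quad\text{or}\quad b_n\equiv0\ \ \forall n\ge N_0,$$ with real coefficients $c_j$, $d_j$, exponents $0<\tau_1<\dots<\tau_J$, $0<\sigma_1<\dots<\sigma_K$, and $c_1,d_1>0$. Let $\beta=\min(\sigma_1,\tau_1)$, with the convention $\tau_1=+\infty$ if $a_n\equiv1$ for $n\ge N_0$ and $\sigma_1=+\infty$ if $b_n\equiv0$ for $n\ge N_0$. Let $f$ be the density of the absolutely continuous part of $\mu$, continuous and strictly positive on $(-2,2)$. (a) If $\beta\ge2$, then $\log f(x)=O(\log(2-x))$ as $x\nearrow2$. (b) If $\beta<2$ and $\mu(\{2\})=0$, then $\log f$ has an asymptotic expansion of the form $$\log f(x)=-\sum_{i=1}^IQ_i(2-x)^{-\kappa_i}+O(\log(2-x)),\qquad x\nearrow2,$$ with $I\in\mathbb{N}$ and $\kappa_1>\kappa_2>\dots>\kappa_I>0$. The leading term is given by $$Q_1=C_1^{\frac1\beta}\,\frac{\Gamma\left(\frac1\beta-\frac12\right)\sqrt\pi}{\Gamma\left(\frac1\beta\right)},\qquad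 \kappa_1=\frac1\beta-\frac12,$$ where $C_1=2c_1$ if $\tau_1<\sigma_1$, $C_1=2c_1+d_1$ if $\tau_1=\sigma_1$, and $C_1=d_1$ if $\tau_1>\sigma_1$ (so that $C_1n^{-\beta}$, $C_1>0$, is the leading term in the expansion of $2-2a_n-b_n$).
   Context: Nontrivial means not supported on a finite set. The orthonormal polynomials $p_n$ of $\mu$ ($p_0=1$, positive leading coefficients) satisfy $xp_n(x)=a_np_{n-1}(x)+b_{n+1}p_n(x)+a_{n+1}p_{n+1}(x)$ for $n\ge0$ (with $p_{-1}=0$); this defines the Jacobi parameters $\{a_n,b_n\}_{n\ge1}$ of $\mu$. Under the stated assumptions the sequences $a_n,b_n$ have bounded variation with limits $1$ and $0$, and it is known that $d\mu=f(x)\,dx+d\mu_{\rm s}$ with $f$ continuous and strictly positive on $(-2,2)$, $f=0$ on $\mathbb{R}\setminus(-2,2)$, and $\mu_{\rm s}$ supported on $\mathbb{R}\setminus(-2,2)$. $\Gamma$ denotes the Gamma function. *)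

(* Defs.v *)
From HB Require Import structures.
From mathcomp Require Export all_boot all_order all_algebra.
From mathcomp Require Export all_classical all_reals all_analysis.
Export Order.TTheory GRing.Theory Num.Theory.
Export numFieldNormedType.Exports.

Set Implicit Arguments.
Unset Strict Implicit.
Unset Printing Implicit Defensive.

Local Open Scope classical_set_scope.
Local Open Scope ring_scope.

Definition compactly_supported (R : realType)
    (mu : {measure set (measurableTypeR R) -> \bar R}) : Prop :=
  exists2 K : set R, compact K & mu (~` K) = 0%E.

Definition nontrivial_measure (R : realType)
    (mu : {measure set (measurableTypeR R) -> \bar R}) : Prop :=
  forall A : set R, finite_set A -> mu (~` A) <> 0%E.

Definition orthonormal_polys (R : realType)
    (mu : {measure set (measurableTypeR R) -> \bar R})
    (p : nat -> {poly R}) : Prop :=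
  [/\ p 0%N = 1,
      forall n, size (p n) = n.+1,
      forall n, 0 < lead_coef (p n)
    & forall m n, (\int[mu]_x ((p m).[x] * (p n).[x])%:E = ((m == n)%:R)%:E)%E].

(** The parameters are indexed by n >= 1: the values a 0 and b 0 are not
    constrained. *)
Definition jacobi_parameters (R : realType)
    (mu : {measure set (measurableTypeR R) -> \bar R})
    (a b : nat -> R) : Prop :=
  exists2 p : nat -> {poly R}, orthonormal_polys mu p &
    forall n, 'X * p n =
      (if n is m.+1 then a n *: p m else 0)
      + b n.+1 *: p n + a n.+1 *: p n.+1.

(** [f] is a density of the absolutely continuous part in the Lebesgue
    decomposition [mu = f dx + nu], with [nu] singular. *)
Definition ac_density (R : realType)
    (mu : {measure set (measurableTypeR R) -> \bar R}) (f : R -> R) : Prop :=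
  [/\ measurable_fun setT f,
      forall x, 0 <= f x
    & exists nu : {measure set (measurableTypeR R) -> \bar R},
        (exists N : set (measurableTypeR R),
           [/\ measurable N, lebesgue_measure N = 0%E & nu (~` N) = 0%E]) /\
        (forall A : set (measurableTypeR R), measurable A ->
           mu A = (\int[lebesgue_measure]_(x in A) (f x)%:E + nu A)%E)].

(** Euler's integral; meaningful for [0 < s] only. *)
Definition Gamma (R : realType) (s : R) : R :=
  \int[lebesgue_measure]_(t in `]0, +oo[) (t `^ (s - 1) * expR (- t)).

(** A nonempty sum of terms [coef j * n ^ (- expo j)]; the mathematical index
    [j = 1, ..., J] is shifted to [j = 0, ..., J - 1], so the leading term is
    the one at [ord0]. *)
Record power_sum (R : realType) := PowerSum {
  ps_len : nat ;
  ps_coef : 'I_ps_len.+1 -> R ;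
  ps_expo : 'I_ps_len.+1 -> R }.

Arguments ps_coef {R} p _.
Arguments ps_expo {R} p _.

Definition ps_lead_coef (R : realType) (P : power_sum R) : R := ps_coef P ord0.
Definition ps_lead_expo (R : realType) (P : power_sum R) : R := ps_expo P ord0.

Definition admissible_power_sum (R : realType) (P : power_sum R) : Prop :=
  [/\ 0 < ps_lead_expo P,
      forall i j : 'I_(ps_len P).+1, (i < j)%N -> ps_expo P i < ps_expo P j
    & 0 < ps_lead_coef P].

(** For [o = Some P], the sequence [s] is, from [N0] on, [l] minus the power
    sum [P] up to an error small with respect to [n ^ (- 1 - leading exponent)];
    for [o = None] it is constantly [l] from [N0] on. *)
Definition power_expansion (R : realType) (s : nat -> R) (l : R) (N0 : nat)
    (o : option (power_sum R)) : Prop :=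
  match o with
  | Some P =>
      admissible_power_sum P /\
      exists2 e : nat -> R,
        e =o_\oo (fun n : nat => n%:R `^ (- 1 - ps_lead_expo P)) &
        forall n, (N0 <= n)%N ->
          s n = l - \sum_(j < (ps_len P).+1)
                      ps_coef P j * n%:R `^ (- ps_expo P j) + e n
  | None => forall n, (N0 <= n)%N -> s n = l
  end.

Definition lead_expo (R : realType) (o : option (power_sum R)) : \bar R :=
  if o is Some P then (ps_lead_expo P)%:E else +oo%E.

(** The value for [None] is a dummy. *)
Definition lead_coeff (R : realType) (o : option (power_sum R)) : R :=
  if o is Some P then ps_lead_coef P else 0.

(** [C1 * n ^ (- beta)] is the leading term of [2 - 2 * a n - b n], where [oa]
    and [ob] describe the expansions of [a] and [b]. *)
Definition C1 (R : realType) (oa ob : option (power_sum R)) : R :=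
  if (lead_expo oa < lead_expo ob)%E then 2 * lead_coeff oa
  else if lead_expo oa == lead_expo ob then 2 * lead_coeff oa + lead_coeff ob
  else lead_coeff ob.

(* Main.v *)
Require Import Defs.
From mathcomp Require Import measurable_realfun ring lra zify.

(** The density is read off from the orthonormal polynomials [p n], and these
    from the recurrence that they satisfy. The bridge is the Turan determinant
    [turan n x = a_(n+1)^2 p_(n+1)(x)^2 - a_(n+1) a_(n+2) p_n(x) p_(n+2)(x)]:
    as [a n] tends to 1 and [b n] to 0, the measures [turan n dmu] converge
    weakly to the normalised semicircle law ([turan_poly]). Bounds on [turan n]
    near a point that hold for all large [n] are therefore, up to constants,
    bounds on [semi / f] at that point ([density_bounds]).

    Let [x = 2 - eps], [W n = 2 - 2 a_n - b_n] and
    [gap n = (x - b_n) / a_n - 2 = (W n - eps) / a_n]. The coefficients are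
    eventually monotone, so [gap n] is nonnegative up to some index [m] and
    negative beyond it. Beyond [m] the determinant is a positive definite
    quadratic form in [(p_(n+1)(x), p_n(x))], and the monotonicity of the
    coefficients lets it vary by at most a power of [eps] in all: hence
    [f (2 - eps) = 1 / (p_m(x)^2 + p_(m+1)(x)^2)] up to powers of [eps]
    ([elliptic_density]), whose logarithms are absorbed by the error term.
    Below [m], a solution of the recurrence that starts positive and increasing
    is, up to such factors, the product [growth] of the [mult (gap k)], where [mult d] is the larger root of
    [l + l^-1 = 2 + d]; any other solution is at most as large
    ([hyperbolic_bounds]). So [|ln f| <= 2 ln growth + O(ln eps^-1)], and even
    [ln f = - 2 ln growth + O(ln eps^-1)] if the data at the edge start increasing
    ([density_logs]).

    This is where [mu {2} = 0] enters. When [beta < 2], [n^2 W n] tends to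
    infinity; if [|p_n(2)|] never increased, a comparison would give
    [p_n(2) = O(1/n)], so that the sum of the [p_n(2)^2] would converge and [2]
    would carry mass ([growing_at_edge]). When [2 <= beta] the bound on [|ln f|]
    suffices, because [ln growth] is itself [O(ln eps^-1)].

    There remains the expansion of [ln growth], the sum of the
    [ln (mult (gap k))]. As the derivative of [ln (mult (v^2))] is
    [(1 + v^2 / 4)^(-1/2)], this sum is the integral over [v] of that weight
    times the number of indices with [v^2 <= gap k]. With [t = v^2 + eps] and
    [r = v^2 / t] the condition on [k] reads [t <= W k + r t (1 - a_k)], and the
    expansion of the coefficients in powers of [k] can be inverted: the number
    is [(C1 / t)^(1 / beta) (1 + a finite sum of terms c r^m t^w) + O(1)]
    ([count_expansion]). Integrated term by term, [r^m t^(- th)] contributes a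
    constant times [eps^(1/2 - th)] when [1/2 < th], and [O(ln eps^-1)]
    otherwise ([edge_int_singular], [edge_int_mild]). The terms of the first
    kind are those of the theorem. The leading one is
    [2 C1^(1 / beta)] times the integral of [(1 + v^2)^(- 1 / beta)] over the
    half-line, which [half_line_beta] expresses by the Gamma function. *)

Set Implicit Arguments.
Unset Strict Implicit.
Unset Printing Implicit Defensive.

Local Open Scope classical_set_scope.
Local Open Scope ring_scope.

(** * Continuous functions and a boundedly supported measure *)

Section BoundedSupport.
Context {R : realType} (mu : probability (measurableTypeR R) R) (B : R).
Hypothesis supp : mu (~` `[- B, B]%classic) = 0%E.

Lemma cont_meas (h : R -> R) : continuous h -> measurable_fun [set: measurableTypeR R] h.
Proof. by move=> ch; apply: continuous_measurable_fun. Qed.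

Lemma cont_bounded_itv (h : R -> R) (a b : R) : continuous h ->
  exists2 M, 0 <= M & forall x, x \in `[a, b] -> `|h x| <= M.
Proof.
move=> ch; case: (leP a b) => [ab|ba]; last first.
  exists 0 => // x; rewrite in_itv /= => /andP[ax xb].
  by have := le_lt_trans (le_trans ax xb) ba; rewrite ltxx.
have ch' : {within `[a, b], continuous (fun x => `|h x|)}.
  by apply: continuous_subspaceT => x; apply: continuous_comp; [exact: ch|exact: norm_continuous].
have [c cab hc] := EVT_max ab ch'.
by exists `|h c|.
Qed.

Lemma cont_integrable (h : R -> R) : continuous h -> mu.-integrable setT (EFin \o h).
Proof.
move=> ch.
have [M M0 hM] := @cont_bounded_itv h (-B) B ch.
apply/integrableP; split; first by apply/measurable_EFinP; exact: cont_meas.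
rewrite (@ge0_negligible_integral _ _ _ mu setT (~` `[- B, B]%classic)) //.
- rewrite setTD setCK.
  apply: (@le_lt_trans _ _ (\int[mu]_(x in `[(- B)%R, B]) M%:E)%E).
    apply: ge0_le_integral => //.
    + apply/measurable_funTS; apply: (measurableT_comp (f := abse)) => //.
      by apply/measurable_EFinP; exact: cont_meas.
  rewrite integral_cst //; apply: lte_mul_pinfty => //.
  by rewrite (le_lt_trans (probability_le1 mu _)) ?ltry.
- exact: measurableC.
- apply: (measurableT_comp (f := abse)) => //; by apply/measurable_EFinP; exact: cont_meas.
Qed.

Lemma le_cont_integral (h1 h2 : R -> R) : continuous h1 -> continuous h2 ->
  (forall x, - B <= x <= B -> h1 x <= h2 x) ->
  \int[mu]_x h1 x <= \int[mu]_x h2 x.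
Proof.
move=> c1 c2 h12.
have i1 := cont_integrable c1; have i2 := cont_integrable c2.
have mN : measurable (~` `[- B, B]%classic : set (measurableTypeR R)) by exact: measurableC.
rewrite /Rintegral (@negligible_integral _ _ _ mu setT _ _ mN measurableT i1 supp).
rewrite (@negligible_integral _ _ _ mu setT _ _ mN measurableT i2 supp).
rewrite setTD setCK.
apply: le_Rintegral => //.
- exact: integrableS i1.
- exact: integrableS i2.
Qed.

Lemma contD (h1 h2 : R -> R) : continuous h1 -> continuous h2 -> continuous (fun x => h1 x + h2 x).
Proof. by move=> c1 c2 x; apply: cvgD; [exact: c1|exact: c2]. Qed.

Lemma contM (h1 h2 : R -> R) : continuous h1 -> continuous h2 -> continuous (fun x => h1 x * h2 x).
Proof. by move=> c1 c2 x; apply: cvgM; [exact: c1|exact: c2]. Qed.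

Lemma intD (h1 h2 : R -> R) : continuous h1 -> continuous h2 ->
  \int[mu]_x (h1 x + h2 x) = \int[mu]_x h1 x + \int[mu]_x h2 x.
Proof. by move=> c1 c2; apply: RintegralD => //; exact: cont_integrable. Qed.

Lemma intB (h1 h2 : R -> R) : continuous h1 -> continuous h2 ->
  \int[mu]_x (h1 x - h2 x) = \int[mu]_x h1 x - \int[mu]_x h2 x.
Proof. by move=> c1 c2; apply: RintegralB => //; exact: cont_integrable. Qed.

Lemma intZ (k : R) (h : R -> R) : continuous h ->
  \int[mu]_x (k * h x) = k * \int[mu]_x h x.
Proof. by move=> c1; apply: RintegralZl => //; exact: cont_integrable. Qed.

End BoundedSupport.

(** * Walk numbers and the moments of the semicircle law *)

(** The number of nonnegative walks of [j] steps from height [i] to height [0];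
    at [i = 0] these are the moments of the semicircle law. *)
Fixpoint walks (j i : nat) : nat :=
  if j is j'.+1 then walks j' i.+1 + (if i is i'.+1 then walks j' i' else 0)
  else (i == 0).

Lemma walks_ballot j : (forall m i, j = (m.*2 + i)%N ->
    (walks j i + (if m is m'.+1 then 'C(j, m') else 0) = 'C(j, m))%N) /\
  (forall i, (j < i)%N || odd (j + i) -> walks j i = 0%N).
Proof.
elim: j => [|j [IH1 IH2]]; split.
- by move=> [|m] [|i] //=; rewrite ?doubleS ?bin0.
- by move=> [|i] //=.
- move=> [|m] i.
    rewrite double0 add0n => <-; rewrite bin0 addn0 /=.
    rewrite IH2 ?ltnS ?leqW // add0n.
    by have := IH1 0%N j erefl; rewrite bin0 addn0.
  move=> E /=; case: i E => [|i] E.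
    have -> : walks j 1 = ('C(j, m) - (if m is m'.+1 then 'C(j,m') else 0))%N.
      by have := IH1 m 1%N; case: m E => [|m] E; lia.
    have E2 : j = m.*2.+1 by lia.
    have H : 'C(j, m.+1) = 'C(j, m).
      by rewrite -bin_sub; [congr binomial; lia|lia].
    have := IH1 m 1%N; rewrite addn1 => /(_ E2) A; rewrite [in RHS]binS H.
    by case: m E E2 H A => [|m] E E2 H A; rewrite ?binS ?bin0 /=; lia.
  have := IH1 m i.+2; have := IH1 m.+1 i; case: m E => [|m] E; rewrite !binS ?bin0; lia.
- move=> i Hi /=; rewrite IH2; last by lia.
  by case: i Hi => [|i] Hi //; rewrite IH2 //; lia.
Qed.

Lemma walks_central k : (k.+1 * walks k.*2 0 = 'C(k.*2, k))%N.
Proof.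
have := (walks_ballot k.*2).1 k 0%N; rewrite addn0 => /(_ erefl).
case: k => [|k]; first by rewrite /=; lia.
have := mul_bin_left k.+1.*2 k.
rewrite (_ : (k.+1.*2 - k = k.+2)%N); last by lia.
move=> F1 F2; nia.
Qed.

Lemma bin_central k : (k.+1 * 'C(k.+1.*2, k.+1) = 2 * k.*2.+1 * 'C(k.*2, k))%N.
Proof.
have := mul_bin_diag k.+1.*2 k; rewrite doubleS /= => F1.
have := mul_bin_down k.*2.+1 k; rewrite /= (_ : (k.*2.+1 - k = k.+1)%N); last by lia.
move=> F2; nia.
Qed.

(** The recursion that integration by parts gives for the moments of the
    semicircle weight, here for the walk numbers. *)
Lemma walks_moment (j : nat) : ((j + 4) * walks j.+2 0 = 4 * (j + 1) * walks j 0)%N.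
Proof.
have [oj|ej] := boolP (odd j).
  rewrite (walks_ballot j).2 ?(walks_ballot j.+2).2 ?muln0 ?addn0 /= ?oj ?orbT //.
have Ej : j = (j./2).*2 by rewrite -[LHS](odd_double_half j) (negPf ej).
move: (j./2) Ej => k -> {ej j}.
have F1 := walks_central k; have F2 := walks_central k.+1; have F3 := bin_central k.
apply/eqP; rewrite -(eqn_pmul2l (ltn0Sn k)); apply/eqP.
rewrite doubleS in F2 F3; rewrite -F1 -F2 in F3.
have -> : (k.+1 * ((k.*2 + 4) * walks k.*2.+2 0) = 2 * (k.+1 * (k.+2 * walks k.*2.+2 0)))%N by lia.
rewrite F3; lia.
Qed.

Lemma walks_1_0 : walks 1 0 = 0%N.
Proof. by []. Qed.

Section Semicircle.
Context {R : realType}.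
Notation leb := (@lebesgue_measure R).
Definition semi (x : R) : R := Num.sqrt (4 - x ^+ 2).

Lemma semi_cont : continuous semi.
Proof.
move=> x; apply: continuous_comp; last exact: sqrt_continuous.
by apply: cvgB; [exact: cvg_cst|exact: exprn_continuous].
Qed.

Lemma semi_ge0 x : 0 <= semi x. Proof. exact: sqrtr_ge0. Qed.

Lemma semi_gt0 x : x \in `](-2), 2[ -> 0 < semi x.
Proof. by rewrite in_itv /= => /andP[x1 x2]; rewrite sqrtr_gt0; nra. Qed.

Lemma semi_sqr x : x \in `](-2), 2[ -> semi x * semi x = 4 - x ^+ 2.
Proof. by rewrite in_itv /= => /andP[x1 x2]; rewrite -expr2 sqr_sqrtr //; nra. Qed.

Lemma is_derive_semi (x : R) : x \in `](-2), 2[ -> is_derive x 1 semi (- x / semi x).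
Proof.
move=> hx; have s0 := semi_gt0 hx.
have h4 : 0 < 4 - x ^+ 2 by move: hx; rewrite in_itv /= => /andP[x1 x2]; nra.
have d1 : is_derive x 1 (fun y : R => 4 - y ^+ 2) (- (2 * x)).
  by apply: is_derive_eq; rewrite /GRing.scale /=; ring.
have d2 : is_derive (4 - x ^+ 2) 1 Num.sqrt (2 * Num.sqrt (4 - x^+2))^-1.
  by apply: is_derive1_sqrt.
have := @is_derive1_comp _ Num.sqrt (fun y : R => 4 - y ^+ 2) _ _ _ d2 d1.
move=> H; apply: (is_derive_eq H).
by rewrite /semi; field; rewrite gt_eqF.
Qed.

Definition semi_prim (j : nat) (x : R) : R := x ^+ j * (4 - x ^+ 2) * semi x.

Lemma semi_prim_cont j : continuous (semi_prim j).
Proof.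
apply: contM; last exact: semi_cont.
apply: contM; first exact: exprn_continuous.
by move=> x; apply: cvgB; [exact: cvg_cst|exact: exprn_continuous].
Qed.

Lemma is_derive_semi_prim (j : nat) (x : R) : x \in `](-2), 2[ ->
  is_derive x 1 (semi_prim j)
    ((4 * j%:R * x ^+ j.-1 - (j + 3)%:R * x ^+ j.+1) * semi x).
Proof.
move=> hx; have s0 := semi_gt0 hx.
have d0 := is_derive_semi hx.
have d1 : is_derive x 1 (fun y : R => y ^+ j * (4 - y ^+ 2))
   (j%:R * x ^+ j.-1 * (4 - x ^+ 2) - x ^+ j * (2 * x)).
  have da : is_derive x 1 (fun y : R => y ^+ j) (j%:R * x ^+ j.-1).
    by apply: DeriveDef; [exact: exprn_derivable|rewrite exp_derive /GRing.scale /= mulr1].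
  have db : is_derive x 1 (fun y : R => 4 - y ^+ 2) (- (2 * x)).
    by apply: is_derive_eq; rewrite /GRing.scale /=; ring.
  have H := @is_deriveM _ _ (fun y : R => y ^+ j) (fun y : R => 4 - y ^+ 2) x 1 _ _ da db.
  by apply: (is_derive_eq H); rewrite /GRing.scale /=; ring.
have := @is_deriveM _ _ (fun y : R => y ^+ j * (4 - y ^+ 2)) semi x 1 _ _ d1 d0.
move=> H; apply: (is_derive_eq H).
have hs := semi_sqr hx.
have -> : x ^+ j * (4 - x ^+ 2) *: (- x / semi x) = - x ^+ j.+1 * semi x.
  by rewrite -hs /GRing.scale /= exprS; field; rewrite gt_eqF.
rewrite /GRing.scale /= natrD; case: j {d1 H} => [|j]; rewrite ?expr0 /= ?exprS; ring.
Qed.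

Lemma cont_integrable_itv (h : R -> R) (a b : R) : continuous h ->
  leb.-integrable `[a, b] (EFin \o h).
Proof.
move=> ch; apply: continuous_compact_integrable; first exact: segment_compact.
exact: continuous_subspaceT.
Qed.

Definition semi_int (h : R -> R) : R := \int[leb]_(x in `[(-2), 2]) (h x * semi x).

(** Times the weight, the integrand is the derivative of [semi_prim j], which
    vanishes at both endpoints. *)
Lemma semi_int_moment j : 
  semi_int (fun x => 4 * j%:R * x ^+ j.-1 - (j + 3)%:R * x ^+ j.+1) = 0.
Proof.
rewrite /semi_int /Rintegral.
have := @continuous_FTC2 R (fun x => (4 * j%:R * x ^+ j.-1 - (j + 3)%:R * x ^+ j.+1) * semi x) (semi_prim j) (-2) 2.
move=> -> //.
- rewrite /semi_prim /= sqrrN [4 - _](_ : _ = 0); last by ring.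
  by rewrite !mulr0 !mul0r subrr.
- by lra.
- apply: continuous_subspaceT; apply: contM; last exact: semi_cont.
  by move=> x; apply: cvgB; apply: cvgM; (try exact: cvg_cst); exact: exprn_continuous.
- split.
  + by move=> x /is_derive_semi_prim H; exact: ex_derive.
  + by apply: cvg_at_right_filter; exact: semi_prim_cont.
  + by apply: cvg_at_left_filter; exact: semi_prim_cont.
- by move=> x /(is_derive_semi_prim j) H; rewrite derive1E; exact: derive_val.
Qed.

Lemma semi_intD (h1 h2 : R -> R) : continuous h1 -> continuous h2 ->
  semi_int (fun x => h1 x + h2 x) = semi_int h1 + semi_int h2.
Proof.
move=> c1 c2; rewrite /semi_int.
rewrite -RintegralD //; last 2 first.
  1,2: by apply: cont_integrable_itv; apply: contM => //; exact: semi_cont.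
by apply: eq_Rintegral => x _; rewrite mulrDl.
Qed.

Lemma semi_intZ (k : R) (h : R -> R) : continuous h ->
  semi_int (fun x => k * h x) = k * semi_int h.
Proof.
move=> c1; rewrite /semi_int -RintegralZl //; last first.
  by apply: cont_integrable_itv; apply: contM => //; exact: semi_cont.
by apply: eq_Rintegral => x _; rewrite mulrA.
Qed.

Lemma le_semi_int (h1 h2 : R -> R) : continuous h1 -> continuous h2 ->
  (forall x, -2 <= x <= 2 -> h1 x <= h2 x) -> semi_int h1 <= semi_int h2.
Proof.
move=> c1 c2 h12; apply: le_Rintegral => //.
1,2: by apply: cont_integrable_itv; apply: contM => //; exact: semi_cont.
by move=> x /=; rewrite in_itv /= => /h12 H; rewrite ler_wpM2r // semi_ge0.
Qed.

Lemma semi_int1_gt0 : 0 < semi_int (fun=> 1).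
Proof.
apply: (@lt_le_trans _ _ (\int[leb]_(x in `[0, 1]) 1)).
  by rewrite Rintegral_cst //= lebesgue_measure_itv /= lte_fin ltr01 /= mul1r subr0.
rewrite /semi_int.
have i1 := @cont_integrable_itv (fun x => 1 * semi x) (-2) 2 (contM (@cst_continuous _ _ _) semi_cont).
have sub : `[0, 1] `<=` `[(-2), 2 : R].
  by move=> x /=; rewrite !in_itv /= => /andP[? ?]; apply/andP; split; lra.
rewrite -lee_fin !fineK; last 2 first.
- by apply: integrable_fin_num => //.
- by apply: integrable_fin_num => //; exact: (@cont_integrable_itv (fun=> 1) 0 1 (@cst_continuous _ _ _)).
apply: (@le_trans _ _ (\int[leb]_(x in `[0%R, 1%R]) (1 * semi x)%:E)%E).
  apply: ge0_le_integral => //.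
  + by apply: measurable_int; apply: (@cont_integrable_itv (fun x => 1 * semi x) 0 1 (contM (@cst_continuous _ _ _) semi_cont)).
  + move=> x /=; rewrite in_itv /= => /andP[x0 x1]; rewrite lee_fin mul1r /semi.
    by rewrite -{1}sqrtr1 ler_sqrt; nra.
apply: ge0_subset_integral => //.
- by apply: measurable_int; exact: i1.
- by move=> x _; rewrite lee_fin mul1r semi_ge0.
Qed.

Lemma semi_int_walks j : semi_int (fun x => x ^+ j) = (walks j 0)%:R * semi_int (fun=> 1).
Proof.
suff: semi_int (fun x => x ^+ j) = (walks j 0)%:R * semi_int (fun=> 1) /\
      semi_int (fun x => x ^+ j.+1) = (walks j.+1 0)%:R * semi_int (fun=> 1) by case.
have cX k : continuous (fun x : R => x ^+ k) by exact: exprn_continuous.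
have cZ (k : R) m : continuous (fun x : R => k * x ^+ m).
  by apply: contM; [exact: cst_continuous|exact: cX].
elim: j => [|j [IH1 IH2]]; split => //.
- by rewrite mul1r; apply: eq_Rintegral => x _; rewrite expr0.
- rewrite walks_1_0 mul0r.
  have := semi_int_moment 0; rewrite mulr0.
  under eq_fun do rewrite mul0r add0r -mulNr.
  rewrite semi_intZ // => /eqP; rewrite mulf_eq0 oppr_eq0 pnatr_eq0 /= => /eqP -> //.
- have /= := semi_int_moment j.+1.
  under eq_fun do rewrite -mulNr.
  rewrite semi_intD // !semi_intZ // IH1 => H.
  have := walks_moment j; move/(congr1 (fun n : nat => n%:R : R)); rewrite !natrM.
  move=> H2.
  have j4 : (j + 4)%:R != 0 :> R by rewrite pnatr_eq0 addnS.
  apply: (mulfI j4); rewrite [RHS]mulrA H2.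
  move: H; rewrite (_ : (j.+1 + 3 = j + 4)%N); last by lia.
  rewrite mulNr => /eqP; rewrite subr_eq0 => /eqP <-.
  by rewrite addn1; ring.
Qed.

End Semicircle.

(** * The weak limit of the Turan determinants *)

Lemma cvg_mul_bounded {R : realType} (c d : nat -> R) (M : R) :
  c n @[n --> \oo] --> 0 -> (forall n, `|d n| <= M) -> c n * d n @[n --> \oo] --> 0.
Proof.
move=> c0 dM; apply/cvgr0Pnorm_le => e e0.
have M0 : 0 <= M by apply: le_trans (dM 0%N).
have M1 : 0 < M + 1 by apply: ltr_wpDl.
have e1 : 0 < e / (M + 1) by apply: divr_gt0.
move/cvgr0Pnorm_le : c0 => /(_ _ e1); apply: filterS => n Hn.
rewrite normrM; apply: (@le_trans _ _ (e / (M + 1) * (M + 1))); last by rewrite divfK // gt_eqF.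
by apply: ler_pM => //; apply: (le_trans (dM n)); rewrite lerDl.
Qed.

Lemma cvg_shift1 {R : realType} (c : nat -> R) (k : nat) (l : R) :
  c n @[n --> \oo] --> l -> c (n + k)%N @[n --> \oo] --> l.
Proof. by move=> cl; rewrite cvg_shiftn. Qed.

Lemma cvg_ext {R : realType} (f g : nat -> R) (l : R) : (forall n, f n = g n) ->
  f n @[n --> \oo] --> l -> g n @[n --> \oo] --> l.
Proof. by move=> /funext ->. Qed.

Lemma limD {R : realType} (f g : nat -> R) (l m : R) : f n @[n --> \oo] --> l ->
  g n @[n --> \oo] --> m -> f n + g n @[n --> \oo] --> l + m.
Proof. exact: cvgD. Qed.

Lemma limB {R : realType} (f g : nat -> R) (l m : R) : f n @[n --> \oo] --> l ->
  g n @[n --> \oo] --> m -> f n - g n @[n --> \oo] --> l - m.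
Proof. exact: cvgB. Qed.

Lemma limZ {R : realType} (c : R) (f : nat -> R) (l : R) : f n @[n --> \oo] --> l ->
  c * f n @[n --> \oo] --> c * l.
Proof. by move=> fl; apply: cvgM => //; exact: cvg_cst. Qed.

Lemma norm_mul_le {R : realType} (u v : R) : `|u * v| <= 2^-1 * (u * u + v * v).
Proof.
have := sqr_ge0 (u - v); have := sqr_ge0 (u + v) => H1 H2.
by rewrite ler_norml; apply/andP; split; nra.
Qed.

Section Limit.
Context {R : realType} (mu : probability (measurableTypeR R) R) (B : R).
Hypothesis B2 : (2 : R) <= B.
Hypothesis supp : mu (~` `[- B, B]%classic) = 0%E.
Variables (p : nat -> {poly R}) (a b : nat -> R).
Hypothesis orth : orthonormal_polys mu p.
Hypothesis jac : forall n, 'X * p n =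
      (if n is m.+1 then a n *: p m else 0)
      + b n.+1 *: p n + a n.+1 *: p n.+1.
Hypothesis cva : a n @[n --> \oo] --> (1 : R).
Hypothesis cvb : b n @[n --> \oo] --> (0 : R).

Lemma jacobi_rec n x : x * (p n.+1).[x] =
  a n.+1 * (p n).[x] + b n.+2 * (p n.+1).[x] + a n.+2 * (p n.+2).[x].
Proof.
have /(congr1 (fun q : {poly R} => q.[x])) := jac n.+1.
by rewrite !(hornerD, hornerM, hornerZ, hornerX).
Qed.

Definition mom (j k l : nat) : R := \int[mu]_x (x ^+ j * ((p k).[x] * (p l).[x])).

Lemma contX j : continuous (fun x : R => x ^+ j).
Proof. exact: exprn_continuous. Qed.

Lemma cont_mom j k l : continuous (fun x : R => x ^+ j * ((p k).[x] * (p l).[x])).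
Proof.
apply: contM; first exact: contX.
by apply: contM; exact: continuous_horner.
Qed.

Lemma momC j k l : mom j k l = mom j l k.
Proof. by apply: eq_Rintegral => x _; rewrite (mulrC (p k).[x]). Qed.

Lemma mom0 k l : mom 0 k l = (k == l)%:R.
Proof.
have [_ _ _ H] := orth.
rewrite /mom /Rintegral; under eq_integral do rewrite expr0 mul1r.
by rewrite H.
Qed.

Lemma momS j k l : mom j.+1 k l.+1 =
  a l.+1 * mom j k l + b l.+2 * mom j k l.+1 + a l.+2 * mom j k l.+2.
Proof.
have cZ (c : R) m : continuous (fun x : R => c * (x ^+ j * ((p k).[x] * (p m).[x]))).
  by apply: contM; [exact: cst_continuous|exact: cont_mom].
rewrite /mom -!(intZ supp) //; try exact: cont_mom.
rewrite -(intD supp) // -(intD supp) //; last by apply: contD.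
apply: eq_Rintegral => x _.
rewrite exprS -mulrA mulrCA (mulrCA x) jacobi_rec.
move: (x ^+ j) ((p k).[x]) ((p l).[x]) ((p l.+1).[x]) ((p l.+2).[x]) => A1 A2 A3 A4 A5; ring.
Qed.

Lemma mom_bound j k l : `|mom j k l| <= B ^+ j.
Proof.
have B0 : 0 <= B by move: B2 => h2; lra.
have cq : continuous (fun x : R => B ^+ j * 2^-1 * (x ^+ 0 * ((p k).[x] * (p k).[x]) + x ^+ 0 * ((p l).[x] * (p l).[x]))).
  apply: contM; [exact: cst_continuous|by apply: contD; exact: cont_mom].
have Eq : \int[mu]_x (B ^+ j * 2^-1 * (x ^+ 0 * ((p k).[x] * (p k).[x]) + x ^+ 0 * ((p l).[x] * (p l).[x]))) = B ^+ j.
  rewrite (intZ supp); last by apply: contD; exact: cont_mom.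
  rewrite (intD supp); try exact: cont_mom.
  rewrite -/(mom 0 k k) -/(mom 0 l l) !mom0 !eqxx (_ : true%:R = 1 :> R) //; by field.
have key x : - B <= x <= B -> `|x ^+ j * ((p k).[x] * (p l).[x])| <=
    B ^+ j * 2^-1 * (x ^+ 0 * ((p k).[x] * (p k).[x]) + x ^+ 0 * ((p l).[x] * (p l).[x])).
  move=> hx; rewrite normrM -mulrA !expr0 !mul1r.
  apply: ler_pM => //.
    by rewrite normrX lerXn2r // ?nnegrE // ler_norml.
  exact: norm_mul_le.
rewrite ler_norml; apply/andP; split.
- rewrite -Eq -mulN1r -(intZ supp) //.
  apply: (le_cont_integral supp) => //; first by apply: contM => //; exact: cst_continuous.
    exact: cont_mom.
  by move=> x /key; rewrite ler_norml mulN1r => /andP[].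
- rewrite -Eq; apply: (le_cont_integral supp) => //; first exact: cont_mom.
  by move=> x /key; rewrite ler_norml => /andP[].
Qed.

Lemma cvg_err (c : nat -> R) (l : R) k j (u v : nat -> nat) : c n @[n --> \oo] --> l ->
  (c (n + k)%N - l) * mom j (u n) (v n) @[n --> \oo] --> 0.
Proof.
move=> cl; apply: (@cvg_mul_bounded _ _ _ (B ^+ j)) => [|n]; last exact: mom_bound.
rewrite -(subrr l); apply: cvgB; last exact: cvg_cst.
exact: cvg_shift1.
Qed.

(** Replacing [a] by 1 and [b] by 0 in the recurrence for the moments costs
    [o(1)], the moments being bounded; what is left is the recursion for
    [walks], started from orthonormality. *)
Lemma mom_walks j i : mom j n.+1 (n.+1 + i) - mom j n (n + i).+2 @[n --> \oo] --> ((walks j i)%:R : R).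
Proof.
elim: j i => [|j IH] i.
  rewrite [X in X @ _](_ : _ = fun=> (i == 0%N)%:R); first exact: cvg_cst.
  apply/funext => n; rewrite !mom0 (_ : (n == _) = false) ?subr0; last by apply/negbTE; lia.
  by congr (nat_of_bool _)%:R; lia.
pose e n := ((a (n + (i.+1))%N - 1) * mom j n.+1 (n + i) + (b (n + i.+2)%N - 0) * mom j n.+1 (n + i).+1
  + (a (n + i.+2)%N - 1) * mom j n.+1 (n + i).+2) - ((a (n + i.+2)%N - 1) * mom j n (n+i).+1 + (b (n + i.+3)%N - 0) * mom j n (n + i).+2
  + (a (n + i.+3)%N - 1) * mom j n (n + i).+3).
have e0 : e n @[n --> \oo] --> (0 + 0 + 0 - (0 + 0 + 0) : R).
  by apply: cvgB; (apply: cvgD; [apply: cvgD|]); apply: cvg_err.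
rewrite !addr0 subrr in e0.
pose d n := if i is i'.+1 then mom j n.+1 (n.+1 + i') - mom j n (n + i').+2 else 0.
have dl : d n @[n --> \oo] --> ((if i is i'.+1 then walks j i' else 0)%:R : R).
  rewrite /d; case: (i) => [|i']; [exact: cvg_cst|exact: IH].
have L := limD (limD (IH i.+1) dl) e0.
rewrite addr0 -natrD in L; apply: cvg_ext L => n.
rewrite /e /d; case: (i) => [|i']; rewrite ?addn0 ?addnS ?addSn ?addn0 !momS.
  rewrite (momC j n n.+1); ring.
ring.
Qed.

(** For [a = 1] and [b = 0] this determinant does not depend on [n]. *)
Definition turan (n : nat) (x : R) : R :=
  a n.+1 ^+ 2 * ((p n.+1).[x] * (p n.+1).[x]) - a n.+1 * a n.+2 * ((p n).[x] * (p n.+2).[x]).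

Lemma cont_turan n : continuous (turan n).
Proof.
have cZ (c : R) k l : continuous (fun x : R => c * ((p k).[x] * (p l).[x])).
  apply: contM; [exact: cst_continuous|].
  by apply: contM; exact: continuous_horner.
by move=> x; apply: cvgB; exact: cZ.
Qed.

Lemma turan_monomial j : \int[mu]_x (x ^+ j * turan n x) @[n --> \oo] -->
   (semi_int (fun x : R => x ^+ j) / semi_int (fun=> 1 : R)).
Proof.
rewrite semi_int_walks mulfK; last by rewrite gt_eqF // semi_int1_gt0.
have c1 : a (n + 1)%N ^+ 2 @[n --> \oo] --> (1 : R).
  rewrite -(expr1n _ 2); apply: (@cvg_comp _ _ _ (fun n => a (n+1)%N) (fun y => y ^+ 2)); last exact: exprn_continuous.
  exact: cvg_shift1.
have c2 : a (n + 1)%N * a (n + 2)%N @[n --> \oo] --> (1 : R).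
  by rewrite -(mulr1 1); apply: cvgM; exact: cvg_shift1.
have s0 (c : nat -> R) : c n @[n --> \oo] --> (1 : R) -> c n - 1 @[n --> \oo] --> (0 : R).
  by move=> H; rewrite -(subrr 1); apply: cvgB => //; exact: cvg_cst.
have e1 := cvg_mul_bounded (s0 _ c1) (fun n => mom_bound j n.+1 n.+1).
have e2 := cvg_mul_bounded (s0 _ c2) (fun n => mom_bound j n n.+2).
have L := limD (@mom_walks j 0) (limB e1 e2).
rewrite subrr addr0 in L; apply: cvg_ext L => n; rewrite !addn0 addn1 addn2.
have cZ (c : R) m k : continuous (fun x : R => c * (x ^+ j * ((p k).[x] * (p m).[x]))).
  by apply: contM; [exact: cst_continuous|exact: cont_mom].
transitivity (\int[mu]_x (a n.+1 ^+ 2 * (x ^+ j * ((p n.+1).[x] * (p n.+1).[x])) - a n.+1 * a n.+2 * (x ^+ j * ((p n).[x] * (p n.+2).[x])))).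
  rewrite (intB supp) // !(intZ supp); try exact: cont_mom.
  rewrite -!/(mom _ _ _); ring.
by apply: eq_Rintegral => x _; rewrite /turan; ring.
Qed.

Lemma turan_poly (q : {poly R}) : \int[mu]_x (q.[x] * turan n x) @[n --> \oo] -->
   (semi_int (fun x : R => q.[x]) / semi_int (fun=> 1 : R)).
Proof.
suff H j : \int[mu]_x (x ^+ j * q.[x] * turan n x) @[n --> \oo] -->
   (semi_int (fun x : R => x ^+ j * q.[x]) / semi_int (fun=> 1 : R)).
  have E1 : (fun n => \int[mu]_x (x ^+ 0 * q.[x] * turan n x)) = (fun n => \int[mu]_x (q.[x] * turan n x)).
    by apply/funext => n; apply: eq_Rintegral => x _; rewrite expr0 mul1r.
  have E2 : (fun x : R => x ^+ 0 * q.[x]) = (fun x => q.[x]).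
    by apply/funext => x; rewrite expr0 mul1r.
  by have := H 0%N; rewrite E1 E2.
elim/poly_ind: q j => [|q c IH] j.
  rewrite (_ : semi_int _ = semi_int (fun x => 0 * x ^+ 0)); last first.
    by congr semi_int; apply/funext => x; rewrite horner0; ring.
  rewrite semi_intZ ?mul0r; last exact: contX.
  rewrite [X in X @ _](_ : _ = fun=> 0); first exact: cvg_cst.
  apply/funext => n; transitivity (\int[mu]_x (0 * x ^+ 0)); last by rewrite (intZ supp) ?mul0r //; exact: contX.
  by apply: eq_Rintegral => x _; rewrite horner0; ring.
have cq : continuous (fun x : R => x ^+ j.+1 * q.[x]).
  by apply: contM; [exact: contX|exact: continuous_horner].
have cc : continuous (fun x : R => c * x ^+ j).
  by apply: contM; [exact: cst_continuous|exact: contX].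
rewrite (_ : semi_int _ = semi_int (fun x => x ^+ j.+1 * q.[x] + c * x ^+ j)); last first.
  by congr semi_int; apply/funext => x; rewrite !hornerE exprS; ring.
rewrite semi_intD // semi_intZ //; last exact: contX.
rewrite mulrDl -mulrA.
have cT n : continuous (fun x : R => x ^+ j * turan n x).
  by apply: contM; [exact: contX|exact: cont_turan].
have L := limD (IH j.+1) (limZ (c := c) (@turan_monomial j)).
apply: cvg_ext L => n; rewrite -(intZ supp) // -(intD supp); last 2 first.
- by apply: contM => //; exact: cont_turan.
- by apply: contM => //; exact: cst_continuous.
have H (y : R) : y ^+ j.+1 * q.[y] * turan n y + c * (y ^+ j * turan n y) =
  y ^+ j * (q * 'X + c%:P).[y] * turan n y by rewrite hornerD hornerM hornerX hornerC exprS; move: (turan n y) => T; ring.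
by apply: eq_Rintegral => x _; exact: H.
Qed.

Lemma turan_bound : exists2 K : R, 0 < K & forall n, \int[mu]_x `|turan n x| <= K.
Proof.
have [Ma [Ma0 aM]] : exists Ma, 0 <= Ma /\ forall n, `|a n| <= Ma.
  have : bounded_fun a := cvg_seq_bounded (cvgP _ cva).
  by case=> M [_ /(_ (`|M| + 1))] H; exists (`|M| + 1); split => [|n]; [exact: addr_ge0|apply: H => //; rewrite ltr_pwDr // ler_norm].
exists (2 * Ma ^+ 2 + 1); first by rewrite ltr_wpDl // mulr_ge0 // sqr_ge0.
move=> n; apply: (@le_trans _ _ (2 * Ma ^+ 2)); last by rewrite lerDl.
have cN : continuous (fun x : R => `|turan n x|).
  by move=> x; apply: continuous_comp; [exact: cont_turan|exact: norm_continuous].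
pose h x := Ma ^+ 2 / 2 * (2 * (x ^+ 0 * ((p n.+1).[x] * (p n.+1).[x])) + ((x ^+ 0 * ((p n).[x] * (p n).[x])) + (x ^+ 0 * ((p n.+2).[x] * (p n.+2).[x])))).
have ch0 : continuous (fun x : R => 2 * (x ^+ 0 * ((p n.+1).[x] * (p n.+1).[x]))).
  by apply: contM; [exact: cst_continuous|exact: cont_mom].
have ch1 : continuous (fun x : R => (x ^+ 0 * ((p n).[x] * (p n).[x])) + (x ^+ 0 * ((p n.+2).[x] * (p n.+2).[x]))).
  by apply: contD; exact: cont_mom.
have ch2 := contD ch0 ch1.
have ch : continuous h by apply: contM => //; exact: cst_continuous.
apply: (@le_trans _ _ (\int[mu]_x h x)); last first.
  rewrite (intZ supp) // (intD supp) // (intZ supp); last exact: cont_mom.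
  rewrite (intD supp); try exact: cont_mom.
  rewrite -!/(mom _ _ _) !mom0 !eqxx (_ : true%:R = 1 :> R) //; lra.
apply: (le_cont_integral supp) => // x _; rewrite /h /turan !expr0 !mul1r.
have A1 : `|a n.+1 ^+ 2| <= Ma ^+ 2 by rewrite normrX lerXn2r ?nnegrE.
have A2 : `|a n.+1 * a n.+2| <= Ma ^+ 2 by rewrite normrM expr2; apply: ler_pM.
apply: (le_trans (ler_normB _ _)); rewrite !normrM.
set u := (p n).[x]; set v := (p n.+1).[x]; set w := (p n.+2).[x].
rewrite -!expr2 !real_normK ?num_real //.
have H1 : a n.+1 ^+ 2 <= Ma ^+ 2 by apply: le_trans A1; rewrite ler_norm.
have H2 : `|u| * `|w| <= (u ^+ 2 + w ^+ 2) / 2.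
  rewrite -(real_normK (num_real u)) -(real_normK (num_real w)).
  by have := sqr_ge0 (`|u| - `|w|); nra.
apply: (@le_trans _ _ (Ma ^+ 2 * v ^+ 2 + Ma ^+ 2 * ((u ^+ 2 + w ^+ 2) / 2))).
  apply: lerD; first by apply: ler_wpM2r => //; exact: sqr_ge0.
  by rewrite -normrM; apply: ler_pM => //; exact: mulr_ge0.
by rewrite le_eqVlt; apply/orP; left; apply/eqP; field.
Qed.

(** Convergence passes from polynomials to uniform limits of polynomials,
    the total masses of [turan n dmu] being bounded. *)
Lemma turan_approx (g : R -> R) : continuous g ->
  (forall eta, 0 < eta -> exists q : {poly R}, forall x, - B <= x <= B -> `|g x - q.[x]| <= eta) ->
  \int[mu]_x (g x * turan n x) @[n --> \oo] --> (semi_int g / semi_int (fun=> 1 : R)).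
Proof.
move=> cg app; have [K K0 hK] := turan_bound.
have s1 := @semi_int1_gt0 R.
apply/cvgrPdist_le => e e0.
pose eta := e / (2 * (K + 1)).
have eta0 : 0 < eta by rewrite divr_gt0 // mulr_gt0 // ltr_wpDr.
have [q hq] := app _ eta0.
have cq : continuous (fun x => q.[x]) by exact: continuous_horner.
have e2 : 0 < e / 2 by rewrite divr_gt0.
have := @turan_poly q; move/cvgrPdist_le => /(_ _ e2); apply: filterS => n Hn.
have D1 : `|semi_int g / semi_int (fun=> 1) - semi_int (fun x => q.[x]) / semi_int (fun=> 1)| <= eta.
  rewrite -mulrBl normrM normfV (gtr0_norm s1) ler_pdivrMr //.
  have cE (c : R) : continuous (fun _ : R => c * 1) by apply: contM; exact: cst_continuous.
  have U := le_semi_int (h1 := g) (h2 := fun x => q.[x] + eta * 1) cg.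
  have V := le_semi_int (h1 := fun x => q.[x]) (h2 := fun x => g x + eta * 1) cq.
  have {U} := U (contD cq (cE eta)); have {V} := V (contD cg (cE eta)).
  rewrite !semi_intD // !semi_intZ; try exact: cst_continuous.
  move=> V U.
  have hB x : -2 <= x <= 2 -> - B <= x <= B by move: B2 => ? /andP[? ?]; apply/andP; split; lra.
  have {}U : semi_int g <= semi_int (fun x => q.[x]) + eta * semi_int (fun=> 1).
    by apply: U => x /hB /hq; rewrite ler_norml => /andP[? ?]; lra.
  have {}V : semi_int (fun x => q.[x]) <= semi_int g + eta * semi_int (fun=> 1).
    by apply: V => x /hB /hq; rewrite ler_norml => /andP[? ?]; lra.
  by rewrite ler_norml; apply/andP; split; lra.
have D2 : `|\int[mu]_x (q.[x] * turan n x) - \int[mu]_x (g x * turan n x)| <= eta * K.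
  have c1 : continuous (fun x => q.[x] * turan n x) by apply: contM => //; exact: cont_turan.
  have c2 : continuous (fun x => g x * turan n x) by apply: contM => //; exact: cont_turan.
  have cN : continuous (fun x : R => `|turan n x|).
    by move=> x; apply: continuous_comp; [exact: cont_turan|exact: norm_continuous].
  have c3 : continuous (fun x => eta * `|turan n x|) by apply: contM => //; exact: cst_continuous.
  apply: (@le_trans _ _ (eta * \int[mu]_x `|turan n x|)); last by rewrite ler_pM2l.
  have key x : - B <= x <= B -> `|q.[x] * turan n x - g x * turan n x| <= eta * `|turan n x|.
    by move=> /hq; rewrite -mulrBl normrM distrC => H; apply: ler_wpM2r.
  rewrite -(intZ supp) // ler_norml; apply/andP; split.
  - rewrite lerNl opprB lerBlDl -(intD supp) //; apply: (le_cont_integral supp) => //; first exact: contD.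
    by move=> x /key; rewrite ler_norml => /andP[? ?]; lra.
  - rewrite lerBlDl -(intD supp) //; apply: (le_cont_integral supp) => //; first exact: contD.
    by move=> x /key; rewrite ler_norml => /andP[? ?]; lra.
have EE : e = e / 2 + (eta + eta * K).
  by rewrite /eta; field; rewrite gt_eqF // ltr_wpDr.
rewrite EE; set A := semi_int g / _ in D1 *; set T := \int[mu]_x (g x * _) in D2 *.
set A' := semi_int _ / _ in D1 Hn; set T' := Rintegral _ _ _ in D2 Hn.
have -> : A - T = (A' - T') + ((A - A') + (T' - T)) by ring.
by apply: (le_trans (ler_normD _ _)); apply: lerD => //; apply: (le_trans (ler_normD _ _)); apply: lerD.
Qed.

End Limit.

(** * Tent functions *)

Lemma outside_itv {R : realType} (x0 r x : R) : 0 < r -> x < x0 - r \/ x0 + r < x -> r <= `|x - x0|.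
Proof. by move=> r0 [] ?; [rewrite ltr0_norm|rewrite gtr0_norm]; lra. Qed.

Section Tent.
Context {R : realType}.
Implicit Types (x y c r : R).

(** The monotone iteration [q + (y^2 - q^2) / 2] towards [|y|] on the unit
    interval. *)
Fixpoint abs_poly (n : nat) : {poly R} :=
  if n is m.+1 then abs_poly m + 2^-1 *: ('X^2 - abs_poly m ^+ 2) else 0.

Lemma abs_poly_step (t q P : R) : 0 <= t -> t <= 1 -> 0 <= q -> q <= t -> t - q <= t * P ->
  t - (q + 2^-1 * (t ^+ 2 - q ^+ 2)) <= t * ((1 - t / 2) * P).
Proof.
move=> t0 t1 q0 qt H.
have h0 : 0 <= 1 - t / 2 by lra.
have := ler_wpM2r h0 H => H2.
have -> : t - (q + 2^-1 * (t ^+ 2 - q ^+ 2)) = (t - q) * (1 - (t + q) / 2) by field.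
nra.
Qed.

Lemma abs_poly_bound n y : `|y| <= 1 ->
  0 <= (abs_poly n).[y] <= `|y| /\ `|y| - (abs_poly n).[y] <= `|y| * (1 - `|y| / 2) ^+ n.
Proof.
move=> y1; have y0 := normr_ge0 y.
elim: n => [|n [/andP[IH0 IH1] IH2]] /=.
  by rewrite horner0 lexx y0 subr0 expr0 mulr1.
rewrite !hornerE -(real_normK (num_real y)).
move: IH0 IH1 IH2; move: ((abs_poly n).[y]) => q IH0 IH1 IH2.
split; first by apply/andP; split; nra.
by rewrite [X in _ <= _ * X]exprS; apply: (@abs_poly_step (`|y|) q _ y0 y1 IH0 IH1 IH2).
Qed.

Lemma pow_decay (t : R) n : 0 <= t <= 1 -> t * (1 - t / 2) ^+ n <= 2 / n.+1%:R.
Proof.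
move=> /andP[t0 t1].
have H : (1 - t / 2) ^+ n * (1 + n%:R * (t / 2)) <= 1.
  elim: n => [|n IH]; first by rewrite expr0 mul0r addr0 mulr1.
  have n0 : 0 <= n%:R :> R by [].
  have P0 : 0 <= (1 - t / 2) ^+ n by apply: exprn_ge0; lra.
  rewrite exprS -[n.+1]addn1 natrD.
  have H : (1 - t / 2) * (1 + (n%:R + 1) * (t / 2)) <= 1 + n%:R * (t / 2) by nra.
  by have := ler_wpM2l P0 H; lra.
have P0 : 0 <= (1 - t / 2) ^+ n by apply: exprn_ge0; lra.
have P1 : (1 - t / 2) ^+ n <= 1 by apply: exprn_ile1; lra.
rewrite ler_pdivlMr // -addn1 natrD; have n0 : 0 <= n%:R :> R by []; nra.
Qed.

Lemma abs_approx (L eta : R) : 0 < L -> 0 < eta ->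
  exists q : {poly R}, forall y, `|y| <= L -> `| `|y| - q.[y] | <= eta.
Proof.
move=> L0 eta0.
have [n Hn] : exists n : nat, 2 * L / eta <= n.+1%:R.
  exists (Num.truncn (2 * L / eta)); apply/ltW/truncnS_gt.
exists (L *: (abs_poly n \Po (L^-1 *: 'X))) => y yL.
rewrite hornerZ horner_comp hornerZ hornerX.
have y1 : `|L^-1 * y| <= 1.
  by rewrite normrM normfV (gtr0_norm L0) mulrC ler_pdivrMr // mul1r.
have [/andP[H0 H1] H2] := abs_poly_bound n y1.
have H3 := pow_decay n (introT andP (conj (normr_ge0 (L^-1 * y)) y1)).
have -> : `|y| = L * `|L^-1 * y| by rewrite normrM normfV (gtr0_norm L0) mulVKf // gt_eqF.
set z := `|L^-1 * y| in H0 H1 H2 H3 *; set q := _.[_] in H0 H1 H2 *.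
rewrite -mulrBr normrM (gtr0_norm L0) ger0_norm; last by rewrite subr_ge0.
apply: (@le_trans _ _ (L * (2 / n.+1%:R))).
  by rewrite ler_pM2l //; apply: le_trans H2 H3.
rewrite mulrA ler_pdivrMr // mulrC (mulrC eta).
by move: Hn; rewrite ler_pdivrMr.
Qed.

(** The hat of height 1 over the interval of centre [c] and radius [r]. As a
    combination of three absolute values it inherits their approximation by
    polynomials. *)
Definition tent c r x : R := (`|x - c - r| + `|x - c + r| - 2 * `|x - c|) / (2 * r).

Lemma tent_cont c r : continuous (tent c r).
Proof.
have cN (d : R) : continuous (fun x : R => `|x - d|).
  move=> x; apply: (@continuous_comp _ _ _ (fun x : R => x - d)); last exact: norm_continuous.
  by apply: cvgB; [exact: cvg_id|exact: cvg_cst].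
move=> x; apply: cvgM; last exact: cvg_cst.
have E1 : (fun x : R => `|x - c - r|) = (fun x => `|x - (c + r)|) by apply/funext => y; rewrite opprD addrA.
have E2 : (fun x : R => `|x - c + r|) = (fun x => `|x - (c - r)|) by apply/funext => y; rewrite opprB addrA addrAC.
have H1 := cN (c + r); rewrite -E1 in H1.
have H2 := cN (c - r); rewrite -E2 in H2.
apply: cvgB; first apply: cvgD.
- exact: H1.
- exact: H2.
- by apply: cvgM; [exact: cvg_cst|exact: cN].
Qed.

Lemma tentP c r x : 0 < r -> 0 <= tent c r x <= 1.
Proof.
move=> r0; rewrite /tent ler_pdivlMr ?ler_pdivrMr ?mulr_gt0 // mul0r mul1r.
case: (ler0P (x - c - r)) => ?; case: (ler0P (x - c + r)) => ?; case: (ler0P (x - c)) => ?; apply/andP; split; lra.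
Qed.

Lemma tent_out c r x : 0 < r -> r <= `|x - c| -> tent c r x = 0.
Proof.
move=> r0 h; rewrite /tent (_ : _ - _ = 0) ?mul0r //.
move: h; case: (ler0P (x - c - r)) => ?; case: (ler0P (x - c + r)) => ?; case: (ler0P (x - c)) => ? ?; lra.
Qed.

Lemma tent_half c r x : 0 < r -> `|x - c| <= r / 2 -> 2^-1 <= tent c r x.
Proof.
move=> r0 h; rewrite /tent ler_pdivlMr ?mulr_gt0 //.
move: h; case: (ler0P (x - c - r)) => ?; case: (ler0P (x - c + r)) => ?; case: (ler0P (x - c)) => ? ?; lra.
Qed.

Lemma tent_approx c r (B : R) : 0 < r -> 0 < B -> forall eta, 0 < eta ->
  exists q : {poly R}, forall x, - B <= x <= B -> `|tent c r x - q.[x]| <= eta.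
Proof.
move=> r0 B0 eta eta0.
have L0 : 0 < B + `|c| + r by have := normr_ge0 c; lra.
have e0 : 0 < eta * r / 2 by rewrite divr_gt0 // mulr_gt0.
have [q hq] := abs_approx L0 e0.
exists ((2 * r)^-1 *: ((q \Po ('X - (c + r)%:P)) + (q \Po ('X - (c - r)%:P)) - 2 *: (q \Po ('X - c%:P)))) => x hx.
rewrite !(hornerE, horner_comp).
have xB : `|x| <= B by rewrite ler_norml.
have b1 : `|x - c - r| <= B + `|c| + r.
  apply: (le_trans (ler_normB _ _)); rewrite (gtr0_norm r0) lerD2r.
  by apply: (le_trans (ler_normB _ _)); rewrite lerD2r.
have b2 : `|x - c + r| <= B + `|c| + r.
  apply: (le_trans (ler_normD _ _)); rewrite (gtr0_norm r0) lerD2r.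
  by apply: (le_trans (ler_normB _ _)); rewrite lerD2r.
have b3 : `|x - c| <= B + `|c| + r.
  by apply: (le_trans (ler_normB _ _)); have := normr_ge0 c; lra.
have {b1} := hq _ b1; have {b2} := hq _ b2; have {b3} := hq _ b3.
rewrite (_ : x - (c + r) = x - c - r); last by ring.
rewrite (_ : x - (c - r) = x - c + r); last by ring.
rewrite /tent.
set n3 := `|x - c|; set n2 := `|x - c + r|; set n1 := `|x - c - r|.
set q3 := q.[x - c]; set q2 := q.[x - c + r]; set q1 := q.[x - c - r].
move=> b3 b2 b1.
have -> : (n1 + n2 - 2 * n3) / (2 * r) - (2 * r)^-1 * (q1 + q2 - 2 * q3) =
   ((n1 - q1) + (n2 - q2) - 2 * (n3 - q3)) / (2 * r) by field; rewrite gt_eqF.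
rewrite normrM normfV (gtr0_norm (_ : 0 < 2 * r)) ?mulr_gt0 // ler_pdivrMr ?mulr_gt0 //.
move: b1 b2 b3; rewrite !ler_norml => /andP[? ?] /andP[? ?] /andP[? ?].
by apply/andP; split; lra.
Qed.

Lemma semi_le2 x : semi x <= 2.
Proof.
rewrite /semi -[leRHS](ger0_norm (_ : 0 <= 2)) // -sqrtr_sqr ler_sqrt; last exact: sqr_ge0.
by have := sqr_ge0 x; lra.
Qed.

Notation leb := (@lebesgue_measure R).

Lemma semi_int_EFin (h : R -> R) : continuous h ->
  ((semi_int h)%:E = \int[leb]_(x in `[(-2)%R, 2%R]) (h x * semi x)%:E)%E.
Proof.
move=> ch; rewrite /semi_int /Rintegral fineK //; apply: integrable_fin_num => //.
by apply: cont_integrable_itv; apply: contM => //; exact: semi_cont.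
Qed.

Lemma leb_itv c r : 0 < r -> leb `[c - r, c + r]%classic = (2 * r)%:E.
Proof.
move=> r0; rewrite lebesgue_measure_itv /= lte_fin ifT; last by lra.
by rewrite -EFinB; congr EFin; ring.
Qed.

Lemma semi_int_tent_le c r : 0 < r -> semi_int (tent c r) <= 4 * r.
Proof.
move=> r0; rewrite -lee_fin semi_int_EFin; last exact: tent_cont.
apply: (@le_trans _ _ (\int[leb]_(x in `[(-2)%R, 2%R]) (2 * \1_(`[(c - r)%R, (c + r)%R]%classic) x)%:E)%E).
  apply: ge0_le_integral => //.
  - by move=> x _; rewrite lee_fin mulr_ge0 ?semi_ge0 //; case/andP: (tentP c x r0).
  - apply/measurable_EFinP; apply: measurable_funTS; apply: cont_meas.
    by apply: contM; [exact: tent_cont|exact: semi_cont].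
  - by apply/measurable_EFinP; apply: measurable_funM.
  - move=> x _; rewrite lee_fin indicE.
    have [xI|xI] := boolP (x \in `[c - r, c + r]%classic).
      rewrite mulr1 -[leRHS]mul1r; case/andP: (tentP c x r0) => ? ?.
      by apply: ler_pM => //; [exact: semi_ge0|exact: semi_le2].
    rewrite tent_out ?mul0r ?mulr0 //.
    move: xI; rewrite notin_setE /= in_itv /= => /negP; rewrite negb_and -!ltNge => /orP h.
    exact: outside_itv.
under eq_integral do rewrite EFinM.
rewrite ge0_integralZl //; last by apply/measurable_EFinP.
rewrite integral_indic //.
apply: (@le_trans _ _ (2%:E * leb `[(c - r)%R, (c + r)%R]%classic)%E).
  by apply: lee_wpmul2l => //; apply: le_measure; rewrite ?inE //; exact: measurableI.
by rewrite leb_itv // -EFinM lee_fin; lra.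
Qed.

Lemma semi_int_tent_ge c r m : 0 < r -> 0 <= m -> -2 <= c - r / 2 -> c + r / 2 <= 2 ->
  (forall x, `|x - c| <= r / 2 -> m <= semi x) -> m * r / 2 <= semi_int (tent c r).
Proof.
move=> r0 m0 c1 c2 hm; rewrite -lee_fin semi_int_EFin; last exact: tent_cont.
have mts : measurable_fun setT (fun x : measurableTypeR R => (tent c r x * semi x)%:E).
  apply/measurable_EFinP; apply: cont_meas.
  by apply: contM; [exact: tent_cont|exact: semi_cont].
have ts0 (x : R) : (0 <= (tent c r x * semi x)%:E)%E.
  by rewrite lee_fin mulr_ge0 ?semi_ge0 //; case/andP: (tentP c x r0).
apply: (@le_trans _ _ (\int[leb]_(x in `[(c - r / 2)%R, (c + r / 2)%R]) (tent c r x * semi x)%:E)%E); last first.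
  apply: ge0_subset_integral => //; first exact: measurable_funTS.
  by move=> x /=; rewrite !in_itv /= => /andP[? ?]; apply/andP; split; lra.
apply: (@le_trans _ _ (\int[leb]_(x in `[(c - r / 2)%R, (c + r / 2)%R]) (m / 2)%:E)%E).
  rewrite integral_cst //= leb_itv ?divr_gt0 // -EFinM lee_fin; lra.
apply: ge0_le_integral => //; try exact: measurable_funTS.
- by move=> x _; rewrite lee_fin divr_ge0.
- move=> x /=; rewrite in_itv /= => /andP[? ?]; rewrite lee_fin mulrC.
  have xr : `|x - c| <= r / 2 by rewrite ler_norml; apply/andP; split; lra.
  by apply: ler_pM => //; [exact: tent_half|exact: hm].
Qed.

End Tent.

(** * From bounds on Turan determinants to the density *)

Lemma near_value {R : realType} (T t : R) : 0 < T -> `|T - t| < T / 2 -> [/\ T / 2 <= t, 0 <= t & t <= 2 * T].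
Proof. by move=> T0; rewrite ltr_norml => /andP[? ?]; split; lra. Qed.

Lemma window_fits {R : realType} (x0 r rho : R) : 0 < r -> r < rho / 3 -> -2 <= x0 - rho /\ x0 + rho <= 2 ->
  [/\ -2 <= x0 - r / 2, x0 + r / 2 <= 2, r <= rho & 2 * r <= rho].
Proof. by move=> ? ? [? ?]; split; lra. Qed.

Section Bridge.
Context {R : realType} (mu : probability (measurableTypeR R) R) (B : R).
Hypothesis B2 : (2 : R) <= B.
Hypothesis supp : mu (~` `[- B, B]%classic) = 0%E.
Variables (p : nat -> {poly R}) (a b : nat -> R).
Hypothesis orth : orthonormal_polys mu p.
Hypothesis jac : forall n, 'X * p n =
      (if n is m.+1 then a n *: p m else 0)
      + b n.+1 *: p n + a n.+1 *: p n.+1.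
Hypothesis cva : a n @[n --> \oo] --> (1 : R).
Hypothesis cvb : b n @[n --> \oo] --> (0 : R).
Variables (x0 rho Alo Ahi : R) (n1 : nat).
Hypothesis rho0 : 0 < rho.
Hypothesis U_in : (-2 <= x0 - rho) /\ (x0 + rho <= 2).
Hypothesis Alo0 : 0 < Alo.
Hypothesis turan_bounds : forall n, (n1 <= n)%N -> forall x, `|x - x0| < rho ->
  Alo <= turan p a n x <= Ahi.

Let cw : R := semi_int (fun=> 1 : R).

Lemma tent_bounds c r : 0 < r -> `|c - x0| + r <= rho ->
  Alo * \int[mu]_x tent c r x <= semi_int (tent c r) / cw /\
  semi_int (tent c r) / cw <= Ahi * \int[mu]_x tent c r x.
Proof.
move=> r0 hc.
have B0 : 0 < B by move: B2 => ?; lra.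
have ct := @tent_cont R c r.
have L := @turan_approx _ _ _ B2 supp _ _ _ orth jac cva cvb _ ct (@tent_approx R c r B r0 B0).
have cT n : continuous (fun x : R => tent c r x * turan p a n x).
  by apply: contM => //; exact: cont_turan.
have key n : (n1 <= n)%N -> forall x, Alo * tent c r x <= tent c r x * turan p a n x <= Ahi * tent c r x.
  move=> hn x; case/andP: (tentP c x r0) => t0 t1.
  have [h|h] := ltP `|x - c| r; last by rewrite tent_out // !mulr0 mul0r lexx.
  have hx : `|x - x0| < rho.
    rewrite (_ : x - x0 = (x - c) + (c - x0)); last by ring.
    by apply: (le_lt_trans (ler_normD _ _)); lra.
  case/andP: (turan_bounds hn hx) => ? ?.
  by rewrite ![_ * tent c r x]mulrC; apply/andP; split; apply: ler_wpM2l.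
have cZ (k : R) : continuous (fun x : R => k * tent c r x).
  by apply: contM => //; exact: cst_continuous.
split.
- apply: (ler_cvg_to (cvg_cst _) L); near=> n.
  have hn : (n1 <= n)%N by near: n; exists n1.
  rewrite -(intZ supp) //; apply: (le_cont_integral supp) => // x _.
  by have /andP[] := key n hn x.
- apply: (ler_cvg_to L (cvg_cst _)); near=> n.
  have hn : (n1 <= n)%N by near: n; exists n1.
  rewrite -(intZ supp) //; apply: (le_cont_integral supp) => // x _.
  by have /andP[] := key n hn x.
Unshelve. all: by end_near.
Qed.

Lemma mu_EFin (h : R -> R) : continuous h -> (\int[mu]_x (h x)%:E)%E = (\int[mu]_x h x)%:E.
Proof.
move=> ch; rewrite /Rintegral fineK //; apply: integrable_fin_num => //.
exact: (cont_integrable supp).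
Qed.

Definition itv_const : R := 16 / (Alo * cw).

Lemma cw_gt0 : 0 < cw. Proof. exact: semi_int1_gt0. Qed.

Lemma itv_const_gt0 : 0 < itv_const.
Proof. by rewrite divr_gt0 // mulr_gt0 // cw_gt0. Qed.

(** Twice the tent of radius [2 r] dominates the indicator of the interval. *)
Lemma mu_itv_le c r : 0 < r -> `|c - x0| + 2 * r <= rho ->
  (mu `[(c - r)%R, (c + r)%R]%classic <= (itv_const * r)%:E)%E.
Proof.
move=> r0 hc; have r20 : 0 < 2 * r by rewrite mulr_gt0.
have ct := @tent_cont R c (2 * r).
have c2 : continuous (fun x : R => 2 * tent c (2 * r) x).
  by apply: contM => //; exact: cst_continuous.
apply: (@le_trans _ _ ((2 * \int[mu]_x tent c (2 * r) x)%:E)).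
  have -> : (mu `[(c - r)%R, (c + r)%R]%classic = \int[mu]_x (\1_(`[(c - r)%R, (c + r)%R]%classic) x)%:E)%E.
    by rewrite integral_indic // setIT.
  rewrite -(intZ supp) // -mu_EFin //.
  apply: ge0_le_integral => //.
  - by apply/measurable_EFinP.
  - by apply/measurable_EFinP; exact: cont_meas.
  - move=> x _; rewrite lee_fin indicE; have [xI|xI] := boolP (_ \in _).
      have := @tent_half _ c (2 * r) x r20.
      move: xI; rewrite inE /= in_itv /= => /andP[? ?].
      rewrite (_ : `|x - c| <= 2 * r / 2) => [/(_ isT)|]; first by rewrite -[true%:R]/(1 : R); lra.
      by rewrite ler_norml; apply/andP; split; lra.
    by case/andP: (tentP c x r20) => t0 t1; rewrite mulr_ge0.
rewrite lee_fin /itv_const.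
have [H _] := tent_bounds r20 hc.
have S := semi_int_tent_le c r20.
have ac : 0 < Alo * cw by rewrite mulr_gt0 // cw_gt0.
rewrite mulrAC ler_pdivlMr //.
move: H; rewrite ler_pdivlMr ?cw_gt0 // => H; nra.
Qed.

(** The interval bound, summed over a cover of small total length: the measure
    has no singular part near [x0]. *)
Lemma mu_null (A : set (measurableTypeR R)) : measurable A -> A `<=` `]x0 - rho / 3, x0 + rho / 3[%classic ->
  (@lebesgue_measure R) A = 0%E -> mu A = 0%E.
Proof.
move=> mA AU A0; apply/eqP; rewrite eq_le measure_ge0 andbT.
apply/lee_addgt0Pr => e e0; rewrite add0e.
have C0 := itv_const_gt0.
have e1 : 0 < e / itv_const by rewrite divr_gt0.
have : ((@lebesgue_measure R) A < (e / itv_const)%:E)%E by rewrite A0 lte_fin.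
rewrite /lebesgue_measure /lebesgue_stieltjes_measure /measure_extension /= /mu_ext.
move=> /ereal_inf_lt [_ [F [mF AF] <-] SF].
set U := `]x0 - rho / 3, x0 + rho / 3[%classic.
have key k : (mu (F k `&` U) <= itv_const%:E * wlength idfun (F k))%E.
  have [[u v] _ <-] := mF k.
  have [uv|vu] := ltP u v; last first.
    rewrite set_itv_ge ?set0I ?measure0 ?wlength0 ?mule0 //.
    by rewrite -leNgt /= bnd_simp.
  rewrite wlength_itv_bnd /= ?(ltW uv) //.
  pose c := Num.max u (x0 - rho / 3); pose d := Num.min v (x0 + rho / 3).
  have [cd|dc] := ltP c d; last first.
    rewrite (_ : _ `&` _ = set0) ?measure0 ?mule_ge0 //.
    - by rewrite lee_fin ltW.
    - by rewrite lee_fin subr_ge0 ltW.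
    - rewrite -subset0 => y [/=]; rewrite !in_itv /= => /andP[y1 y2] /andP[y3 y4].
      have : c < y by rewrite gt_max y1.
      have : y <= d by rewrite le_min y2 ltW.
      by move=> h1 h2; have := lt_le_trans h2 (le_trans h1 dc); rewrite ltxx.
  have cx : x0 - rho / 3 <= c by rewrite le_max lexx orbT.
  have dx : d <= x0 + rho / 3 by rewrite ge_min lexx orbT.
  have cu : u <= c by rewrite le_max lexx.
  have dv : d <= v by rewrite ge_min lexx.
  apply: (@le_trans _ _ (mu `[((c + d) / 2 - (d - c) / 2)%R, ((c + d) / 2 + (d - c) / 2)%R]%classic)).
    have -> : (c + d) / 2 - (d - c) / 2 = c by field.
    have -> : (c + d) / 2 + (d - c) / 2 = d by field.
    have mA1 : measurable (`]u, v]%classic `&` U : set (measurableTypeR R)).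
      by apply: measurableI; exact: measurable_itv.
    apply: le_measure; [by rewrite inE|by rewrite inE; exact: measurable_itv|].
    move=> y [/=]; rewrite !in_itv /= => /andP[y1 y2] /andP[y3 y4].
    by rewrite ltW ?gt_max ?y1 //= le_min y2 ltW.
  apply: (le_trans (mu_itv_le _ _)); first by lra.
    have : `|(c + d) / 2 - x0| <= rho / 3 - (d - c) / 2.
      by rewrite ler_norml; apply/andP; split; lra.
    lra.
  rewrite -EFinM lee_fin ler_pM2l //; lra.
have mFU k : measurable (F k `&` U : set (measurableTypeR R)).
  apply: measurableI; last exact: measurable_itv.
  by have [[u v] _ <-] := mF k; exact: measurable_itv.
apply: (@le_trans _ _ (\sum_(0 <= k <oo) mu (F k `&` U))%E).
  apply: measure_sigma_subadditive => // y Ay.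
  by have [k _ Fk] := AF y Ay; exists k => //; split => //; exact: AU.
apply: (@le_trans _ _ (\sum_(0 <= k <oo) (itv_const%:E * wlength idfun (F k)))%E).
  by apply: lee_nneseries => // k _; exact: key.
rewrite nneseriesZl; last by move=> k _; exact: wlength_ge0.
apply: (@le_trans _ _ (itv_const%:E * (e / itv_const)%:E)%E).
  by apply: lee_wpmul2l; [rewrite lee_fin ltW|exact: ltW].
by rewrite -EFinM lee_fin mulrC divfK ?gt_eqF.
Qed.

Variable f : R -> R.
Hypothesis f_density : ac_density mu f.
Hypothesis f_cont : {for x0, continuous f}.
Hypothesis f_gt0 : 0 < f x0.

Lemma mu_density (A : set (measurableTypeR R)) : measurable A -> A `<=` `]x0 - rho / 3, x0 + rho / 3[%classic ->
  (mu A = \int[lebesgue_measure]_(x in A) (f x)%:E)%E.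
Proof.
move=> mA AU; have [mf f0 [nu [[N [mN N0 nuN]] dec]]] := f_density.
rewrite dec // (_ : nu A = 0%E) ?adde0 //.
apply/eqP; rewrite eq_le measure_ge0 andbT.
rewrite -(setIT A) -(setUv N) setIUr.
apply: (le_trans (measureU2 _ _ _)); [exact: measurableI| |].
  by apply: measurableI => //; exact: measurableC.
rewrite [X in (_ + X)%E](_ : _ = 0%E); last first.
  apply/eqP; rewrite eq_le measure_ge0 andbT -nuN; apply: le_measure; rewrite ?inE //.
  - by apply: measurableI => //; exact: measurableC.
  - exact: measurableC.
rewrite adde0; have mAN : measurable (A `&` N) by exact: measurableI.
have H : mu (A `&` N) = 0%E.
  apply: mu_null => //; first by move=> y [/AU].
  apply/eqP; rewrite eq_le measure_ge0 andbT -N0; apply: le_measure; rewrite ?inE //.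
by rewrite -H dec //; apply: leeDr; apply: integral_ge0 => x _; rewrite lee_fin.
Qed.

(** Both inequalities compare the mean of [f] over a small interval around [x0]
    with the value at [x0]. *)
Lemma density_bounds : f x0 <= itv_const /\ semi x0 / (16 * cw) <= Ahi * f x0.
Proof.
have [mf f0 _] := f_density.
have f2 : 0 < f x0 / 2 by rewrite divr_gt0.
have x0I : x0 \in `](-2), 2[ by rewrite in_itv /=; move: rho0; case: U_in => ? ? ?; apply/andP; split; lra.
have s0 := semi_gt0 x0I.
have s2 : 0 < semi x0 / 2 by rewrite divr_gt0.
have [r1 r10 hr1] : exists2 r : R, 0 < r & forall y, `|y - x0| < r -> `|f x0 - f y| < f x0 / 2.
  move/cvgrPdist_lt : f_cont => /(_ _ f2) /nbhs_ballP [r /= r0 hr].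
  by exists r => // y hy; apply: hr; rewrite /ball /= distrC.
have [r2 r20 hr2] : exists2 r : R, 0 < r & forall y, `|y - x0| < r -> `|semi x0 - semi y| < semi x0 / 2.
  move/cvgrPdist_lt : (@semi_cont R x0) => /(_ _ s2) /nbhs_ballP [r /= r0 hr].
  by exists r => // y hy; apply: hr; rewrite /ball /= distrC.
have [r [r0 rr1 rr2 rr3]] : exists r : R, [/\ 0 < r, r < r1, r < r2 & r < rho / 3].
  pose m := Num.min r1 (Num.min r2 (rho / 3)).
  have m0 : 0 < m by rewrite !lt_min r10 r20 divr_gt0.
  exists (m / 2); have : m <= r1 by rewrite ge_min lexx.
  have : m <= r2 by rewrite !ge_min lexx orbT.
  have : m <= rho / 3 by rewrite !ge_min lexx !orbT.
  by move=> ? ? ?; split; lra.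
have [w1 w2 w3 w4] := window_fits r0 rr3 U_in.
pose I : set (measurableTypeR R) := `[x0 - r, x0 + r]%classic.
have mI : measurable I by exact: measurable_itv.
have IU : I `<=` `]x0 - rho / 3, x0 + rho / 3[%classic.
  by move=> y; rewrite /I /= !in_itv /= => /andP[? ?]; apply/andP; split; lra.
have fI y : I y -> f x0 / 2 <= f y <= 2 * f x0.
  rewrite /I /= in_itv /= => /andP[? ?].
  have : `|y - x0| < r1 by rewrite ltr_norml; apply/andP; split; lra.
  by move/hr1/(near_value f_gt0) => [? _ ?]; apply/andP.
have muI := mu_density mI IU.
have lebI : (@lebesgue_measure R) I = (2 * r)%:E by exact: leb_itv.
have mfI : measurable_fun I (fun x : measurableTypeR R => (f x)%:E).
  by apply/measurable_EFinP; exact: measurable_funTS.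
have lo : ((f x0 * r)%:E <= mu I)%E.
  rewrite muI; apply: (@le_trans _ _ (\int[lebesgue_measure]_(x in I) (f x0 / 2)%:E)%E).
    by rewrite integral_cst //= lebI -EFinM lee_fin; lra.
  apply: ge0_le_integral => //; first by move=> x _; rewrite lee_fin ltW.
  by move=> x /fI /andP[].
have hi : (mu I <= (4 * f x0 * r)%:E)%E.
  rewrite muI; apply: (@le_trans _ _ (\int[lebesgue_measure]_(x in I) (2 * f x0)%:E)%E).
    by apply: ge0_le_integral => // [x _|x /fI /andP[]]; rewrite lee_fin.
  by rewrite integral_cst //= lebI -EFinM lee_fin; lra.
split.
  have := mu_itv_le r0 (_ : `|x0 - x0| + 2 * r <= rho); rewrite subrr normr0 => /(_ _).
  move=> H; have {}H := H (_ : 0 + 2 * r <= rho).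
  have {}H := le_trans lo (H _); move: H; rewrite add0r => /(_ w4) H.
  by move: H; rewrite lee_fin ler_pM2r //.
have hc : `|x0 - x0| + r <= rho by rewrite subrr normr0 add0r.
have [_ H] := tent_bounds r0 hc.
have T : \int[mu]_x tent x0 r x <= 4 * f x0 * r.
  rewrite -lee_fin -mu_EFin; last exact: tent_cont.
  apply: le_trans hi.
  have -> : mu I = (\int[mu]_x (\1_I x)%:E)%E by rewrite integral_indic // setIT.
  apply: ge0_le_integral => //.
  - by move=> x _; rewrite lee_fin; case/andP: (tentP x0 x r0).
  - by apply/measurable_EFinP; apply: cont_meas; exact: tent_cont.
  - by apply/measurable_EFinP.
  - move=> x _; rewrite lee_fin indicE; have [xI|xI] := boolP (_ \in _).
      by case/andP: (tentP x0 x r0).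
    rewrite tent_out //.
    move: xI; rewrite notin_setE /I /= in_itv /= => /negP; rewrite negb_and -!ltNge => /orP h.
    exact: outside_itv.
have S : semi x0 / 2 * r / 2 <= semi_int (tent x0 r).
  apply: semi_int_tent_ge => //; first by rewrite ltW.
  move=> y hy; have /hr2/(near_value s0)[] // : `|y - x0| < r2.
  by apply: le_lt_trans hy (lt_trans _ rr2); rewrite ltr_pdivrMr // ltr_pMr // ltr1n.
have cw0 := cw_gt0.
have Ahi0 : 0 < Ahi.
  have h0 : `|x0 - x0| < rho by rewrite subrr normr0.
  have /andP[] := turan_bounds (leqnn n1) h0.
  by move=> h1 h2; apply: lt_le_trans Alo0 (le_trans h1 h2).
move: H; rewrite ler_pdivrMr // => H.
rewrite ler_pdivrMr ?mulr_gt0 //.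
have H2 : semi x0 / 2 * r / 2 <= Ahi * (4 * f x0 * r) * cw.
  apply: (le_trans S); apply: (le_trans H); rewrite ler_pM2r // ler_pM2l //.
have := H2; rewrite -subr_ge0.
rewrite (_ : _ - _ = r * (4 * Ahi * f x0 * cw - semi x0 / 4)); last by field.
by rewrite pmulr_rge0 // => ?; lra.
Qed.

End Bridge.

(** * Square-summable values force a point mass *)

Section PointMass.
Context {R : realType} (mu : probability (measurableTypeR R) R) (B : R).
Hypothesis supp : mu (~` `[- B, B]%classic) = 0%E.
Variables (p : nat -> {poly R}) (a b : nat -> R).
Hypothesis orth : orthonormal_polys mu p.
Hypothesis jac : forall n, 'X * p n =
      (if n is m.+1 then a n *: p m else 0)
      + b n.+1 *: p n + a n.+1 *: p n.+1.
Variable E : R.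

(** The Christoffel-Darboux kernel at the point [E]. *)
Fixpoint cd_kernel (n : nat) : {poly R} :=
  if n is m.+1 then cd_kernel m + (p m).[E] *: p m else 0.

Let I (q : {poly R}) : R := \int[mu]_x q.[x].

Lemma ID (q r : {poly R}) : I (q + r) = I q + I r.
Proof.
rewrite /I -(intD supp); try exact: continuous_horner.
by apply: eq_Rintegral => x _; rewrite hornerD.
Qed.

Lemma IZ c (q : {poly R}) : I (c *: q) = c * I q.
Proof.
rewrite /I -(intZ supp); try exact: continuous_horner.
by apply: eq_Rintegral => x _; rewrite hornerZ.
Qed.

Lemma Ipp m n : I (p m * p n) = (m == n)%:R.
Proof.
have [_ _ _ H] := orth.
by rewrite /I /Rintegral; under eq_integral do rewrite hornerM; rewrite H.
Qed.

Lemma I_kernel_p n m : (m < n)%N -> I (cd_kernel n * p m) = (p m).[E].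
Proof.
suff H k : I (cd_kernel k * p m) = if (m < k)%N then (p m).[E] else 0 by rewrite H => ->.
elim: k => [|k IH] /=; first by rewrite mul0r -(scale0r (p m)) IZ mul0r.
rewrite mulrDl ID IH -scalerAl IZ Ipp ltnS.
case: (ltngtP m k) => [mk|mk|mk]; rewrite ?mulr0 ?addr0 // add0r mulr1.
by rewrite mk.
Qed.

Lemma I_kernel_p_ge n m : (n <= m)%N -> I (cd_kernel n * p m) = 0.
Proof.
elim: n => [|n IH] /= nm; first by rewrite mul0r -(scale0r (p m)) IZ mul0r.
rewrite mulrDl ID IH; last exact: ltnW.
by rewrite -scalerAl IZ Ipp (ltn_eqF nm) mulr0 addr0.
Qed.

Lemma I_kernel_sqr n : I (cd_kernel n * cd_kernel n) = \sum_(k < n) (p k).[E] ^+ 2.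
Proof.
elim: n => [|n IH] /=; first by rewrite big_ord0 mul0r -(scale0r (p 0)) IZ mul0r.
rewrite mulrDl !mulrDr !ID IH big_ord_recr /= -!scalerAr -!scalerAl !IZ.
by rewrite (mulrC (p n) (cd_kernel n)) !I_kernel_p_ge // Ipp eqxx !mulr0 add0r addr0 mulr1 expr2.
Qed.

Lemma christoffel_darboux n : ('X - E%:P) * cd_kernel n.+1 =
  a n.+1 *: ((p n).[E] *: p n.+1 - (p n.+1).[E] *: p n).
Proof.
elim: n => [|n IH].
  have p0 : p 0 = 1 by case: orth.
  have j0 := jac 0; rewrite add0r in j0.
  have jE : E * (p 0).[E] = b 1 * (p 0).[E] + a 1 * (p 1).[E].
    by have /(congr1 (fun q : {poly R} => q.[E])) := j0; rewrite !(hornerD, hornerM, hornerZ, hornerX).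
  rewrite /= add0r -scalerAr mulrBl j0 mul_polyC !scalerBr !scalerDr !scalerA.
  rewrite p0 hornerC in jE *.
  rewrite [(1 * E) *: _](_ : _ = (b 1) *: 1 + (a 1 * (p 1).[E]) *: 1); last first.
    by rewrite -scalerDl mul1r; congr (_ *: _); move: jE; rewrite !mulr1.
  by rewrite !mul1r !mulr1 opprD addrACA subrr add0r.
have jn := jac n.+1.
have jE : E * (p n.+1).[E] = a n.+1 * (p n).[E] + b n.+2 * (p n.+1).[E] + a n.+2 * (p n.+2).[E].
  by have /(congr1 (fun q : {poly R} => q.[E])) := jn; rewrite !(hornerD, hornerM, hornerZ, hornerX).
rewrite [cd_kernel _]/= -/(cd_kernel n.+1) mulrDr IH -scalerAr mulrBl jn.
rewrite -!mul_polyC.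
have jP : E%:P * ((p n.+1).[E])%:P = (a n.+1)%:P * ((p n).[E])%:P + (b n.+2)%:P * ((p n.+1).[E])%:P + (a n.+2)%:P * ((p n.+2).[E])%:P.
  by rewrite -!polyCM -!polyCD jE.
have e : ((p n.+1).[E])%:P * (E%:P * p n.+1) = (E%:P * ((p n.+1).[E])%:P) * p n.+1 by ring.
rewrite [((p n.+1).[E])%:P * (_ - E%:P * _)]mulrBr e jP; ring.
Qed.

Lemma I_cd_sqr n : I ((('X - E%:P) * cd_kernel n.+1) * (('X - E%:P) * cd_kernel n.+1)) =
  a n.+1 ^+ 2 * ((p n).[E] ^+ 2 + (p n.+1).[E] ^+ 2).
Proof.
rewrite christoffel_darboux -!mul_polyC.
set u := (p n).[E]; set v := (p n.+1).[E]; set P := p n; set Q := p n.+1; set A := a n.+1.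
have -> : A%:P * (u%:P * Q - v%:P * P) * (A%:P * (u%:P * Q - v%:P * P)) =
  (A * A * (u * u)) *: (Q * Q) + ((A * A * (v * v)) *: (P * P) + (- (A * A * u * v + A * A * u * v)) *: (P * Q)).
  rewrite -!mul_polyC polyCN polyCD !polyCM; ring.
rewrite !ID !IZ !Ipp !eqxx (_ : (n == n.+1) = false); last by apply/negbTE; rewrite neq_ltn ltnSn.
by rewrite mulr0 addr0 !mulr1 -mulrDr !expr2.
Qed.

(** A continuous approximation, from above, of the indicator of [E]. *)
Definition bump (m : nat) (x : R) : R := (1 + m%:R * (x - E) ^+ 2)^-1.

Lemma bump_den m x : 0 < 1 + m%:R * (x - E) ^+ 2 :> R.
Proof. by rewrite ltr_wpDr // mulr_ge0 // sqr_ge0. Qed.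

Lemma bump_cont m : continuous (bump m).
Proof.
move=> x; apply: cvgV; first by rewrite gt_eqF // bump_den.
have E1 : (fun x : R => 1 + m%:R * (x - E) ^+ 2) = horner (1 + m%:R *: ('X - E%:P) ^+ 2).
  by apply/funext => y; rewrite !hornerE.
have H := @continuous_horner R (1 + m%:R *: ('X - E%:P) ^+ 2).
by rewrite -E1 in H; exact: H.
Qed.

Lemma bump_lim : mu [set E] = 0%E -> (\int[mu]_x (bump m x)%:E)%E @[m --> \oo] --> (0%E : \bar R).
Proof.
move=> muE.
have H := @dominated_cvg _ _ R mu setT measurableT (fun m x => (bump m x)%:E) (fun x => (\1_[set E] x)%:E) (fun=> 1%:E).
have -> : (0%E : \bar R) = (\int[mu]_x (\1_[set E] x)%:E)%E by rewrite integral_indic // setIT.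
apply: H => //.
- by move=> m; apply/measurable_EFinP; apply: cont_meas; exact: bump_cont.
- move=> x _; apply/cvg_EFin; first by apply: nearW.
  have [->|xE] := eqVneq x E.
    rewrite indicE mem_set //; apply: (@cvg_ext _ (fun=> 1)); last exact: cvg_cst.
    by move=> n; rewrite /bump subrr expr0n /= mulr0 addr0 invr1.
  rewrite indicE memNset; last by move=> /= /eqP; rewrite (negPf xE).
  have d0 : 0 < (x - E) ^+ 2 by rewrite lt_def sqrf_eq0 subr_eq0 xE sqr_ge0.
  apply/cvgr0Pnorm_le => e e0.
  exists (Num.truncn ((x - E) ^- 2 / e)).+1 => // n /= hn.
  have den := bump_den n x; have den0 := ltW den.
  rewrite /bump ger0_norm ?invr_ge0 // -[e]invrK lef_pV2 ?posrE ?invr_gt0 //.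
  have : (x - E) ^- 2 / e <= n%:R by apply: le_trans (ltW (truncnS_gt _)) _; rewrite ler_nat.
  rewrite mulrC ler_pdivrMr // => h.
  by apply: (le_trans h); rewrite lerDr.
- by apply/integrableP; split => //; rewrite integral_cst //= normr1 mul1e probability_setT ltry.
- move=> n x _; rewrite /= lee_fin.
  have den := bump_den n x; have den0 := ltW den.
  by rewrite ger0_norm ?invr_ge0 // invf_le1 // lerDl mulr_ge0 // sqr_ge0.
Qed.

(** The kernel [K n] has integral 1 against [mu]. Without mass at [E] this
    contradicts the Cauchy-Schwarz inequality with weight [bump m]: the squared
    norm of [K n] stays bounded, that of [(x - E) K n] is small along a
    subsequence by the Christoffel-Darboux formula, and [bump m] has small
    integral. *)
Lemma summable_mass (S : R) : (forall n, \sum_(k < n) (p k).[E] ^+ 2 <= S) ->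
  (forall e, 0 < e -> exists n, a n.+1 ^+ 2 * ((p n).[E] ^+ 2 + (p n.+1).[E] ^+ 2) <= e) ->
  mu [set E] <> 0%E.
Proof.
move=> hS hdec muE.
have S0 : 0 <= S by have := hS 0; rewrite big_ord0.
pose eta : R := (4 * (S + 1))^-1.
have eta0 : 0 < eta by rewrite invr_gt0 mulr_gt0 // ltr_wpDl.
have etaS : eta * S <= 4^-1.
  by rewrite /eta mulrC ler_pdivrMr ?mulr_gt0 ?ltr_wpDl //; lra.
have [m hm] : exists m, \int[mu]_x bump m x <= eta.
  have := bump_lim muE => /fine_cvgP [_] /cvgrPdist_le /(_ _ eta0) [m _ /(_ m (leqnn m))] /=.
  by rewrite sub0r normrN => h; exists m; apply: le_trans (ler_norm _) h.
clear muE.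
have e1 : 0 < (4 * eta * (m%:R + 1))^-1 by rewrite invr_gt0 !mulr_gt0 // ltr_wpDl.
have [n hn] := hdec _ e1.
pose K := cd_kernel n.+1.
have cK : continuous (fun x : R => (K * K).[x]) by exact: continuous_horner.
have cK2 : continuous (fun x : R => ((('X - E%:P) * K) * (('X - E%:P) * K)).[x]) by exact: continuous_horner.
have h1 : I K = 1.
  have p0 : p 0 = 1 by case: orth.
  by rewrite -[K]mulr1 -p0 I_kernel_p // p0 hornerC.
have c1 : continuous (fun x : R => (4 * eta)^-1 * bump m x).
  by apply: contM; [exact: cst_continuous|exact: bump_cont].
have c2 : continuous (fun x : R => eta * (K * K).[x]).
  by apply: contM => //; exact: cst_continuous.
have c3 : continuous (fun x : R => eta * m%:R * ((('X - E%:P) * K) * (('X - E%:P) * K)).[x]).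
  by apply: contM => //; exact: cst_continuous.
(* The difference of the two sides is [eta d (K - (2 eta d)^-1) ^ 2], with
     [d] the inverse of the bump. *)
have key (x : R) : K.[x] <= (4 * eta)^-1 * bump m x + (eta * (K * K).[x] + eta * m%:R * ((('X - E%:P) * K) * (('X - E%:P) * K)).[x]).
  rewrite !hornerM hornerXsubC /bump.
  set d := 1 + _; have d0 : 0 < d := bump_den m x.
  have -> : eta * (K.[x] * K.[x]) + eta * m%:R * ((x - E) * K.[x] * ((x - E) * K.[x])) = eta * d * K.[x] ^+ 2 by rewrite /d; ring.
  rewrite -invfM -subr_ge0.
  have -> : (4 * eta * d)^-1 + eta * d * K.[x] ^+ 2 - K.[x] = (eta * d) * (K.[x] - (2 * eta * d)^-1) ^+ 2.
    by field; rewrite !gt_eqF.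
  by rewrite mulr_ge0 ?sqr_ge0 // mulr_ge0 // ltW.
have : I K <= (4 * eta)^-1 * \int[mu]_x bump m x + (eta * I (K * K) + eta * m%:R * I ((('X - E%:P) * K) * (('X - E%:P) * K))).
  rewrite /I -!(intZ supp) //; last exact: bump_cont.
  rewrite -!(intD supp) //; last exact: contD.
  apply: (le_cont_integral supp) => //; first exact: continuous_horner.
  by apply: contD => //; exact: contD.
rewrite h1 I_kernel_sqr I_cd_sqr => H.
have H1 : (4 * eta)^-1 * \int[mu]_x bump m x <= 4^-1.
  rewrite mulrC ler_pdivrMr ?mulr_gt0 //; lra.
have H2 : eta * (\sum_(k < n.+1) (p k).[E] ^+ 2) <= 4^-1.
  by apply: le_trans etaS; rewrite ler_pM2l.
have H3 : eta * m%:R * (a n.+1 ^+ 2 * ((p n).[E] ^+ 2 + (p n.+1).[E] ^+ 2)) <= 4^-1.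
  apply: (@le_trans _ _ (eta * m%:R * (4 * eta * (m%:R + 1))^-1)).
    by apply: ler_wpM2l => //; rewrite mulr_ge0 // ltW.
  rewrite ler_pdivrMr ?mulr_gt0 ?ltr_wpDl //.
  have m0 : 0 <= m%:R :> R by []; nra.
lra.
Qed.

End PointMass.

(** * Growth of the polynomials at an endpoint without mass *)

Section Decay.
Context {R : realType}.
Implicit Types (a b u d : nat -> R).

(** The maximum principle for the recurrence at the edge: once a subsolution
    is positive and increasing, it stays so. *)
Lemma subsolution_grows a b d N k :
  (forall n, (N <= n)%N -> [/\ 0 < a n, a n <= a n.+1 & 2 * a n <= 2 - b n]) ->
  (forall n, (N <= n)%N -> (2 - b n.+2) * d n.+1 - a n.+1 * d n <= a n.+2 * d n.+2) ->
  (N <= k)%N -> d k <= d k.+1 -> 0 < d k.+1 ->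
  forall n, (k < n)%N -> d k.+1 <= d n.
Proof.
move=> hab hd Nk dk dk0.
have H j : d (k + j)%N <= d (k + j).+1 /\ d k.+1 <= d (k + j).+1.
  elim: j => [|j [IH1 IH2]]; first by rewrite addn0.
  rewrite addnS; set n := (k + j)%N in IH1 IH2 *.
  have Nn : (N <= n)%N by rewrite (leq_trans Nk) // leq_addr.
  have [a1 a12 _] := hab n.+1 (leqW Nn).
  have [a2 _ w2] := hab n.+2 (leqW (leqW Nn)).
  have := hd n Nn.
  have d1 : 0 < d n.+1 by apply: lt_le_trans dk0 IH2.
  move=> h; have : a n.+2 * d n.+1 <= a n.+2 * d n.+2 by nra.
  by rewrite ler_pM2l // => h2; split => //; apply: le_trans IH2 h2.
move=> n kn; have [_] := H (n - k.+1)%N.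
by rewrite (_ : (k + (n - k.+1)).+1 = n)%N //; lia.
Qed.

(** Comparison with the supersolutions [A / n + eta n]: the term [A / n] is one
    by the lower bound on [n^2 (2 - 2 a_n - b_n)], and [eta n], with [eta]
    arbitrarily small, beats the bounded sequence [u] at infinity. *)
Lemma growth_or_decay a b u N : (0 < N)%N ->
  (forall n, (N <= n)%N -> [/\ 0 < a n, a n <= 1, a n <= a n.+1, b n <= 0 & 8 <= n%:R ^+ 2 * (2 - 2 * a n - b n)]) ->
  (forall n, (N <= n)%N -> a n.+2 * u n.+2 = (2 - b n.+2) * u n.+1 - a n.+1 * u n) ->
  (forall n, (N <= n)%N -> `|u n.+1| <= `|u n|) ->
  exists2 A, 0 <= A & forall n, (N <= n)%N -> `|u n| <= A / n%:R.
Proof.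
move=> N0 hab hu hdec.
have N0R : 0 < N%:R :> R by rewrite ltr0n.
pose A : R := N%:R * `|u N|.
have A0 : 0 <= A by rewrite mulr_ge0.
exists A => // n0 Nn0.
suff: forall e : R, 0 < e -> `|u n0| <= A / n0%:R + e by move/ler_addgt0Pr.
move=> e e0.
have n00 : (0 < n0)%N by apply: leq_trans Nn0.
pose eta : R := e / n0%:R.
have eta0 : 0 < eta by rewrite divr_gt0 // ltr0n.
pose v (n : nat) : R := A / n%:R + eta * n%:R.
pose d n := `|u n| - v n.
suff H n : (N <= n)%N -> d n <= 0.
  have := H _ Nn0; rewrite /d /v /eta subr_le0 divfK //.
  by rewrite pnatr_eq0 -lt0n.
have ub n1 : (N <= n1)%N -> `|u n1| <= `|u N|.
  move=> h; rewrite -(subnKC h); elim: (n1 - N)%N => [|j IH]; first by rewrite addn0.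
  by rewrite addnS; apply: le_trans (hdec _ _) IH; rewrite leq_addr.
have hab' m : (N <= m)%N -> [/\ 0 < a m, a m <= a m.+1 & 2 * a m <= 2 - b m].
  move=> h; have [a0 a1 aa b0 w] := hab m h; split => //.
  have m0 : 0 < m%:R ^+ 2 :> R by rewrite exprn_gt0 // ltr0n (leq_trans N0 h).
  have : 0 < 2 - 2 * a m - b m by rewrite -(pmulr_rgt0 _ m0); lra.
  by lra.
have hd m : (N <= m)%N -> (2 - b m.+2) * d m.+1 - a m.+1 * d m <= a m.+2 * d m.+2.
  move=> h; have [a10 _ a12 _ _] := hab m.+1 (leqW h).
  have [a20 a21 _ b20 w] := hab m.+2 (leqW (leqW h)).
  have hu1 : (2 - b m.+2) * `|u m.+1| - a m.+1 * `|u m| <= a m.+2 * `|u m.+2|.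
    rewrite lerBlDr -{1}(gtr0_norm (_ : 0 < 2 - b m.+2)); last by lra.
    have -> : a m.+2 * `|u m.+2| = `|a m.+2 * u m.+2| by rewrite normrM gtr0_norm.
    have -> : a m.+1 * `|u m| = `|a m.+1 * u m| by rewrite normrM gtr0_norm.
    rewrite -normrM.
    have -> : (2 - b m.+2) * u m.+1 = a m.+2 * u m.+2 + a m.+1 * u m by rewrite hu // subrK.
    exact: ler_normD.
  suff hv : a m.+2 * v m.+2 <= (2 - b m.+2) * v m.+1 - a m.+1 * v m.
    by rewrite /d; lra.
  have mN : (0 < m)%N by exact: leq_trans N0 h.
  have m0 : 0 < m%:R :> R by rewrite ltr0n.
  have m1 : 1 <= m%:R :> R by rewrite ler1n.
  rewrite /v; rewrite -[m.+2]addn2 -[m.+1]addn1 !natrD.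
  rewrite addn1 addn2; rewrite -[m.+2]addn2 natrD in w; rewrite addn2 in w.
  set M := m%:R in m0 m1 w *; set al := a m.+2 in a12 a20 a21 w *; set be := b m.+2 in b20 w *.
  apply: (@le_trans _ _ ((2 - be) * (A / (M + 1) + eta * (M + 1)) - al * (A / M + eta * M))); last first.
    rewrite lerD2l lerN2; apply: ler_wpM2r => //.
    by rewrite addr_ge0 // ?divr_ge0 ?mulr_ge0 // ltW.
  have M1 : 0 < M + 1 by rewrite addr_gt0.
  have M2 : 0 < M + 2 by rewrite addr_gt0.
  set W := 2 - 2 * al - be in w.
  have Wlo : 8 / (M + 2) ^+ 2 <= W by rewrite ler_pdivrMr ?exprn_gt0 // mulrC.
  have -> : 2 - be = 2 * al + W by rewrite /W; ring.
  rewrite -subr_ge0.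
  have -> : (2 * al + W) * (A / (M + 1) + eta * (M + 1)) - al * (A / M + eta * M) - al * (A / (M + 2) + eta * (M + 2)) =
    W * eta * (M + 1) + A / (M + 1) * (W - 2 * al / (M * (M + 2))).
    by field; rewrite !gt_eqF.
  have W0 : 0 <= W by apply: le_trans Wlo; rewrite divr_ge0 // sqr_ge0.
  apply: addr_ge0; first by rewrite !mulr_ge0 // ltW.
  apply: mulr_ge0; first by rewrite divr_ge0 // ltW.
  rewrite subr_ge0; apply: le_trans Wlo.
  rewrite ler_pdivrMr ?mulr_gt0 // mulrAC ler_pdivlMr ?exprn_gt0 //.
  have : 2 * al * (M + 2) ^+ 2 <= 2 * (M + 2) ^+ 2 by rewrite ler_wpM2r ?sqr_ge0 // -[leRHS]mulr1 ler_pM2l.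
  move=> h1; apply: (le_trans h1); rewrite expr2 !mulrA ler_pM2r //; move: m1; clear; lra.
elim/ltn_ind: n => n IH Nn.
have [//|dn0] := leP (d n) 0; exfalso.
have nN : n != N.
  apply/eqP => E; move: dn0; rewrite E /d /v /A -mulrA mulrC divfK ?gt_eqF //.
  have : 0 < eta * N%:R by rewrite mulr_gt0.
  lra.
case: n IH Nn dn0 nN => [|k] IH Nn dn0 nN.
  by move: nN; rewrite eq_sym -leqn0 Nn.
have Nk : (N <= k)%N by rewrite leq_eqVlt eq_sym in Nn; case/orP: Nn => [/eqP E|//]; rewrite -E eqxx in nN.
have dk := IH k (ltnSn k) Nk.
have grow := subsolution_grows hab' hd Nk (le_trans dk (ltW dn0)) dn0.
pose M := (Num.truncn (`|u N| / eta)).+1.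
have hM : `|u N| < eta * M%:R.
  by have := truncnS_gt (`|u N| / eta); rewrite ltr_pdivrMr // mulrC.
pose n2 := maxn M k.+1.
have := grow n2 (leq_trans (ltnSn k) (leq_maxr _ _)).
have Nn2 : (N <= n2)%N by rewrite (leq_trans (leqW Nk)) // leq_maxr.
have := ub n2 Nn2; rewrite /d /v.
have : eta * M%:R <= eta * n2%:R by rewrite ler_pM2l // ler_nat leq_maxl.
have : 0 <= A / n2%:R by rewrite divr_ge0.
move=> h1 h2 h3 h4; move: (lt_le_trans dn0 h4) hM h1 h2 h3; rewrite /d /v; clear; lra.
Qed.

Lemma sum_inv_sqr_le (c : nat -> R) N (A : R) : (0 < N)%N -> (forall n, 0 <= c n) ->
  (forall n, (N <= n)%N -> c n <= A / n%:R ^+ 2) -> exists S, forall n, \sum_(k < n) c k <= S.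
Proof.
move=> N0 c0 cA.
have A0 : 0 <= A.
  have := le_trans (c0 N) (cA N (leqnn N)); rewrite pmulr_lge0 // invr_gt0 exprn_gt0 // ltr0n //.
have H j : \sum_(k < N + j) c k <= \sum_(k < N) c k + 2 * A / N%:R - 2 * A / (N + j)%:R.
  elim: j => [|j IH]; first by rewrite addn0 addrK.
  rewrite addnS big_ord_recr /=; apply: (le_trans (lerD IH (cA _ (leq_addr _ _)))).
  set M := (N + j)%N; have M0 : 0 < M%:R :> R by rewrite ltr0n; lia.
  rewrite -[M.+1]addn1 natrD.
  have M1 : 1 <= M%:R :> R by rewrite ler1n; lia.
  rewrite -!addrA lerD2l lerD2l -subr_ge0.
  have -> : - (2 * A / (M%:R + 1)) - (- (2 * A / M%:R) + A / M%:R ^+ 2) = A * (M%:R - 1) / (M%:R ^+ 2 * (M%:R + 1)).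
    by field; rewrite !gt_eqF //; lra.
  by rewrite divr_ge0 ?mulr_ge0 ?sqr_ge0 //; lra.
exists (\sum_(k < N) c k + 2 * A / N%:R) => n.
apply: (@le_trans _ _ (\sum_(k < N + n) c k)).
  rewrite addnC big_split_ord /= lerDl; apply: sumr_ge0 => i _; exact: c0.
apply: (le_trans (H n)); rewrite -[leRHS]addr0 lerD2l oppr_le0 divr_ge0 // mulr_ge0 //.
Qed.

End Decay.

Lemma growing_at_edge {R : realType} (mu : probability (measurableTypeR R) R) (B : R)
  (p : nat -> {poly R}) (a b : nat -> R) N :
  mu (~` `[- B, B]%classic) = 0%E ->
  orthonormal_polys mu p ->
  (forall n, 'X * p n = (if n is m.+1 then a n *: p m else 0) + b n.+1 *: p n + a n.+1 *: p n.+1) ->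
  (0 < N)%N ->
  (forall n, (N <= n)%N -> [/\ 0 < a n, a n <= 1, a n <= a n.+1, b n <= 0 & 8 <= n%:R ^+ 2 * (2 - 2 * a n - b n)]) ->
  mu [set 2] = 0%E ->
  exists2 n, (N <= n)%N & `|(p n).[2]| < `|(p n.+1).[2]|.
Proof.
move=> supp orth jac N0 hab mu2.
apply: contrapT => hno.
have hdec n : (N <= n)%N -> `|(p n.+1).[2]| <= `|(p n).[2]|.
  by move=> h; rewrite leNgt; apply/negP => h2; apply: hno; exists n.
have hu n : (N <= n)%N -> a n.+2 * (p n.+2).[2] = (2 - b n.+2) * (p n.+1).[2] - a n.+1 * (p n).[2].
  by move=> _; have := jacobi_rec jac n 2; clear; lra.
have [A A0 hA] := growth_or_decay N0 hab hu hdec.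
have hA2 n : (N <= n)%N -> (p n).[2] ^+ 2 <= A ^+ 2 / n%:R ^+ 2.
  move=> h; rewrite -(real_normK (num_real _)) -expr_div_n.
  by apply: lerXn2r; rewrite ?nnegrE ?divr_ge0 //; exact: hA.
have [S hS] := sum_inv_sqr_le N0 (fun n => sqr_ge0 (p n).[2]) hA2.
have HS := summable_mass supp orth jac hS.
apply: (HS _ mu2) => e e0.
clear mu2 supp.
pose n := maxn N (Num.truncn (2 * A ^+ 2 / e)).+1.
have Nn : (N <= n)%N by exact: leq_maxl.
have n1 : 1 <= n%:R :> R by rewrite ler1n; lia.
have hn : 2 * A ^+ 2 / e <= n%:R.
  by apply: le_trans (ltW (truncnS_gt _)) _; rewrite ler_nat leq_maxr.
exists n; have [a0 a1 _ _ _] := hab n.+1 (leqW Nn).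
have h1 : (p n).[2] ^+ 2 <= A ^+ 2 / n%:R.
  rewrite -(real_normK (num_real _)); apply: (@le_trans _ _ ((A / n%:R) ^+ 2)).
    by apply: lerXn2r; rewrite ?nnegrE ?divr_ge0 //; exact: hA.
  rewrite expr_div_n; apply: ler_wpM2l; first exact: sqr_ge0.
  by rewrite lef_pV2 ?posrE ?exprn_gt0 ?(lt_le_trans ltr01) // expr2 ler_peMr // (le_trans ler01).
have h2 : (p n.+1).[2] ^+ 2 <= A ^+ 2 / n%:R.
  apply: le_trans h1; rewrite -(real_normK (num_real (p n.+1).[2])) -(real_normK (num_real (p n).[2])).
  by apply: lerXn2r; rewrite ?nnegrE //; exact: hdec.
move: hn; rewrite ler_pdivrMr // => hn.
apply: (@le_trans _ _ (1 * (A ^+ 2 / n%:R + A ^+ 2 / n%:R))).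
  apply: ler_pM; rewrite ?sqr_ge0 ?addr_ge0 ?sqr_ge0 //; last exact: lerD.
  by rewrite expr_le1 // ltW.
rewrite mul1r -mulrDl ler_pdivrMr; last by lra.
by lra.
Qed.

(** * The multiplier of the recurrence with constant coefficients *)

Section Lambda.
Context {R : realType}.
Implicit Types (v d e : R).

(** The larger root [r] of [r - r^-1 = v]; its square is the larger root [l] of
    [l + l^-1 = 2 + v^2]. The parametrisation by [v], the square root of the
    gap, removes the singularity of the multiplier at the turning point. *)
Definition root_mul v : R := v / 2 + Num.sqrt (1 + v ^+ 2 / 4).
Definition mult d : R := root_mul (Num.sqrt d) ^+ 2.

Lemma root_mulP v : 0 <= v -> [/\ 1 <= root_mul v, 1 + v / 2 <= root_mul v & root_mul v - (root_mul v)^-1 = v].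
Proof.
move=> v0.
have h1 : 1 <= 1 + v ^+ 2 / 4 by rewrite lerDl divr_ge0 // sqr_ge0.
have s1 : 1 <= Num.sqrt (1 + v ^+ 2 / 4) by rewrite -{1}sqrtr1 ler_sqrt //; lra.
have ss : Num.sqrt (1 + v ^+ 2 / 4) ^+ 2 = 1 + v ^+ 2 / 4 by rewrite sqr_sqrtr //; lra.
have r1 : 1 + v / 2 <= root_mul v by rewrite /root_mul; lra.
have r0 : 1 <= root_mul v by lra.
split => //.
have rn : root_mul v != 0 by rewrite gt_eqF //; lra.
apply: (mulIf rn); rewrite mulrBl mulVf // /root_mul.
set s := Num.sqrt _ in ss *; rewrite -!expr2 in ss *; nra.
Qed.

Lemma mult_ge1 d : 1 <= mult d.
Proof.
have [h _ _] := root_mulP (sqrtr_ge0 d).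
by rewrite /mult exprn_ege1.
Qed.

Lemma mult_gt0 d : 0 < mult d.
Proof. exact: lt_le_trans ltr01 (mult_ge1 d). Qed.

Lemma multV d : 0 <= d -> mult d + (mult d)^-1 = 2 + d.
Proof.
move=> d0; have [h _ E] := root_mulP (sqrtr_ge0 d).
have dE : d = (root_mul (Num.sqrt d) - (root_mul (Num.sqrt d))^-1) ^+ 2 by rewrite E sqr_sqrtr.
rewrite /mult [in RHS]dE; set s := root_mul _ in h *; field.
by rewrite gt_eqF //; lra.
Qed.

Lemma mult_ge_sqrt d : 1 + Num.sqrt d <= mult d.
Proof.
have [h1 h2 _] := root_mulP (sqrtr_ge0 d).
have := sqrtr_ge0 d; rewrite /mult; set s := root_mul _ in h1 h2 *; nra.
Qed.

Lemma mult_le d : 0 <= d -> mult d <= 2 + d.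
Proof. by move=> d0; rewrite -multV // lerDl invr_ge0 ltW // mult_gt0. Qed.

Lemma mult_mono d e : 0 <= d -> d <= e -> mult d <= mult e.
Proof.
move=> d0 de; rewrite leNgt; apply/negP => h.
have e0 : 0 <= e by lra.
have m1 := mult_ge1 d; have m2 := mult_ge1 e; have mp := mult_gt0 e; have mq := mult_gt0 d.
have h1 := multV d0; have h2 := multV e0.
have : (mult d + (mult d)^-1) - (mult e + (mult e)^-1) = (mult d - mult e) * (1 - (mult d * mult e)^-1).
  by field; rewrite !gt_eqF.
have : 0 < 1 - (mult d * mult e)^-1.
  have mm : 0 < mult d * mult e by exact: mulr_gt0.
  rewrite subr_gt0 invf_lt1 //; have := ler_wpM2l (ltW mq) m2.
  by rewrite mulr1 => h3; lra.
nra.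
Qed.

End Lambda.

(** * The recurrence below the turning point *)

Definition edge_regular {R : realType} (a b : nat -> R) (N : nat) := forall n, (N <= n)%N ->
  [/\ 2^-1 <= a n, a n <= 1, a n <= a n.+1, - 2^-1 <= b n & b n <= 0 /\ b n <= b n.+1].

Lemma energy_dominates {R : realType} (q s e : R) : q / 4 * s <= e -> q * (51 * s) <= 204 * e.
Proof. by move=> ?; lra. Qed.

Lemma energy_dominates1 {R : realType} (q s e : R) : q / 4 * s <= e -> 0 <= e -> q * s <= 204 * e.
Proof. by move=> ? ?; lra. Qed.

Lemma relative_step {R : realType} (e e' c d y : R) : e' - e <= d -> d <= c * y * e -> e' <= e * (1 + c * y).
Proof. by move=> ? ?; lra. Qed.

Section Dynamics.
Context {R : realType}.
Variables (a b u : nat -> R) (x : R) (N : nat).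
Hypothesis hab : edge_regular a b N.
Hypothesis x1 : 1 <= x.
Hypothesis x2 : x <= 2.
Hypothesis rec : forall n, (N <= n)%N -> a n.+2 * u n.+2 = (x - b n.+2) * u n.+1 - a n.+1 * u n.

(** The recurrence reads [u_(n+2) = (2 + gap_(n+2)) u_(n+1) - r u_n] with a
    ratio [r <= 1]; a nonnegative gap makes it hyperbolic. *)
Definition gap n : R := (x - b n) / a n - 2.
(** The decrease of [2 - 2 a_n - b_n] from [n] to [n + 1]. *)
Definition step n : R := 2 * (a n.+1 - a n) + (b n.+1 - b n).

Lemma gap_le3 n : (N <= n)%N -> gap n <= 3.
Proof.
move=> h; have [a0 a1 _ b0 [b1 _]] := hab h; have X2 := x2.
have an : 0 < a n by lra.
by rewrite /gap lerBlDr ler_pdivrMr //; lra.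
Qed.

Lemma gap_decr n : (N <= n)%N -> gap n.+1 <= gap n.
Proof.
move=> h; have [a0 a1 a2 b0 [b1 b2]] := hab h; have X1 := x1.
have [a0' _ _ _ [b1' _]] := hab (leqW h).
have an : 0 < a n by lra.
have an1 : 0 < a n.+1 by lra.
rewrite /gap lerD2r ler_pdivrMr // mulrAC ler_pdivlMr //; nra.
Qed.

Lemma gap_drop n : (N <= n)%N -> 0 <= gap n -> step n <= gap n - gap n.+1.
Proof.
move=> h g0; have [a0 a1 a2 b0 [b1 b2]] := hab h; have X1 := x1.
have [a0' a1' _ _ [b1' _]] := hab (leqW h).
have an : 0 < a n by lra.
have an1 : 0 < a n.+1 by lra.
have -> : gap n - gap n.+1 = ((2 + gap n) * (a n.+1 - a n) + (b n.+1 - b n)) / a n.+1.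
  by rewrite /gap; field; rewrite !gt_eqF.
rewrite ler_pdivlMr // /step.
have : 0 <= gap n * (a n.+1 - a n) by rewrite mulr_ge0 // subr_ge0.
have : (2 * (a n.+1 - a n) + (b n.+1 - b n)) * a n.+1 <= 2 * (a n.+1 - a n) + (b n.+1 - b n).
  by rewrite -[leRHS]mulr1; apply: ler_wpM2l => //; lra.
lra.
Qed.

Lemma gap_drop_neg n : (N <= n)%N -> step n / 2 <= gap n - gap n.+1.
Proof.
move=> h; have [a0 a1 a2 b0 [b1 b2]] := hab h; have X1 := x1.
have [a0' a1' _ _ [b1' _]] := hab (leqW h).
have an : 0 < a n by lra.
have an1 : 0 < a n.+1 by lra.
have -> : gap n - gap n.+1 = (((x - b n) / a n) * (a n.+1 - a n) + (b n.+1 - b n)) / a n.+1.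
  by rewrite /gap; field; rewrite !gt_eqF.
rewrite ler_pdivlMr // /step.
have h1 : 1 <= (x - b n) / a n by rewrite ler_pdivlMr //; lra.
have : a n.+1 - a n <= (x - b n) / a n * (a n.+1 - a n).
  by rewrite -[leLHS]mul1r ler_wpM2r //; lra.
have : (2 * (a n.+1 - a n) + (b n.+1 - b n)) / 2 * a n.+1 <= (2 * (a n.+1 - a n) + (b n.+1 - b n)) / 2.
  by rewrite -[leRHS]mulr1; apply: ler_wpM2l => //; lra.
lra.
Qed.

Lemma recE n : (N <= n)%N -> u n.+2 = (2 + gap n.+2) * u n.+1 - a n.+1 / a n.+2 * u n.
Proof.
move=> h; have [a0 _ _ _ _] := hab (leqW (leqW h)).
have an : 0 < a n.+2 by lra.
apply: (mulfI (lt0r_neq0 an)); rewrite rec // /gap; field; rewrite gt_eqF //.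
Qed.

Lemma ratio_le1 n : (N <= n)%N -> 0 <= a n / a n.+1 <= 1.
Proof.
move=> h; have [a0 _ a2 _ _] := hab h; have [a0' _ _ _ _] := hab (leqW h).
have an : 0 < a n.+1 by lra.
by rewrite ler_pdivrMr // mul1r a2 divr_ge0 //; lra.
Qed.

Lemma hyper_incr n : (N <= n)%N -> 0 <= gap n.+2 -> 0 <= u n -> u n <= u n.+1 -> u n.+1 <= u n.+2.
Proof.
move=> h g0 u0 u1; rewrite recE //.
have /andP[r0 r1] := ratio_le1 (leqW h).
have : a n.+1 / a n.+2 * u n <= u n.+1 by apply: le_trans u1; rewrite ler_piMl.
nra.
Qed.

Lemma hyper_lower n : (N <= n)%N -> 0 <= gap n.+2 -> 0 <= u n ->
  mult (gap n.+1) * u n <= u n.+1 -> mult (gap n.+2) * u n.+1 <= u n.+2.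
Proof.
move=> h g0 u0 u1; rewrite recE // -multV //.
have g01 : gap n.+2 <= gap n.+1 := gap_decr (leqW h).
have lm := mult_mono g0 g01.
have /andP[r0 r1] := ratio_le1 (leqW h).
have m0 := mult_gt0 (gap n.+2).
have : a n.+1 / a n.+2 * u n <= u n by rewrite ler_piMl.
have : u n <= (mult (gap n.+2))^-1 * u n.+1.
  rewrite mulrC ler_pdivlMr // mulrC; apply: le_trans u1; exact: ler_wpM2r.
lra.
Qed.

(** The component of a solution along the growing multiplier. Unlike the
    solution itself, it never grows faster than [mult] from one index to the
    next ([hyper_upper]), which makes the upper bound as sharp as the lower one. *)
Definition grow_part n := u n.+1 - u n / mult (gap n.+1).

Lemma hyper_upper n : (N <= n)%N -> 0 <= gap n.+2 -> 0 <= u n ->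
  grow_part n.+1 <= mult (gap n.+2) * grow_part n.
Proof.
move=> h g0 u0; rewrite /grow_part recE // -multV //.
have g01 : gap n.+2 <= gap n.+1 := gap_decr (leqW h).
have g1 : 0 <= gap n.+1 by lra.
have lm := mult_mono g0 g01.
have E1 := multV g1; have E2 := multV g0.
have mp := mult_gt0 (gap n.+1); have mq := mult_gt0 (gap n.+2).
have m1 := mult_ge1 (gap n.+1); have m2 := mult_ge1 (gap n.+2).
have [a0 _ a2 _ _] := hab (leqW h); have [a0' _ _ _ [_ _]] := hab (leqW (leqW h)).
have [_ _ _ _ [_ bb]] := hab (leqW h).
have ap : 0 < a n.+1 by lra.
have aq : 0 < a n.+2 by lra.
have gE : gap n.+1 - gap n.+2 = ((2 + gap n.+1) * (a n.+2 - a n.+1) + (b n.+2 - b n.+1)) / a n.+2.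
  by rewrite /gap; field; rewrite !gt_eqF.
set la := mult (gap n.+1) in E1 lm mp m1 *; set mu := mult (gap n.+2) in E2 lm mq m2 *.
set r := a n.+1 / a n.+2.
have rE : 1 - r = (a n.+2 - a n.+1) / a n.+2 by rewrite /r; field; rewrite gt_eqF.
have g2 : (2 + gap n.+1) * (1 - r) <= gap n.+1 - gap n.+2.
  by rewrite gE rE mulrA ler_pM2r ?invr_gt0 // lerDl subr_ge0.
have r1 : 0 <= 1 - r by rewrite rE divr_ge0 ?subr_ge0 // ltW.
rewrite -subr_ge0.
have -> : mu * (u n.+1 - u n / la) - ((mu + mu^-1) * u n.+1 - r * u n - u n.+1 / mu) = u n * (r - mu / la).
  by field; rewrite !gt_eqF.
apply: mulr_ge0 => //; rewrite subr_ge0 ler_pdivrMr //.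
have : (la + la^-1) - (mu + mu^-1) = (la - mu) * (1 - (la * mu)^-1) by field; rewrite !gt_eqF.
rewrite E1 E2 => E3.
have : (la - mu) * (1 - (la * mu)^-1) <= la - mu.
  rewrite -[leRHS]mulr1; apply: ler_wpM2l; first by lra.
  by rewrite lerBlDr lerDl invr_ge0 mulr_ge0 // ltW.
have : la * (1 - r) <= (2 + gap n.+1) * (1 - r).
  by apply: ler_wpM2r => //; rewrite -E1 lerDl invr_ge0 ltW.
lra.
Qed.

(** The product starts at [N + 2], the first index at which the recurrence
    determines a value from those at [N] and [N + 1]. *)
Definition growth m : R := \prod_(N.+2 <= k < m.+1) mult (gap k).

Lemma growthS m : (N < m)%N -> growth m.+1 = growth m * mult (gap m.+1).
Proof. by move=> h; rewrite /growth big_nat_recr. Qed.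

Lemma growth_ge1 m : 1 <= growth m.
Proof.
rewrite /growth; elim/big_ind: _ => // [y z y1 z1|i _]; last exact: mult_ge1.
by rewrite -[1]mulr1 ler_pM.
Qed.

Lemma gap_ge m n : (N <= n)%N -> (n <= m)%N -> gap m <= gap n.
Proof.
move=> Nn /subnKC <-; elim: (m - n)%N => [|j IH]; first by rewrite addn0.
by rewrite addnS; apply: le_trans IH; apply: gap_decr; rewrite (leq_trans Nn) // leq_addr.
Qed.

Lemma hyper_incr_all m : 0 <= gap m -> 0 <= u N -> u N <= u N.+1 ->
  forall n, (N <= n)%N -> (n < m)%N -> 0 <= u n /\ u n <= u n.+1.
Proof.
move=> gm u0 u1 n Nn; rewrite -(subnKC Nn).
elim: (n - N)%N => [|j IH]; rewrite ?addn0 // addnS => jm.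
have [|v0 v1] := IH; first exact: ltnW.
have Nj : (N <= N + j)%N by exact: leq_addr.
split; first exact: le_trans v1.
apply: hyper_incr => //; apply: le_trans gm _; apply: gap_ge => //.
by rewrite (leq_trans Nj) // -addn2 leq_addr.
Qed.

Lemma hyper_lower_all m : 0 <= gap m -> u N = 0 -> 0 <= u N.+1 -> (N < m)%N ->
  u N.+1 * growth m <= u m.
Proof.
move=> gm u0 u1 Nm.
have H j : (N + j < m)%N -> mult (gap (N + j).+1) * u (N + j)%N <= u (N + j).+1 /\ u N.+1 * growth (N + j).+1 <= u (N + j).+1.
  elim: j => [|j IH]; rewrite ?addn0 ?addnS.
    by rewrite u0 mulr0 /growth big_geq // mulr1.
  move=> jm; have [v0 v1] := IH (ltnW jm).
  have Nj : (N <= N + j)%N by exact: leq_addr.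
  have uN : u N <= u N.+1 by rewrite u0.
  have [w0 w1] := hyper_incr_all gm (eq_ind_r (fun z => 0 <= z) (lexx 0) u0) uN Nj (ltnW jm).
  have g2 : 0 <= gap (N + j).+2.
    by apply: le_trans gm _; apply: gap_ge => //; rewrite (leq_trans Nj) // -addn2 leq_addr.
  have L := hyper_lower Nj g2 w0 v0.
  split => //; rewrite growthS; last by rewrite ltnS leq_addr.
  rewrite mulrA; apply: le_trans L; rewrite [leRHS]mulrC; apply: ler_wpM2r => //.
  by rewrite ltW // mult_gt0.
have := H (m.-1 - N)%N; rewrite subnKC; last by rewrite -ltnS prednK //; exact: leq_ltn_trans Nm.
by rewrite prednK; last exact: leq_ltn_trans Nm; case.
Qed.

Lemma hyper_upper_all m : 0 <= gap m -> 0 <= u N -> u N <= u N.+1 -> (N < m)%N ->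
  grow_part m.-1 <= u N.+1 * growth m.
Proof.
move=> gm u0 u1 Nm.
have H j : (N + j < m)%N -> grow_part (N + j) <= u N.+1 * growth (N + j).+1.
  elim: j => [|j IH]; rewrite ?addn0 ?addnS.
    move=> _; rewrite /growth big_geq // mulr1 /grow_part lerBlDr lerDl; apply: divr_ge0 => //.
    exact: ltW (mult_gt0 _).
  move=> jm; have Nj : (N <= N + j)%N by exact: leq_addr.
  have [w0 w1] := hyper_incr_all gm u0 u1 Nj (ltnW jm).
  have g2 : 0 <= gap (N + j).+2.
    by apply: le_trans gm _; apply: gap_ge => //; rewrite (leq_trans Nj) // -addn2 leq_addr.
  apply: (le_trans (hyper_upper Nj g2 w0)).
  rewrite growthS; last by rewrite ltnS leq_addr.
  rewrite mulrA mulrC; apply: ler_wpM2r; first by rewrite ltW // mult_gt0.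
  exact: IH (ltnW jm).
have m1E : m.-1.+1 = m by rewrite prednK //; exact: leq_ltn_trans Nm.
have := H (m.-1 - N)%N; rewrite subnKC; last by rewrite -ltnS m1E.
by rewrite m1E; apply.
Qed.

Lemma forward_bound n : (N <= n)%N -> `|u n.+2| <= 5 * `|u n.+1| + `|u n|.
Proof.
move=> h; rewrite recE //; have /andP[r0 r1] := ratio_le1 (leqW h).
have [a0 a1 _ b0 [b1 _]] := hab (leqW (leqW h)); have X1 := x1.
have g3 := gap_le3 (leqW (leqW h)).
have g0 : 0 <= 2 + gap n.+2 by rewrite /gap addrCA subrr addr0 divr_ge0 //; lra.
move: r0 r1; move: (a n.+1 / a n.+2) => r r0 r1.
apply: (le_trans (ler_normB _ _)); rewrite !normrM (ger0_norm g0) (ger0_norm r0).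
by apply: lerD; [apply: ler_wpM2r => //; lra|rewrite ler_piMl].
Qed.

Lemma backward_bound n : (N <= n)%N -> `|u n| <= 5 * (`|u n.+1| + `|u n.+2|).
Proof.
move=> h; have [a0 a1 _ b0 [b1 _]] := hab (leqW (leqW h)); have X1 := x1; have X2 := x2.
have [c0 _ _ _ _] := hab (leqW h).
have E : a n.+1 * u n = (x - b n.+2) * u n.+1 - a n.+2 * u n.+2 by rewrite rec //; ring.
have h1 : `|a n.+1 * u n| <= (5/2) * (`|u n.+1| + `|u n.+2|).
  rewrite E; apply: (le_trans (ler_normB _ _)); rewrite !normrM mulrDr.
  by apply: lerD; apply: ler_wpM2r => //; rewrite ger0_norm; lra.
rewrite normrM ger0_norm in h1; last by lra.
have := normr_ge0 (u n); nra.
Qed.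

(** * The energy beyond the turning point *)

(** The Turan determinant, written with the recurrence as a quadratic form in
    two consecutive values. Its discriminant has the sign of [- ellip n]
    (times a positive factor), so the form is definite once [ellip n] is
    positive. *)
Definition energy n : R := a n.+1 ^+ 2 * (u n.+1 ^+ 2 + u n ^+ 2) - (x - b n.+2) * a n.+1 * (u n.+1 * u n).
Definition size2 n : R := u n.+1 ^+ 2 + u n ^+ 2.
Definition ellip n : R := 2 * a n.+1 + b n.+2 - x.

Lemma energy_turan n : (N <= n)%N -> energy n = a n.+1 ^+ 2 * (u n.+1 * u n.+1) - a n.+1 * a n.+2 * (u n * u n.+2).
Proof.
move=> h; rewrite /energy.
have -> : a n.+1 * a n.+2 * (u n * u n.+2) = a n.+1 * u n * (a n.+2 * u n.+2) by ring.
rewrite rec //; ring.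
Qed.

Lemma energyS n : (N <= n)%N -> energy n.+1 = energy n + (a n.+2 ^+ 2 - a n.+1 ^+ 2) * u n.+1 ^+ 2 +
  (b n.+3 - b n.+2) * (a n.+2 * (u n.+2 * u n.+1)).
Proof.
move=> h; rewrite /energy.
have -> : (x - b n.+3) * a n.+2 * (u n.+2 * u n.+1) = (x - b n.+2) * u n.+1 * (a n.+2 * u n.+2) - (b n.+3 - b n.+2) * (a n.+2 * (u n.+2 * u n.+1)) by ring.
have -> : a n.+2 ^+ 2 * (u n.+2 ^+ 2 + u n.+1 ^+ 2) = (a n.+2 * u n.+2) ^+ 2 + a n.+2 ^+ 2 * u n.+1 ^+ 2 by ring.
rewrite rec //; ring.
Qed.

Lemma size2_ge0 n : 0 <= size2 n.
Proof. by rewrite addr_ge0 // sqr_ge0. Qed.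

Lemma cross_le n : `|u n.+1 * u n| <= size2 n / 2.
Proof.
rewrite /size2; have := sqr_ge0 (u n.+1 - u n); have := sqr_ge0 (u n.+1 + u n) => H1 H2.
by rewrite ler_norml; apply/andP; split; nra.
Qed.

Lemma energy_ge n : (N <= n)%N -> 0 <= ellip n -> ellip n / 4 * size2 n <= energy n.
Proof.
move=> h q0; have [a0 a1 _ _ _] := hab (leqW h); have X1 := x1.
have [_ _ _ b0 [b1 _]] := hab (leqW (leqW h)).
have := cross_le n; rewrite ler_norml => /andP[_ c].
have s0 := size2_ge0 n.
have h1 : (x - b n.+2) * a n.+1 * (u n.+1 * u n) <= (x - b n.+2) * a n.+1 * (size2 n / 2).
  by apply: ler_wpM2l => //; rewrite mulr_ge0; lra.
rewrite /energy -/(size2 n).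
have : ellip n / 4 * size2 n <= a n.+1 / 2 * ellip n * size2 n.
  apply: ler_wpM2r => //; nra.
rewrite /ellip in q0 *; nra.
Qed.

Lemma energy_le n : (N <= n)%N -> energy n <= 3 * size2 n.
Proof.
move=> h; have [a0 a1 _ _ _] := hab (leqW h); have X1 := x1; have X2 := x2.
have [_ _ _ b0 [b1 _]] := hab (leqW (leqW h)).
have := cross_le n; rewrite ler_norml => /andP[c _].
have s0 := size2_ge0 n.
rewrite /energy -/(size2 n).
have k0 : 0 <= (x - b n.+2) * a n.+1 by rewrite mulr_ge0; lra.
have k1 : (x - b n.+2) * a n.+1 <= 5 / 2 by nra.
have k2 : a n.+1 ^+ 2 <= 1 by rewrite expr_le1 //; lra.
nra.
Qed.

Lemma size2S n : (N <= n)%N -> size2 n.+1 <= 51 * size2 n.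
Proof.
move=> h; have := forward_bound h; rewrite /size2.
rewrite -(real_normK (num_real (u n.+2))) -(real_normK (num_real (u n.+1))) -(real_normK (num_real (u n))).
have := normr_ge0 (u n.+2); have := normr_ge0 (u n.+1); have := normr_ge0 (u n).
set A := `|u n|; set B := `|u n.+1|; set C := `|u n.+2| => A0 B0 C0 CB.
have : C ^+ 2 <= (5 * B + A) ^+ 2 by apply: lerXn2r; rewrite ?nnegrE //; lra.
have := sqr_ge0 (5 * B - A); nra.
Qed.

(** The increments of [a] and [b] are nonnegative, so together they are
    bounded by the increment of [ellip]. *)
Lemma energy_diff n : (N <= n)%N -> `|energy n.+1 - energy n| <= (ellip n.+1 - ellip n) * size2 n.+1.
Proof.
move=> h.
have -> : energy n.+1 - energy n = (a n.+2 ^+ 2 - a n.+1 ^+ 2) * u n.+1 ^+ 2 +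
  (b n.+3 - b n.+2) * (a n.+2 * (u n.+2 * u n.+1)) by rewrite energyS //; ring.
have [a0 a1 a2 _ _] := hab (leqW h); have [a0' a1' _ _ [_ bb]] := hab (leqW (leqW h)).
have := cross_le n.+1 => c; have u0 : u n.+1 ^+ 2 <= size2 n.+1 by rewrite /size2 lerDr sqr_ge0.
have s0 := size2_ge0 n.+1.
apply: (le_trans (ler_normD _ _)).
rewrite [`|_ * u n.+1 ^+ 2|]normrM [`|(b n.+3 - _) * _|]normrM [`|a n.+2 * _|]normrM.
rewrite (ger0_norm (sqr_ge0 _)) (ger0_norm (_ : 0 <= b n.+3 - b n.+2)); last by lra.
rewrite (ger0_norm (_ : 0 <= a n.+2)); last by lra.
rewrite ger0_norm; last by nra.
have h1 : (a n.+2 ^+ 2 - a n.+1 ^+ 2) * u n.+1 ^+ 2 <= 2 * (a n.+2 - a n.+1) * size2 n.+1.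
  apply: ler_pM => //; [by nra|exact: sqr_ge0|by nra].
have h2 : (b n.+3 - b n.+2) * (a n.+2 * `|u n.+2 * u n.+1|) <= (b n.+3 - b n.+2) * size2 n.+1.
  apply: ler_wpM2l; first by lra.
  apply: (@le_trans _ _ (1 * (size2 n.+1 / 2))); last by lra.
  by apply: ler_pM => //; lra.
rewrite /ellip; lra.
Qed.

Lemma bernoulli (y : R) k : 0 <= y -> 1 + k%:R * y <= (1 + y) ^+ k.
Proof.
move=> y0; elim: k => [|k IH]; first by rewrite mul0r addr0 expr0.
rewrite exprS -[k.+1]addn1 natrD.
have k0 : 0 <= k%:R :> R by [].
have := ler_wpM2l (_ : 0 <= 1 + y) IH; rewrite addr_ge0 // => /(_ isT); nra.
Qed.

Lemma ellip_incr n : (N <= n)%N -> ellip n <= ellip n.+1.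
Proof.
move=> h; have [_ _ a2 _ _] := hab (leqW h); have [_ _ _ _ [_ bb]] := hab (leqW (leqW h)).
by rewrite /ellip; lra.
Qed.

(** The relative change of the energy is at most 204 times that of [ellip]:
    the factor 51 of [size2S] times the factor 4 of [energy_ge]. Bernoulli turns
    it into a power, which telescopes in [energy_comparable]. *)
Lemma energy_step n : (N <= n)%N -> 0 < ellip n ->
  energy n.+1 <= energy n * (ellip n.+1 / ellip n) ^+ 204 /\
  energy n <= energy n.+1 * (ellip n.+1 / ellip n) ^+ 204.
Proof.
move=> h q0; have q01 := ellip_incr h.
have q1 : 0 < ellip n.+1 by exact: lt_le_trans q01.
have E0 := energy_ge h (ltW q0); have E1 := energy_ge (leqW h) (ltW q1).
have s0 := size2_ge0 n; have s1 := size2_ge0 n.+1; have ss := size2S h.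
have := energy_diff h; rewrite ler_norml => /andP[d1 d2].
pose y := (ellip n.+1 - ellip n) / ellip n.
have y0 : 0 <= y by apply: divr_ge0; [rewrite subr_ge0|exact: ltW].
have yE : ellip n.+1 / ellip n = 1 + y by rewrite /y; field; rewrite gt_eqF.
have dE : ellip n.+1 - ellip n = y * ellip n by rewrite /y divfK // gt_eqF.
have B204 := bernoulli 204 y0.
have e0 : 0 <= energy n by apply: le_trans E0; rewrite mulr_ge0 // divr_ge0 // ltW.
have e1 : 0 <= energy n.+1 by apply: le_trans E1; rewrite mulr_ge0 // divr_ge0 // ltW.
rewrite yE; split.
- apply: (@le_trans _ _ (energy n * (1 + 204%:R * y))); last exact: ler_wpM2l.
  have : (ellip n.+1 - ellip n) * size2 n.+1 <= 204%:R * y * energy n.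
    rewrite dE; apply: (@le_trans _ _ (y * ellip n * (51 * size2 n))).
      by apply: ler_wpM2l => //; rewrite mulr_ge0 // ltW.
    rewrite (_ : 204%:R * y * energy n = y * (204 * energy n)); last by ring.
    by rewrite -mulrA ler_wpM2l //; exact: energy_dominates E0.
  exact: relative_step d2.
- apply: (@le_trans _ _ (energy n.+1 * (1 + 204%:R * y))); last exact: ler_wpM2l.
  have : (ellip n.+1 - ellip n) * size2 n.+1 <= 204%:R * y * energy n.+1.
    rewrite dE (_ : 204%:R * y * energy n.+1 = y * (204 * energy n.+1)); last by ring.
    rewrite -mulrA ler_wpM2l //; apply: (@le_trans _ _ (ellip n.+1 * size2 n.+1)); first by rewrite ler_wpM2r.
    exact: energy_dominates1 E1 e1.
  by apply: relative_step; rewrite -opprB lerNl.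
Qed.

Lemma ellip_ge m n : (N <= n)%N -> (n <= m)%N -> ellip n <= ellip m.
Proof.
move=> Nn /subnKC <-; elim: (m - n)%N => [|j IH]; first by rewrite addn0.
by rewrite addnS; apply: (le_trans IH); apply: ellip_incr; rewrite (leq_trans Nn) // leq_addr.
Qed.

Lemma energy_comparable n m : (N <= n)%N -> (n <= m)%N -> 0 < ellip n ->
  energy m <= energy n * (ellip m / ellip n) ^+ 204 /\
  energy n <= energy m * (ellip m / ellip n) ^+ 204.
Proof.
move=> Nn /subnKC <-; move=> q0; elim: (m - n)%N => [|j [IH1 IH2]].
  by rewrite addn0 divff ?gt_eqF // expr1n mulr1.
rewrite addnS; set k := (n + j)%N in IH1 IH2 *.
have Nk : (N <= k)%N by rewrite (leq_trans Nn) // leq_addr.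
have qk : 0 < ellip k by apply: lt_le_trans q0 _; apply: ellip_ge => //; exact: leq_addr.
have [S1 S2] := energy_step Nk qk.
have qk1 := lt_le_trans qk (ellip_incr Nk).
have E : (ellip k.+1 / ellip n) ^+ 204 = (ellip k / ellip n) ^+ 204 * (ellip k.+1 / ellip k) ^+ 204.
  by rewrite -exprMn; congr (_ ^+ _); field; rewrite !gt_eqF.
rewrite E; split.
- by apply: (le_trans S1); rewrite mulrA; apply: ler_wpM2r => //; rewrite exprn_ge0 // divr_ge0 // ltW.
- apply: (le_trans IH2).
  have P0 : 0 <= (ellip k / ellip n) ^+ 204 by rewrite exprn_ge0 // divr_ge0 // ltW.
  by have := ler_wpM2r P0 S2; rewrite -mulrA (mulrC ((ellip k.+1 / ellip k) ^+ 204)).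
Qed.

End Dynamics.

Lemma energy_polynomially_stable {R : realType} : exists K : nat, forall (a b u : nat -> R) (x : R) N,
  edge_regular a b N -> 1 <= x -> x <= 2 ->
  (forall n, (N <= n)%N -> a n.+2 * u n.+2 = (x - b n.+2) * u n.+1 - a n.+1 * u n) ->
  forall n m, (N <= n)%N -> (n <= m)%N -> 0 < ellip a b x n ->
  energy a b u x m <= energy a b u x n * (ellip a b x m / ellip a b x n) ^+ K /\
  energy a b u x n <= energy a b u x m * (ellip a b x m / ellip a b x n) ^+ K.
Proof.
by exists 204%N => a b u x N hab x1 x2 rec n m; exact: (@energy_comparable R a b u x N hab x1 x2 rec n m).
Qed.

(** * The density and the polynomials at the turning point *)

Section Estimates.
Context {R : realType}.
Implicit Types x g t : R.

Lemma near_edge_point x0 x rho : rho <= 2 - x0 -> rho <= x0 - 1 ->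
  - rho < x - x0 -> x - x0 < rho -> 1 <= x /\ x <= 2.
Proof. by move=> *; split; lra. Qed.

Lemma ellip_near (a b : nat -> R) n x0 x g rho : g <= ellip a b x0 n -> rho <= g / 2 ->
  x - x0 < rho -> g / 2 <= ellip a b x n.
Proof. by rewrite /ellip => *; lra. Qed.

Lemma ellip_le1 (a b : nat -> R) n x : a n.+1 <= 1 -> b n.+2 <= 0 -> 1 <= x -> ellip a b x n <= 1.
Proof. by rewrite /ellip => *; lra. Qed.

Lemma lower_assembly (F c G T z : R) : F * (T / 2 * G * c) <= 16 -> z <= F * c * G * (2 * T) -> z <= 96.
Proof. by move=> ? ?; lra. Qed.

Lemma half_energy s g T : g / 4 * s <= T -> s * (g / 2) <= 2 * T.
Proof. by move=> ?; lra. Qed.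

Lemma upper_edge_itv x0 : 3 / 2 < x0 -> x0 < 2 -> x0 \in `](-2), 2[.
Proof. by move=> ? ?; rewrite in_itv /=; apply/andP; split; lra. Qed.

Lemma upper_edge_nbhs x0 rho : rho <= 2 - x0 -> rho <= x0 - 1 ->
  -2 <= x0 - rho /\ x0 + rho <= 2.
Proof. by move=> *; split; lra. Qed.

End Estimates.

Section EllipticDensity.
Context {R : realType} (mu : probability (measurableTypeR R) R) (B : R).
Hypothesis B2 : (2 : R) <= B.
Hypothesis supp : mu (~` `[- B, B]%classic) = 0%E.
Variables (p : nat -> {poly R}) (a b : nat -> R).
Hypothesis orth : orthonormal_polys mu p.
Hypothesis jac : forall n, 'X * p n =
      (if n is m.+1 then a n *: p m else 0)
      + b n.+1 *: p n + a n.+1 *: p n.+1.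
Hypothesis a_gt0 : forall n, (0 < n)%N -> 0 < a n.
Hypothesis cva : a n @[n --> \oo] --> (1 : R).
Hypothesis cvb : b n @[n --> \oo] --> (0 : R).
Variable N : nat.
Hypothesis hab : edge_regular a b N.

Lemma poly_rec x n : a n.+2 * (p n.+2).[x] = (x - b n.+2) * (p n.+1).[x] - a n.+1 * (p n).[x].
Proof. by rewrite mulrBl (jacobi_rec jac n x); ring. Qed.

Lemma consecutive_neq0 x n : 0 < (p n.+1).[x] ^+ 2 + (p n).[x] ^+ 2.
Proof.
rewrite lt_def addr_ge0 ?sqr_ge0 // andbT.
apply/eqP => /eqP; rewrite paddr_eq0 ?sqr_ge0 // !sqrf_eq0 => /andP[/eqP h1 /eqP h0].
have p0 : p 0 = 1 by case: orth.
elim: n h1 h0 => [|n IH] h1 h0; first by move: h0; rewrite p0 hornerC => /eqP; rewrite oner_eq0.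
apply: IH => //; have := poly_rec x n; rewrite h1 h0 !mulr0 sub0r.
by move/eqP; rewrite eq_sym oppr_eq0 mulf_eq0 gt_eqF ?a_gt0 //= => /eqP.
Qed.

Variable f : R -> R.
Hypothesis f_density : ac_density mu f.
Hypothesis f_cont : {in `](-2), 2[, continuous f}.
Hypothesis f_gt0 : {in `](-2), 2[, forall x, 0 < f x}.

Let u (x : R) (n : nat) : R := (p n).[x].

(** The Turan determinant at [n1] is continuous and comparable to [size2];
    its later values near [x0] differ by a factor between [(g / 2) ^ K] and its
    inverse, since [ellip] lies between [g / 2] and 1. These are the bounds that
    the weak limit of the determinants transfers to the density. *)
Lemma elliptic_density : exists (K : nat) (C : R), 0 < C /\ forall n1 x0 g,
  (N <= n1)%N -> 3 / 2 < x0 -> x0 < 2 -> 0 < g -> g <= 1 -> g <= ellip a b x0 n1 ->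
  f x0 * size2 (u x0) n1 * (g / 2) ^+ K.+1 <= C /\
  semi x0 * (g / 2) ^+ K.+1 <= C * size2 (u x0) n1 * f x0.
Proof.
pose cw : R := semi_int (fun=> 1 : R).
have cw0 : 0 < cw by exact: semi_int1_gt0.
have [K comparable] := @energy_polynomially_stable R.
exists K, (96 * (cw + cw^-1)); split; first by rewrite mulr_gt0 // addr_gt0 // invr_gt0.
move=> n1 x0 g Nn1 x01 x02 g0 g1 hg.
have s0 : 0 < size2 (u x0) n1 by exact: consecutive_neq0.
set s := size2 (u x0) n1 in s0 *.
have rec x n : (N <= n)%N -> a n.+2 * u x n.+2 = (x - b n.+2) * u x n.+1 - a n.+1 * u x n.
  by move=> _; exact: poly_rec.
have ET x n : (N <= n)%N -> energy a b (u x) x n = turan p a n x.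
  by move=> h; rewrite (energy_turan (rec x) h).
have x1 : 1 <= x0 by apply: ltW; apply: lt_trans x01; rewrite ltr_pdivlMr // mul1r ltr_nat.
pose T0 := turan p a n1 x0.
have T0lo : g / 4 * s <= T0.
  rewrite /T0 -ET //; apply: le_trans (energy_ge (u x0) hab x1 Nn1 _); last exact: le_trans (ltW g0) hg.
  by rewrite ler_pM2r // ler_pM2r // invr_gt0.
have T0hi : T0 <= 3 * s by rewrite /T0 -ET //; apply: (energy_le (u x0) hab x1 (ltW x02) Nn1).
have T00 : 0 < T0 by apply: lt_le_trans T0lo; rewrite !mulr_gt0.
have T02 : 0 < T0 / 2 by rewrite divr_gt0.
have [r1 r10 hr1] : exists2 r : R, 0 < r & forall y, `|y - x0| < r -> `|T0 - turan p a n1 y| < T0 / 2.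
  have := @cont_turan _ p a n1 x0; move/cvgrPdist_lt => /(_ _ T02) /nbhs_ballP [r /= r0 hr].
  by exists r => // y hy; apply: hr; rewrite /ball /= distrC.
pose rho := Num.min r1 (Num.min (g / 2) (Num.min (2 - x0) (x0 - 1))).
have rho0 : 0 < rho by rewrite !lt_min r10 divr_gt0 //= subr_gt0 x02 subr_gt0; lra.
have rr1 : rho <= r1 by rewrite ge_min lexx.
have rr2 : rho <= g / 2 by rewrite !ge_min lexx !orbT.
have rr3 : rho <= 2 - x0 by rewrite !ge_min lexx !orbT.
have rr4 : rho <= x0 - 1 by rewrite !ge_min lexx !orbT.
have [G G0 GE] : exists2 G, 0 < G & (g / 2) ^+ K = G by exists ((g / 2) ^+ K) => //; rewrite exprn_gt0 // divr_gt0.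
pose Alo := T0 / 2 * G; pose Ahi := 2 * T0 / G.
have Alo0 : 0 < Alo by rewrite mulr_gt0.
have U_in : -2 <= x0 - rho /\ x0 + rho <= 2 by exact: upper_edge_nbhs rr3 rr4.
have bounds n : (n1 <= n)%N -> forall x, `|x - x0| < rho -> Alo <= turan p a n x <= Ahi.
  move=> hn x hx; have := hx; rewrite ltr_norml => /andP[hx1 hx2].
  have [y1 y2] := near_edge_point rr3 rr4 hx1 hx2.
  have Nn : (N <= n)%N by exact: leq_trans hn.
  have q1 : g / 2 <= ellip a b x n1 := ellip_near hg rr2 hx2.
  have q0 : 0 < ellip a b x n1 by apply: lt_le_trans q1; rewrite divr_gt0.
  have [H1 H2] := comparable _ _ _ _ _ hab y1 y2 (rec x) _ _ Nn1 hn q0.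
  rewrite !ET // in H1 H2.
  have qm : 0 < ellip a b x n by apply: lt_le_trans q0 (ellip_ge x hab Nn1 hn).
  have qm1 : ellip a b x n <= 1.
    have [_ h1 _ _ _] := hab (leqW Nn); have [_ _ _ _ [h2 _]] := hab (leqW (leqW Nn)).
    exact: ellip_le1 h1 h2 y1.
  have rat : (ellip a b x n / ellip a b x n1) ^+ K <= G^-1.
    rewrite -GE -exprVn; apply: lerXn2r; rewrite ?nnegrE ?divr_ge0 ?invr_ge0 //; try exact: ltW.
      by rewrite ltW // divr_gt0.
    rewrite -[leRHS]mul1r; apply: ler_pM => //; first exact: ltW.
      by rewrite invr_ge0 ltW.
    by rewrite lef_pV2 // posrE // divr_gt0.
  have [t1 t2 t3] := near_value T00 (hr1 x (lt_le_trans hx rr1)).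
  set rt := _ ^+ K in rat H1 H2.
  have rt0 : 0 <= rt by rewrite exprn_ge0 // divr_ge0 // ltW.
  have Tn0 : 0 <= turan p a n x.
    rewrite -ET //; apply: le_trans (energy_ge (u x) hab y1 Nn (ltW qm)).
    by rewrite mulr_ge0 ?divr_ge0 ?size2_ge0 // ltW.
  apply/andP; split.
  - have h : turan p a n1 x <= turan p a n x * G^-1 by apply: (le_trans H2); exact: ler_wpM2l.
    by rewrite /Alo -ler_pdivlMr //; exact: le_trans t1 h.
  - have h : turan p a n x <= turan p a n1 x * G^-1.
      by apply: (le_trans H1); apply: ler_wpM2l.
    by rewrite /Ahi; apply: (le_trans h); rewrite ler_pM2r ?invr_gt0.
have x0I := upper_edge_itv x01 x02.
have [D1 D2] := @density_bounds _ _ _ B2 supp _ _ _ orth jac cva cvb x0 rho Alo Ahi n1 rho0 U_in Alo0 bounds f f_density (f_cont x0I) (f_gt0 x0I).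
have fx := f_gt0 x0I.
rewrite -/cw in D1 D2.
have g2 : 0 < g / 2 by rewrite divr_gt0.
have GS : (g / 2) ^+ K.+1 = G * (g / 2) by rewrite exprSr GE.
rewrite GS; split.
- move: D1; rewrite /itv_const -/cw ler_pdivlMr ?mulr_gt0 // => D1.
  apply: (@le_trans _ _ (96 * cw^-1)); last by rewrite ler_pM2l // lerDr ltW.
  rewrite ler_pdivlMr //.
  have h := half_energy T0lo.
  have : f x0 * s * (G * (g / 2)) * cw <= f x0 * cw * G * (2 * T0).
    rewrite (_ : f x0 * s * (G * (g / 2)) * cw = f x0 * cw * G * (s * (g / 2))); last by ring.
    by rewrite ler_pM2l // !mulr_gt0.
  exact: lower_assembly D1.
- apply: (@le_trans _ _ (96 * cw * s * f x0)); last first.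
    by rewrite ler_pM2r // ler_pM2r // ler_pM2l // lerDl invr_ge0 ltW.
  move: D2; rewrite ler_pdivrMr ?mulr_gt0 // => D2.
  have sm0 : 0 <= semi x0 by exact: semi_ge0.
  apply: (@le_trans _ _ (semi x0 * G)).
    rewrite ler_wpM2l // ler_piMr ?ltW // ltr_pdivrMr // mul1r.
    by apply: le_lt_trans g1 _; rewrite ltr1n.
  rewrite -ler_pdivlMr //; apply: (le_trans D2).
  rewrite /Ahi (_ : 2 * T0 / G * f x0 * (16 * cw) = 32 * cw * f x0 * T0 / G); last by ring.
  rewrite ler_pM2r ?invr_gt0 //.
  rewrite (_ : 96 * cw * s * f x0 = 32 * cw * f x0 * (3 * s)); last by ring.
  by rewrite ler_pM2l // !mulr_gt0.
Qed.

End EllipticDensity.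

(** * All solutions below the turning point *)

Lemma sqr_mono {R : realType} (y z : R) : 0 <= y -> y <= z -> y ^+ 2 <= z ^+ 2.
Proof. by move=> y0 yz; rewrite lerXn2r // nnegrE (le_trans y0). Qed.

Lemma sum_sqr_bound {R : realType} (v w z : R) : 0 <= v -> 0 <= w -> v <= 155 * z -> w <= 805 * z ->
  w ^+ 2 + v ^+ 2 <= 10 ^+ 6 * z ^+ 2.
Proof.
move=> v0 w0 h1 h2; have := sqr_mono v0 h1; have := sqr_mono w0 h2.
by have := sqr_ge0 z; rewrite !exprMn; lra.
Qed.

Lemma sqr_sum_le {R : realType} (v w : R) : (v + w) ^+ 2 <= 2 * (v ^+ 2 + w ^+ 2).
Proof. have := sqr_ge0 (v - w); nra. Qed.

Lemma wronskian_bound {R : realType} (c w v1 v2 y : R) : 2^-1 <= c -> 0 <= w -> 0 <= v1 -> 0 <= v2 -> 0 <= y ->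
  c * w <= v2 * (155 * y) + v1 * (805 * y) -> w <= 1920 * ((v2 + v1) * y).
Proof.
move=> hc w0 h1 h2 y0 h.
have e1 : 0 <= v1 * y by rewrite mulr_ge0.
have e2 : 0 <= v2 * y by rewrite mulr_ge0.
have e3 : 2^-1 * w <= c * w by rewrite ler_wpM2r.
lra.
Qed.

Lemma add_bounds {R : realType} (v w z : R) : v <= 1920 * z -> w <= 1920 * z -> v + w <= 3840 * z.
Proof. by move=> ? ?; lra. Qed.

Lemma square_bound {R : realType} (t s : R) : 0 <= s -> t ^+ 2 <= 2 * s ->
  3840 ^+ 2 * t ^+ 2 <= 10 ^+ 8 * s.
Proof. by move=> ? ?; lra. Qed.

Lemma growing_bound {R : realType} (t s X : R) : t ^+ 2 <= 2 * s -> X <= 5 ^+ 2 * t ^+ 2 -> X <= 50 * s.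
Proof. by move=> ? ?; lra. Qed.

Lemma next_values_bound {R : realType} (v0 v1 v2 v3 v4 y : R) : v0 <= v1 -> v1 <= 5 * y ->
  v2 <= 5 * v1 + v0 -> v3 <= 5 * v2 + v1 -> v4 <= 5 * v3 + v2 -> v3 <= 155 * y /\ v4 <= 805 * y.
Proof. by move=> *; split; lra. Qed.

Section Hyperbolic.
Context {R : realType}.
Variables (a b : nat -> R) (x : R) (N : nat).
Hypothesis hab : edge_regular a b N.
Hypothesis x1 : 1 <= x.
Hypothesis x2 : x <= 2.

Definition solves (u : nat -> R) := forall n, (N <= n)%N -> a n.+2 * u n.+2 = (x - b n.+2) * u n.+1 - a n.+1 * u n.

Fixpoint sol_pair (v0 v1 : R) (j : nat) : R * R :=
  if j is i.+1 then
    let w := sol_pair v0 v1 i in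
    (w.2, ((x - b (N + i).+2) * w.2 - a (N + i).+1 * w.1) / a (N + i).+2)
  else (v0, v1).

Definition sol v0 v1 n := (sol_pair v0 v1 (n - N)).1.

Lemma sol_solves v0 v1 : [/\ sol v0 v1 N = v0, sol v0 v1 N.+1 = v1 & solves (sol v0 v1)].
Proof.
split; rewrite /sol ?subnn // ?subSnn //.
move=> n Nn.
have E1 : (n.+1 - N = (n - N).+1)%N by rewrite subSn.
have E2 : (n.+2 - N = (n - N).+2)%N by rewrite subSn ?E1 // leqW.
rewrite E2 E1 /= subnKC // mulrC divfK //.
by have [a0 _ _ _ _] := hab (leqW (leqW Nn)); rewrite gt_eqF //; lra.
Qed.

Lemma solves_uniq u v : solves u -> solves v -> u N = v N -> u N.+1 = v N.+1 ->
  forall n, (N <= n)%N -> u n = v n.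
Proof.
move=> su sv e0 e1 n /subnKC <-.
suff: u (N + (n - N))%N = v (N + (n - N))%N /\ u (N + (n - N)).+1 = v (N + (n - N)).+1 by case.
elim: (n - N)%N => [|j [IH1 IH2]]; first by rewrite addn0.
rewrite addnS; split => //.
have Nj : (N <= N + j)%N by exact: leq_addr.
have [a0 _ _ _ _] := hab (leqW (leqW Nj)).
have an : a (N + j).+2 != 0 by rewrite gt_eqF //; lra.
by apply: (mulfI an); rewrite su // sv // IH1 IH2.
Qed.

Lemma sol_decomp u : solves u -> forall n, (N <= n)%N ->
  u n = u N * sol 1 1 n + (u N.+1 - u N) * sol 0 1 n.
Proof.
move=> su.
have [k0 k1 sk] := sol_solves 1 1; have [z0 z1 sz] := sol_solves 0 1.
apply: solves_uniq => //.
- by move=> n Nn; rewrite !mulrDr !(mulrCA (a n.+2)) sk // sz //; ring.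
- by rewrite k0 z0; ring.
- by rewrite k1 z1; ring.
Qed.

Lemma wronskian u v : solves u -> solves v -> forall n, (N <= n)%N ->
  a n.+1 * (u n.+1 * v n - u n * v n.+1) = a N.+1 * (u N.+1 * v N - u N * v N.+1).
Proof.
move=> su sv n /subnKC <-; elim: (n - N)%N => [|j IH]; first by rewrite addn0.
rewrite addnS -IH; have Nj : (N <= N + j)%N by exact: leq_addr.
have := su _ Nj; have := sv _ Nj; set m := (N + j)%N => sv' su'.
have -> : a m.+2 * (u m.+2 * v m.+1 - u m.+1 * v m.+2) = (a m.+2 * u m.+2) * v m.+1 - u m.+1 * (a m.+2 * v m.+2) by ring.
by rewrite su' sv'; ring.
Qed.

Variables (m : nat) (g : R).
Hypothesis Nm : (N.+1 < m)%N.
Hypothesis gm : 0 <= gap a b x m.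
Hypothesis g0 : 0 < g.
Hypothesis g1 : g <= 1.
Hypothesis gm1 : g <= gap a b x m.-1.

Let G := growth a b x N m.

Lemma growth_ge1' : 1 <= G. Proof. exact: growth_ge1. Qed.

(** The multiplier is at least [1 + g] one step before the turning point, so
    there the solution is at most [5 / g] times its growing part; the next three
    values cost constants only. *)
Lemma positive_solution_bound v : solves v -> 0 <= v N -> v N <= v N.+1 ->
  `|v m.+1| <= 155 * (v N.+1 * G / g) /\ `|v m.+2| <= 805 * (v N.+1 * G / g).
Proof.
move=> sv v0 v1.
have G0 := g0; have G1 := g1; have X1 := x1; have X2 := x2.
have [k mE] : exists k, m = k.+2 by case: m Nm => [//|[//|k]] _; exists k.
rewrite /G; move: Nm gm gm1; rewrite mE => Nk gk gk1; rewrite /= in gk1.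
set G' := growth a b x N k.+2.
have gk1' : 0 <= gap a b x k.+1 := le_trans (ltW g0) gk1.
have Nk1 : (N < k.+1)%N by exact: Nk.
have Nk0 : (N <= k)%N by exact: Nk.
have U := hyper_upper_all hab x1 sv gk1' v0 v1 Nk1; rewrite /= in U.
have [w0 w1] := hyper_incr_all hab x1 sv gk v0 v1 Nk0 (leqnSn _).
have w2 := le_trans w0 w1.
have Gs : growth a b x N k.+1 <= G'.
  have h0 : 0 <= growth a b x N k.+1 by apply: le_trans (growth_ge1 a b x N k.+1).
  by rewrite /G' (growthS a b x Nk1); have := ler_wpM2l h0 (mult_ge1 (gap a b x k.+2)); rewrite mulr1.
have vN : 0 <= v N.+1 := le_trans v0 v1.
have lam := mult_ge_sqrt (gap a b x k.+1).
have lam5 : mult (gap a b x k.+1) <= 5.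
  by apply: (le_trans (mult_le gk1')); have := gap_le3 hab x2 (leqW Nk0); lra.
have sg : g <= Num.sqrt (gap a b x k.+1).
  rewrite -[leLHS](ger0_norm (ltW g0)) -sqrtr_sqr ler_sqrt //.
  by apply: le_trans gk1; rewrite expr2 ler_piMl // ltW.
have lp := mult_gt0 (gap a b x k.+1).
set la := mult _ in lam lam5 lp U.
have key : v k.+1 * g <= 5 * (v N.+1 * G').
  have h1 : v k.+1 - v k.+1 / la <= v N.+1 * G'.
    apply: (@le_trans _ _ (grow_part a b v x k)).
      by rewrite /grow_part -/la lerD2l lerN2 ler_pM2r ?invr_gt0.
    by apply: (le_trans U); exact: ler_wpM2l.
  have h2 : v k.+1 - v k.+1 / la = v k.+1 * (la - 1) / la by field; rewrite gt_eqF.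
  rewrite h2 ler_pdivrMr // in h1.
  have h3 : v k.+1 * g <= v k.+1 * (la - 1) by apply: ler_wpM2l => //; rewrite lerBrDl; exact: le_trans (lerD (lexx 1) sg) lam.
  have h4 : v N.+1 * G' * la <= v N.+1 * G' * 5.
    by apply: ler_wpM2l => //; rewrite mulr_ge0 //; apply: le_trans (growth_ge1 _ _ _ _ _).
  by apply: (le_trans h3); apply: (le_trans h1); rewrite [5 * _]mulrC.
set Y := v N.+1 * G' / g.
have b0 : v k.+1 <= 5 * Y by rewrite /Y mulrA ler_pdivlMr.
have F1 := forward_bound hab x1 x2 sv Nk0.
have F2 := forward_bound hab x1 x2 sv (leqW Nk0).
have F3 := forward_bound hab x1 x2 sv (leqW (leqW Nk0)).
rewrite (ger0_norm w0) (ger0_norm w2) in F1; rewrite (ger0_norm w2) in F2.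
exact: next_values_bound w1 b0 F1 F2 F3.
Qed.

(** The upper bound decomposes [u] on the solutions with data [(1, 1)] and
    [(0, 1)]. The second bound is the constancy of the Wronskian of [u] with
    these: [u] cannot be smaller at the turning point than the inverse of their
    growth. In the third, both components of [u] are
    nonnegative and the one on the data [(0, 1)] is kept. *)
Lemma hyperbolic_bounds u : solves u ->
  let A : R := `|u N| + `|u N.+1 - u N| in
  let s : R := size2 u m.+1 in
  [/\ s * g ^+ 2 <= 10 ^+ 6 * (A ^+ 2 * G ^+ 2),
      A ^+ 2 * g ^+ 2 <= 10 ^+ 8 * (G ^+ 2 * s) &
      0 <= u N -> u N <= u N.+1 -> (u N.+1 - u N) ^+ 2 * G ^+ 2 <= 50 * s].
Proof.
move=> su A s.
have G0 := g0; have G1 := growth_ge1'; have X1 := x1; have X2 := x2.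
have [k0 k1 sk] := sol_solves 1 1; have [z0 z1 sz] := sol_solves 0 1.
have kN : 0 <= sol 1 1 N by rewrite k0.
have kN1 : sol 1 1 N <= sol 1 1 N.+1 by rewrite k0 k1.
have zN : 0 <= sol 0 1 N by rewrite z0.
have zN1 : sol 0 1 N <= sol 0 1 N.+1 by rewrite z0 z1.
have [Bk1 Bk2] := positive_solution_bound sk kN kN1.
have [Bz1 Bz2] := positive_solution_bound sz zN zN1.
rewrite k1 mul1r in Bk1 Bk2; rewrite z1 mul1r in Bz1 Bz2.
have Nm0 : (N <= m)%N by exact: ltnW (ltnW Nm).
have Y0 : 0 <= G / g by rewrite divr_ge0 // ?(ltW g0) // (le_trans ler01 G1).
set Y := G / g in Bk1 Bk2 Bz1 Bz2 Y0.
have A0 : 0 <= A by rewrite addr_ge0.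
have up n Z : (N <= n)%N -> `|sol 1 1 n| <= Z -> `|sol 0 1 n| <= Z -> `|u n| <= A * Z.
  move=> Nn h1 h2; rewrite (sol_decomp su Nn); apply: (le_trans (ler_normD _ _)).
  by rewrite !normrM /A mulrDl; apply: lerD; exact: ler_wpM2l.
have u1 := up _ _ (leqW Nm0) Bk1 Bz1; have u2 := up _ _ (leqW (leqW Nm0)) Bk2 Bz2.
have YE : Y * g = G by rewrite /Y divfK // gt_eqF.
have sE : s = `|u m.+2| ^+ 2 + `|u m.+1| ^+ 2 by rewrite !real_normK ?num_real.
have n1 := normr_ge0 (u m.+1); have n2 := normr_ge0 (u m.+2).
split.
- have GE : G ^+ 2 = Y ^+ 2 * g ^+ 2 by rewrite -YE exprMn.
  rewrite GE (_ : 10 ^+ 6 * (A ^+ 2 * (Y ^+ 2 * g ^+ 2)) = 10 ^+ 6 * (A * Y) ^+ 2 * g ^+ 2); last by ring.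
  apply: ler_wpM2r; first exact: sqr_ge0.
  set Z := A * Y.
  have Z0 : 0 <= Z by rewrite mulr_ge0.
  have q1 : `|u m.+1| <= 155 * Z by rewrite /Z mulrCA.
  have q2 : `|u m.+2| <= 805 * Z by rewrite /Z mulrCA.
  by rewrite sE; exact: sum_sqr_bound.
- set t := `|u m.+2| + `|u m.+1|.
  have t0 : 0 <= t by rewrite addr_ge0.
  have ts : t ^+ 2 <= 2 * s by rewrite sE /t; exact: sqr_sum_le.
  have [a0 _ _ _ _] := hab (leqnSn N).
  have [_ am _ _ _] := hab (leqW (leqW Nm0)); have [am0 _ _ _ _] := hab (leqW (leqW Nm0)).
  have W v : solves v -> `|v m.+1| <= 155 * Y -> `|v m.+2| <= 805 * Y ->
      `|u N.+1 * v N - u N * v N.+1| <= 1920 * (t * Y).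
    move=> sv h1 h2; have := wronskian su sv (leqW Nm0) => w.
    apply: (wronskian_bound a0) => //.
    rewrite -[a N.+1]ger0_norm; last by apply: le_trans a0; rewrite invr_ge0.
    rewrite -normrM -w normrM; apply: (@le_trans _ _ (1 * `|u m.+2 * v m.+1 - u m.+1 * v m.+2|)).
      by apply: ler_wpM2r => //; rewrite ger0_norm //; apply: le_trans am0; rewrite invr_ge0.
    rewrite mul1r; apply: (le_trans (ler_normB _ _)); rewrite !normrM.
    by apply: lerD; exact: ler_wpM2l.
  have Wz := W _ sz Bz1 Bz2; rewrite z0 z1 mulr0 mulr1 sub0r normrN in Wz.
  have Wk := W _ sk Bk1 Bk2; rewrite k0 k1 !mulr1 in Wk.
  have AA : A <= 3840 * (t * Y) by rewrite /A; exact: add_bounds.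
  have tY : 0 <= t * Y by rewrite mulr_ge0.
  have A2 : A ^+ 2 <= (3840 * (t * Y)) ^+ 2 by apply: sqr_mono.
  apply: (@le_trans _ _ ((3840 * (t * Y)) ^+ 2 * g ^+ 2)); first by apply: ler_wpM2r => //; exact: sqr_ge0.
  rewrite -exprMn (_ : 3840 * (t * Y) * g = 3840 * t * G); last by rewrite -YE; ring.
  rewrite (_ : (3840 * t * G) ^+ 2 = G ^+ 2 * (3840 ^+ 2 * t ^+ 2)); last by ring.
  rewrite (_ : 10 ^+ 8 * (G ^+ 2 * s) = G ^+ 2 * (10 ^+ 8 * s)); last by ring.
  have s0 : 0 <= s by exact: size2_ge0.
  apply: ler_wpM2l; first exact: sqr_ge0.
  exact: square_bound.
- move=> v0 v1.
  have d0 : 0 <= u N.+1 - u N by rewrite subr_ge0.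
  have zp : 0 <= sol 0 1 N.+1 by rewrite z1.
  have Lz := hyper_lower_all hab x1 sz gm z0 zp (ltnW Nm); rewrite z1 mul1r -/G in Lz.
  have k0m : 0 <= sol 1 1 m.
    have Nm1 : (N <= m.-1)%N by rewrite -ltnS prednK ?(ltnW Nm) //; exact: leq_ltn_trans (ltnW Nm).
    have mm : m.-1.+1 = m by rewrite prednK //; exact: leq_ltn_trans (ltnW Nm).
    have := hyper_incr_all hab x1 sk gm kN kN1 Nm1.
    rewrite mm => /(_ (leqnn _)) [h1 h2].
    exact: le_trans h1 h2.
  have um : (u N.+1 - u N) * G <= u m.
    rewrite (sol_decomp su Nm0); apply: (@le_trans _ _ ((u N.+1 - u N) * sol 0 1 m)).
      exact: ler_wpM2l.
    by rewrite lerDr mulr_ge0.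
  have Bb := backward_bound hab x1 x2 su Nm0.
  have dG : 0 <= (u N.+1 - u N) * G by rewrite mulr_ge0 // (le_trans ler01 G1).
  rewrite (ger0_norm (le_trans dG um)) in Bb.
  rewrite -exprMn sE.
  apply: (@growing_bound _ (`|u m.+1| + `|u m.+2|)); first by rewrite [X in 2 * X]addrC; exact: sqr_sum_le.
  by rewrite -[leRHS]exprMn; apply: sqr_mono => //; exact: le_trans um Bb.
Qed.

End Hyperbolic.

(** * The logarithm of the density and the growth product *)

Section LogHelpers.
Context {R : realType}.
Implicit Types x y : R.

Lemma ln_mono x y : 0 < x -> x <= y -> ln x <= ln y.
Proof. by move=> x0 xy; rewrite ler_ln // posrE //; exact: lt_le_trans xy. Qed.

Lemma lnMp x y : 0 < x -> 0 < y -> ln (x * y) = ln x + ln y.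
Proof. by move=> x0 y0; rewrite lnM // posrE. Qed.

Lemma lnXp n x : 0 < x -> ln (x ^+ n) = n%:R * ln x.
Proof. by move=> x0; rewrite lnXn // mulr_natl. Qed.

Lemma lnVp x : 0 < x -> ln x^-1 = - ln x.
Proof. by move=> x0; rewrite lnV // posrE. Qed.

Lemma powR_neg_le (x y r : R) : 0 < x -> x <= y -> 0 <= r -> y `^ (- r) <= x `^ (- r).
Proof.
move=> x0 xy r0; rewrite !powRN lef_pV2 ?posrE ?powR_gt0 //; last exact: lt_le_trans xy.
by apply: ge0_ler_powR => //; rewrite nnegrE; lra.
Qed.

Lemma powR_le1 (x r : R) : 0 <= x -> x <= 1 -> 0 <= r -> x `^ r <= 1.
Proof.
move=> x0 x1 r0; apply: (@le_trans _ _ (1 `^ r)); last by rewrite powR1.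
by apply: ge0_ler_powR; rewrite ?nnegrE.
Qed.

Lemma lnX2 x : 0 < x -> ln (x ^+ 2) = 2 * ln x.
Proof. by move=> x0; rewrite lnXp. Qed.

Lemma ln_sqr_le (s g c A G : R) : 0 < s -> 0 < g -> 0 < c -> 0 < A -> 0 < G ->
  s * g ^+ 2 <= c * (A ^+ 2 * G ^+ 2) -> ln s + 2 * ln g <= ln c + 2 * (ln A + ln G).
Proof.
move=> s0 g0 c0 A0 G0.
have g2 := exprn_gt0 2 g0; have A2 := exprn_gt0 2 A0; have G2 := exprn_gt0 2 G0.
move/(ln_mono (mulr_gt0 s0 g2)).
by rewrite (lnMp s0 g2) (lnMp c0 (mulr_gt0 A2 G2)) (lnMp A2 G2) (lnX2 g0) (lnX2 A0) (lnX2 G0) mulrDr.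
Qed.

Lemma ln_sqr_ge (s g c A G : R) : 0 < s -> 0 < g -> 0 < c -> 0 < A -> 0 < G ->
  A ^+ 2 * g ^+ 2 <= c * (G ^+ 2 * s) -> 2 * ln A + 2 * ln g <= ln c + 2 * ln G + ln s.
Proof.
move=> s0 g0 c0 A0 G0.
have g2 := exprn_gt0 2 g0; have A2 := exprn_gt0 2 A0; have G2 := exprn_gt0 2 G0.
move/(ln_mono (mulr_gt0 A2 g2)).
by rewrite (lnMp A2 g2) (lnMp c0 (mulr_gt0 G2 s0)) (lnMp G2 s0) (lnX2 g0) (lnX2 A0) (lnX2 G0) addrA.
Qed.

End LogHelpers.

Definition defect {R : realType} (a b : nat -> R) (n : nat) : R := 2 - 2 * a n - b n.

(** [F], [S], [Gl] and [lA] stand for the logarithms of the density, of the sum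
    of squares, of the growth product and of the size of the initial data, and
    [L] for [ln eps^-1]. *)
Lemma log_algebra {R : realType} (F S Gl K1 q kap L lC lA lA1 lA2 l2 l6 l8 ls : R) :
  0 <= Gl -> 1 <= L ->
  F + S - K1 * (q + kap * L) <= lC ->
  ls - K1 * (q + kap * L) <= lC + S + F -> - L <= ls ->
  S + 2 * (l2 - (q + kap * L)) <= l6 + 2 * (lA + Gl) ->
  2 * lA + 2 * (l2 - (q + kap * L)) <= l8 + 2 * Gl + S ->
  lA1 <= lA -> lA <= lA2 ->
  `|F| <= (`|lC| + K1 * q + `|l6| + `|l8| + 2 * `|l2| + 2 * q + 2 * `|lA1| + 2 * `|lA2|) + (K1 * kap + 2 * kap + 1) * L + 2 * Gl
  /\ F <= - S + `|lC| + K1 * q + K1 * kap * L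
  /\ - 2 * Gl - (`|lC| + K1 * q + `|l6| + 2 * `|l2| + 2 * q + 2 * `|lA2|) - (K1 * kap + 2 * kap + 1) * L <= F.
Proof.
move=> G0 L1 h1 h2 h3 h4 h5 h6 h7.
have n1 := ler_norm lC; have n2 := ler_norm (- lC); rewrite normrN in n2.
have n3 := ler_norm l6; have n4 := ler_norm (- l6); rewrite normrN in n4.
have n5 := ler_norm l8; have n6 := ler_norm (- l8); rewrite normrN in n6.
have n7 := ler_norm l2; have n8 := ler_norm (- l2); rewrite normrN in n8.
have n9 := ler_norm lA1; have n10 := ler_norm (- lA1); rewrite normrN in n10.
have n11 := ler_norm lA2; have n12 := ler_norm (- lA2); rewrite normrN in n12.
split; last by split; lra.
by rewrite ler_norml; apply/andP; split; lra.
Qed.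

Lemma log_final (R : realType) (F lG ls aC Kq a6 a8 a2 q aA1 aA2 ad a9 l9 ld KkL kL L ca caL cbL : R) :
  F <= - ls + aC + Kq + KkL ->
  - 2 * lG - (aC + Kq + a6 + 2 * a2 + 2 * q + 2 * aA2) - cbL <= F ->
  2 * ld + 2 * lG <= l9 + ls -> - ld <= ad -> l9 <= a9 ->
  0 <= a6 -> 0 <= a8 -> 0 <= a2 -> 0 <= q -> 0 <= aA1 -> 0 <= aA2 -> 0 <= ad -> 0 <= a9 ->
  0 <= kL -> 0 <= KkL -> 0 <= L ->
  ca = aC + Kq + a6 + a8 + 2 * a2 + 2 * q + 2 * aA1 + 2 * aA2 + 2 * ad + a9 ->
  ca <= caL -> cbL = KkL + 2 * kL + L ->
  `|F + 2 * lG| <= caL + cbL.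
Proof. by move=> *; rewrite ler_norml; apply/andP; split; lra. Qed.

Definition log_const (R : realType) (K : nat) (C c1 kap c6 c8 c9 A1 d : R) : R :=
  (`|ln C| + K.+1%:R * (`|ln 2 - ln c1| + `|kap|) + `|ln c6| + `|ln c8| + 2 * `|ln 2|
    + 2 * (`|ln 2 - ln c1| + `|kap|) + 2 * `|ln A1| + 2 * `|ln (4 * A1)|)
  + 2 * `|ln d| + `|ln c9| + (K.+1%:R * `|kap| + 2 * `|kap| + 1).

Lemma log_const_ge0 (R : realType) (K : nat) (C c1 kap c6 c8 c9 A1 d : R) : 0 <= log_const K C c1 kap c6 c8 c9 A1 d.
Proof. by rewrite !addr_ge0 // ?mulr_ge0 // ?addr_ge0 // mulr_ge0. Qed.

(** The hypotheses on products become linear after taking logarithms; all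
    constants and all powers of [e] are collected in the factor [log_const]. *)
Lemma log_estimates (R : realType) (K : nat) (C c1 kap c6 c8 c9 A1 d F s A G e sm : R) :
  let g := c1 * e `^ kap in
  let M := log_const K C c1 kap c6 c8 c9 A1 d in
  0 < C -> 0 < c1 -> 0 < c6 -> 0 < c8 -> 0 < c9 -> 0 < A1 -> 0 < d -> 0 < F -> 0 < s -> 1 <= G -> 0 < e ->
  1 <= ln e^-1 -> e <= sm ->
  F * s * (g / 2) ^+ K.+1 <= C -> sm * (g / 2) ^+ K.+1 <= C * s * F ->
  s * g ^+ 2 <= c6 * (A ^+ 2 * G ^+ 2) -> A ^+ 2 * g ^+ 2 <= c8 * (G ^+ 2 * s) ->
  A1 <= A -> A <= 4 * A1 ->
  `|ln F| <= M * ln e^-1 + 2 * ln G /\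
  (d ^+ 2 * G ^+ 2 <= c9 * s -> `|ln F + 2 * ln G| <= M * ln e^-1).
Proof.
move=> g M C0 c10 c60 c80 c90 A10 d0 fx s0 G1 e1 L1 esm D1 D2 H1 H2 hA1 hA2.
rewrite /M /log_const {M}.
pose q : R := `|ln 2 - ln c1| + `|kap|; pose K1 : R := K.+1%:R; pose kp : R := `|kap|.
set ca : R := (X in (X + _) * _); rewrite -/K1 -/kp.
set cb : R := K1 * kp + 2 * kp + 1.
have K10 : 0 <= K1 by rewrite ler0n.
have q0 : 0 <= q by rewrite addr_ge0.
have kp0 : 0 <= kp by exact: normr_ge0.
have A0 : 0 < A by exact: lt_le_trans hA1.
have G0 : 0 < G by exact: lt_le_trans G1.
have g0 : 0 < g by rewrite mulr_gt0 // powR_gt0.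
have h0 : 0 < g / 2 by rewrite divr_gt0.
have lG0 : 0 <= ln G by exact: ln_ge0.
have eL : ln e = - ln e^-1 by rewrite lnVp // opprK.
set L := ln e^-1 in L1 eL *.
have lg2 : ln g >= ln 2 - (q + kp * L).
  rewrite /g lnMp ?powR_gt0 // ln_powR eL.
  have : `|kap * L| <= kp * L by rewrite normrM (ger0_norm (_ : 0 <= L)) //; lra.
  rewrite ler_norml => /andP[t1 t2].
  move: t2 (ler_norm (ln 2 - ln c1)) (normr_ge0 kap); rewrite /q /kp; clear; lra.
have caE : ca = `|ln C| + K1 * q + `|ln c6| + `|ln c8| + 2 * `|ln 2| + 2 * q + 2 * `|ln A1| + 2 * `|ln (4 * A1)|
  + 2 * `|ln d| + `|ln c9| by [].
have cbE : cb * L = K1 * kp * L + 2 * (kp * L) + L by rewrite /cb; ring.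
have cbL : cb = K1 * kp + 2 * kp + 1 by [].
clearbody ca cb.
have K1E : K.+1%:R = K1 by [].
clearbody q kp K1 L g.
have lg : ln (g / 2) >= - (q + kp * L) by rewrite (lnMp g0) ?invr_gt0 // lnVp // lerBrDl; move: lg2; rewrite addrC.
have P0 : 0 < (g / 2) ^+ K.+1 by rewrite exprn_gt0.
have lK := ler_wpM2l K10 lg.
have E1 : ln F + ln s - K1 * (q + kp * L) <= ln C.
  have := ln_mono (mulr_gt0 (mulr_gt0 fx s0) P0) D1.
  rewrite (lnMp (mulr_gt0 fx s0) P0) (lnMp fx s0) (lnXp _ h0) K1E.
  by apply: le_trans; rewrite lerD2l -mulrN.
have sm0 : 0 < sm by exact: lt_le_trans esm.
have E2 : ln sm - K1 * (q + kp * L) <= ln C + ln s + ln F.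
  have := ln_mono (mulr_gt0 sm0 P0) D2; rewrite (lnMp sm0 P0) (lnXp _ h0) K1E (lnMp (mulr_gt0 C0 s0) fx) (lnMp C0 s0).
  by apply: le_trans; rewrite lerD2l -mulrN.
have E3 : - L <= ln sm by rewrite -eL; exact: ln_mono.
have E4 : ln s + 2 * (ln 2 - (q + kp * L)) <= ln c6 + 2 * (ln A + ln G).
  by apply: le_trans (ln_sqr_le s0 g0 c60 A0 G0 H1); rewrite lerD2l ler_pM2l.
have E5 : 2 * ln A + 2 * (ln 2 - (q + kp * L)) <= ln c8 + 2 * ln G + ln s.
  by apply: le_trans (ln_sqr_ge s0 g0 c80 A0 G0 H2); rewrite lerD2l ler_pM2l.
have E6 := ln_mono A10 hA1.
have E7 := ln_mono A0 hA2.
have [F1 [F2 F3]] := log_algebra lG0 L1 E1 E2 E3 E4 E5 E6 E7.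
have n0 := ler_norm (- ln d); rewrite normrN in n0.
have n1 := ler_norm (ln c9).
have n3 := normr_ge0 (ln A1); have n4 := normr_ge0 (ln (4 * A1)); have n5 := normr_ge0 (ln c8 : R).
have n6 := normr_ge0 (ln c6); have n7 := normr_ge0 (ln 2 : R); have n8 := normr_ge0 (ln C).
have d1 := normr_ge0 (ln d); have d2 := normr_ge0 (ln c9).
have k1 : 0 <= K1 * kp by rewrite mulr_ge0.
have L0 := le_trans ler01 L1.
have k2 : 0 <= kp * L by rewrite mulr_ge0.
have k3 : 0 <= K1 * q by rewrite mulr_ge0.
have ca0 : 0 <= ca by rewrite caE !addr_ge0 // ?mulr_ge0.
have caL : ca <= ca * L by rewrite ler_peMr.
have cE : (ca + cb) * L = ca * L + cb * L by rewrite mulrDl.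
clear D1 D2 H1 H2 lg lg2 lK P0 E3 E4 E5.
split.
  apply: (le_trans F1); rewrite cE -cbL !lerD2r; apply: le_trans caL.
  by rewrite caE -[leRHS]addrA lerDl addr_ge0 // mulr_ge0.
move=> H.
have E8 : 2 * ln d + 2 * ln G <= ln c9 + ln s.
  have H8 : d ^+ 2 * G ^+ 2 <= c9 * (1 ^+ 2 * s) by rewrite expr1n mul1r.
  by have := ln_sqr_ge s0 G0 c90 d0 ltr01 H8; rewrite ln1 mulr0 addr0.
have k4 : 0 <= K1 * kp * L by rewrite mulr_ge0.
have F3' : -2 * ln G - (`|ln C| + K1 * q + `|ln c6| + 2 * `|ln 2| + 2 * q + 2 * `|ln (4 * A1)|) - cb * L <= ln F.
  by rewrite cbL.
clear F3.
by rewrite cE; exact: (log_final F2 F3' E8 n0 n1 n6 n5 n7 q0 n3 n4 d1 d2 k2 k4 L0 caE caL cbE).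
Qed.

Lemma near2_itv (R : realType) (e : R) : 0 < e -> e < 4^-1 -> 2 - e \in `](-2), 2[.
Proof. by move=> e0 e1; rewrite in_itv /=; apply/andP; split; lra. Qed.

Lemma near2_semi (R : realType) (e : R) : 0 < e -> e < 4^-1 -> e <= semi (2 - e).
Proof.
move=> e0 e1; rewrite /semi -[leLHS](ger0_norm (ltW e0)) -sqrtr_sqr ler_sqrt; nra.
Qed.

Section EdgeArithmetic.
Context {R : realType}.
Implicit Types c X Y e d v w : R.

Lemma quarter_mul_le c X Y : 0 <= c -> 0 <= X -> X <= Y -> c / 4 * X <= c * Y.
Proof. by move=> c0 X0 XY; apply: ler_pM => //; [rewrite divr_ge0|rewrite ler_pdivrMr //; lra]. Qed.

Lemma gap_mul_ellip (a b : nat -> R) x m : a m.+2 != 0 -> b m.+2 <= b m.+3 ->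
  - gap a b x m.+2 * a m.+2 <= ellip a b x m.+1.
Proof. by move=> a0 *; rewrite /ellip /gap mulNr mulrBl divfK //; lra. Qed.

Lemma ellip_from_step c X g h1 h2 s a e : g <= c / 4 * X -> c * X <= s -> s / 2 <= h1 - h2 -> h1 < 0 ->
  0 <= c * X -> 2^-1 <= a -> - h2 * a <= e -> g <= e.
Proof. by move=> *; nra. Qed.

Lemma near_two (e : R) : 0 < e -> e < 4^-1 -> [/\ 1 <= 2 - e, 3 / 2 < 2 - e & 2 - e < 2].
Proof. by move=> ? ?; split; lra. Qed.

Lemma perturbed_start (eta d v w v' w' : R) : 0 < d -> `|v - v'| < eta -> `|(w - v) - (w' - v')| <= 2 * eta ->
  eta <= v -> d + 2 * eta <= w - v -> [/\ 0 <= v', v' <= w' & d <= w' - v'].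
Proof.
move=> d0; rewrite ltr_norml ler_norml => /andP[k1 k2] /andP[k3 k4] h1 h2; split; lra.
Qed.

Lemma perturbed_size (eta S v w v' w' : R) : `|v - v'| < eta -> `|(w - v) - (w' - v')| <= 2 * eta ->
  S = `|v| + `|w - v| -> eta <= S / 8 -> S / 2 <= `|v'| + `|w' - v'| /\ `|v'| + `|w' - v'| <= 4 * (S / 2).
Proof.
move=> e1 e2 SE eS.
have t1 := ler_normD v' (v - v'); have t2 := ler_normB v (v - v').
have t3 := ler_normD (w' - v') ((w - v) - (w' - v')); have t4 := ler_normB (w - v) ((w - v) - (w' - v')).
rewrite addrC subrK in t1; rewrite addrC subrK in t3; rewrite !subKr in t2 t4.
by move: e1 e2 SE eS t1 t2 t3 t4; clear; split; lra.
Qed.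

End EdgeArithmetic.

Section GrowthDensity.
Context {R : realType} (mu : probability (measurableTypeR R) R) (B : R).
Hypothesis B2 : (2 : R) <= B.
Hypothesis supp : mu (~` `[- B, B]%classic) = 0%E.
Variables (p : nat -> {poly R}) (a b : nat -> R).
Hypothesis orth : orthonormal_polys mu p.
Hypothesis jac : forall n, 'X * p n =
      (if n is m.+1 then a n *: p m else 0)
      + b n.+1 *: p n + a n.+1 *: p n.+1.
Hypothesis a_gt0 : forall n, (0 < n)%N -> 0 < a n.
Hypothesis cva : a n @[n --> \oo] --> (1 : R).
Hypothesis cvb : b n @[n --> \oo] --> (0 : R).
Variable f : R -> R.
Hypothesis f_density : ac_density mu f.
Hypothesis f_cont : {in `](-2), 2[, continuous f}.
Hypothesis f_gt0 : {in `](-2), 2[, forall x, 0 < f x}.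
Variable N : nat.
Hypothesis N0 : (0 < N)%N.
Hypothesis hab : edge_regular a b N.
Variables (bet c0 Cw : R).
Hypothesis bet0 : 0 < bet.
Hypothesis c00 : 0 < c0.
Hypothesis Cw0 : 0 < Cw.
Hypothesis hstep : forall n, (N <= n)%N -> c0 * n%:R `^ (- (1 + bet)) <= step a b n.
Hypothesis hW : forall n, (N <= n)%N -> 0 < defect a b n <= Cw * n%:R `^ (- bet).

Let u (x : R) (n : nat) : R := (p n).[x].

Lemma gap_defect eps n : (N <= n)%N -> gap a b (2 - eps) n = (defect a b n - eps) / a n.
Proof.
move=> h; have [a0 _ _ _ _] := hab h.
rewrite /gap /defect; field; rewrite gt_eqF // (lt_le_trans _ a0) //.
Qed.

Lemma gap_ge0 eps n : (N <= n)%N -> (0 <= gap a b (2 - eps) n) = (eps <= defect a b n).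
Proof.
move=> h; have [a0 _ _ _ _] := hab h; have an : 0 < a n by rewrite (lt_le_trans _ a0).
by rewrite gap_defect // pmulr_lge0 ?invr_gt0 // subr_ge0.
Qed.

Lemma defect_small eps : 0 < eps -> exists n0, forall n, (n0 <= n)%N -> (N <= n)%N -> defect a b n < eps.
Proof.
move=> e0; pose y := (2 * Cw / eps) `^ bet^-1.
exists (Num.truncn y).+1 => n n0 Nn.
have /andP[_ h] := hW Nn; apply: (le_lt_trans h).
have yn : y <= n%:R by apply: le_trans (ltW (truncnS_gt _)) _; rewrite ler_nat.
have b0 := bet0; have C0 := Cw0.
have q0 : 0 < 2 * Cw / eps by rewrite divr_gt0 // mulr_gt0.
have y0 : 0 < y by rewrite powR_gt0.
have : n%:R `^ (- bet) <= y `^ (- bet) by apply: powR_neg_le => //; exact: ltW.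
rewrite /y -powRrM mulrN mulVf ?gt_eqF // (powR_inv1 (ltW q0)) => h2.
apply: (@le_lt_trans _ _ (Cw * (2 * Cw / eps)^-1)); first by rewrite ler_pM2l.
rewrite (_ : Cw * (2 * Cw / eps)^-1 = eps / 2); last by field; rewrite !gt_eqF.
lra.
Qed.

(** The last index at which the recurrence for [2 - eps] is hyperbolic; it
    exists because the defect tends to 0. *)
Lemma turning_index eps : 0 < eps -> eps <= defect a b N.+2 ->
  exists m, [/\ (N.+1 < m)%N, eps <= defect a b m & defect a b m.+1 < eps].
Proof.
move=> e0 e1; have [n0 hn0] := defect_small e0.
have ex : exists n, (N.+2 <= n)%N && (defect a b n < eps).
  exists (maxn n0 N.+2); rewrite leq_maxr /=; apply: hn0; first exact: leq_maxl.
  by apply: leq_trans (leq_maxr _ _); rewrite ltnW.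
case: (ex_minnP ex) => m /andP[m1 m2] mmin.
have mN : m != N.+2 by apply/eqP => E; move: m2; rewrite E ltNge e1.
have [k mE] : exists k, m = k.+1 by case: m m1 {m2 mmin mN} => [//|k] _; exists k.
subst m; exists k.
have Nk : (N.+1 < k)%N by move: m1; rewrite leq_eqVlt eq_sym (negPf mN).
split => //; rewrite leNgt; apply/negP => h.
by have := mmin k; rewrite Nk h => /(_ isT); rewrite ltnn.
Qed.

(** The step [c0 n^(-1 - bet)] separates the gaps at consecutive indices, and
    the turning index is at most of order [eps^(-1 / bet)]. So next to the
    turning point [gap] and [ellip] are at least [c1 eps^kap] with
    [kap = (1 + bet) / bet]. *)
Lemma density_core : exists (K : nat) (C c1 kap e0 : R), [/\ 0 < C, 0 < c1, 0 < e0, e0 <= 4^-1 &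
  forall eps, 0 < eps -> eps < e0 -> exists m, [/\ (N.+1 < m)%N, eps <= defect a b m, defect a b m.+1 < eps &
    let x : R := 2 - eps in let G : R := growth a b x N m in let s : R := size2 (u x) m.+1 in
    let A : R := `|u x N| + `|u x N.+1 - u x N| in let g : R := c1 * eps `^ kap in
    [/\ g <= 1, f x * s * (g / 2) ^+ K.+1 <= C, semi x * (g / 2) ^+ K.+1 <= C * s * f x &
     [/\ s * g ^+ 2 <= 10 ^+ 6 * (A ^+ 2 * G ^+ 2), A ^+ 2 * g ^+ 2 <= 10 ^+ 8 * (G ^+ 2 * s) &
      forall sg : R, sg ^+ 2 = 1 -> 0 <= sg * u x N -> sg * u x N <= sg * u x N.+1 ->
        (u x N.+1 - u x N) ^+ 2 * G ^+ 2 <= 50 * s]]]].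
Proof.
have b0 := bet0; have c0' := c00; have C0 := Cw0.
have [K [C [C0' HC]]] := elliptic_density B2 supp orth jac a_gt0 cva cvb hab f_density f_cont f_gt0.
pose kap := (1 + bet) / bet.
pose c2 : R := c0 / 4 * 2 `^ (- (1 + bet)) * Cw `^ (- kap).
have c20 : 0 < c2 by rewrite !mulr_gt0 ?powR_gt0.
pose c1 := Num.min 1 c2.
have c10 : 0 < c1 by rewrite lt_min ltr01.
have c11 : c1 <= 1 by rewrite ge_min lexx.
have c12 : c1 <= c2 by rewrite ge_min lexx orbT.
have /andP[W0 _] := hW (leqW (leqnSn N)).
exists K, C, c1, kap, (Num.min 4^-1 (defect a b N.+2)); split => //.
- by rewrite lt_min W0 andbT invr_gt0.
- by rewrite ge_min lexx.
move=> eps e0; rewrite lt_min => /andP[e4 eW].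
have [m [Nm m1 m2]] := turning_index e0 (ltW eW).
exists m; split => //.
move=> x G s A g.
have Nm0 : (N <= m)%N by exact: ltnW (ltnW Nm).
have mE : m.-1.+1 = m by rewrite prednK //; exact: leq_ltn_trans (ltnW Nm).
have Nm1 : (N <= m.-1)%N by rewrite -ltnS mE ltnW.
have [x1 x32 x22] := near_two e0 e4; have x2 := ltW x22.
have kap0 : 0 < kap by rewrite divr_gt0 // addr_gt0.
have m0 : 0 < m%:R :> R by rewrite ltr0n (leq_ltn_trans _ (ltnW Nm)).
have g0 : 0 < g by rewrite mulr_gt0 // powR_gt0.
have ek : eps `^ kap <= 1.
  apply: powR_le1 (ltW e0) _ (ltW kap0); apply: le_trans (ltW e4) _.
  by rewrite invf_le1 // ler1n.
have g1 : g <= 1.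
  by rewrite /g -[1]mulr1; apply: ler_pM => //; [exact: ltW|exact: powR_ge0].
have mpow : Cw `^ (- kap) * eps `^ kap <= m%:R `^ (- (1 + bet)).
  have /andP[_ h] := hW Nm0.
  have h2 : eps / Cw <= m%:R `^ (- bet) by rewrite ler_pdivrMr // mulrC; exact: le_trans h.
  have : (eps / Cw) `^ kap <= (m%:R `^ (- bet)) `^ kap.
    apply: ge0_ler_powR; rewrite ?nnegrE //; [exact: ltW|by apply: divr_ge0; exact: ltW].
  rewrite -powRrM (_ : - bet * kap = - (1 + bet)); last by rewrite /kap; field; rewrite gt_eqF.
  have Ci : 0 <= Cw^-1 by rewrite invr_ge0 ltW.
  by rewrite powRM // ?(ltW e0) // -(powR_inv1 (ltW C0)) -powRrM mulN1r mulrC.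
have gmain : g <= c0 / 4 * (2 * m%:R) `^ (- (1 + bet)).
  apply: (@le_trans _ _ (c2 * eps `^ kap)); first by apply: ler_wpM2r => //; exact: powR_ge0.
  rewrite /c2 powRM // -!mulrA ler_pM2l // ler_pM2l ?invr_gt0 // ler_pM2l ?powR_gt0 //.
have t1 : 0 <= 1 + bet by rewrite addr_ge0 // ltW.
have X0 : 0 <= (2 * m%:R) `^ (- (1 + bet)) by exact: powR_ge0.
have gm1 : g <= gap a b x m.-1.
  have h0 : 0 <= gap a b x m by rewrite gap_ge0.
  have hd := gap_decr hab x1 Nm1; rewrite mE in hd.
  have h1 := gap_drop hab x1 Nm1 (le_trans h0 hd); rewrite mE in h1.
  have h2 := hstep Nm1.
  have h3 : c0 * m%:R `^ (- (1 + bet)) <= c0 * m.-1%:R `^ (- (1 + bet)).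
    rewrite ler_pM2l //; apply: powR_neg_le => //.
      by rewrite ltr0n (leq_trans N0 Nm1).
    by rewrite ler_nat leq_pred.
  have h4 : c0 / 4 * (2 * m%:R) `^ (- (1 + bet)) <= c0 * m%:R `^ (- (1 + bet)).
    apply: quarter_mul_le => //; first exact: ltW.
    by apply: powR_neg_le => //; rewrite ler_peMl ?ler1n // ltW.
  apply: (le_trans gmain); apply: (le_trans h4); apply: (le_trans h3); apply: (le_trans h2).
  by apply: (le_trans h1); rewrite gerBl.
have gel : g <= ellip a b x m.+1.
  have Nm2 : (N <= m.+1)%N by exact: leqW.
  have Nm3 : (N <= m.+2)%N by exact: leqW.
  have [a2 a3 _ _ [_ bb]] := hab Nm3.
  have hneg : gap a b x m.+1 < 0 by rewrite ltNge gap_ge0 // -ltNge.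
  have h1 := gap_drop_neg hab x1 Nm2.
  have h2 := hstep Nm2.
  have h3 : c0 * (2 * m%:R) `^ (- (1 + bet)) <= c0 * m.+1%:R `^ (- (1 + bet)).
    rewrite ler_pM2l //; apply: powR_neg_le => //.
    rewrite -[m.+1]addn1 natrD mulr_natl mulr2n lerD2l ler1n -(ltr0n R) //.
  have an0 : a m.+2 != 0 by rewrite gt_eqF // (lt_le_trans _ a2).
  apply: ellip_from_step gmain (le_trans h3 h2) h1 hneg _ a2 (gap_mul_ellip x an0 bb).
  by rewrite mulr_ge0 // ltW.
have [D1 D2] := HC m.+1 x g (leqW Nm0) x32 x22 g0 g1 gel.
have gm : 0 <= gap a b x m by rewrite gap_ge0.
have su : solves a b x N (u x) by move=> n _; exact: poly_rec.
have [H1 H2 _] := hyperbolic_bounds hab x1 x2 Nm gm g0 g1 gm1 su.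
split => //; split => // sg sg1 v0 v1.
have sv : solves a b x N (fun n => sg * u x n).
  by move=> n h; rewrite mulrCA su //; ring.
have [_ _ H3] := hyperbolic_bounds hab x1 x2 Nm gm g0 g1 gm1 sv.
have := H3 v0 v1; rewrite /size2 !exprMn sg1 !mul1r -mulrBr exprMn sg1 mul1r.
by [].
Qed.

(** Up to sign, the values at the edge are positive and increasing at [N]; by
    continuity the same holds at [2 - eps] for small [eps]. *)
Definition growing_start := exists sg : R, [/\ sg ^+ 2 = 1, 0 < sg * u 2 N & sg * u 2 N < sg * u 2 N.+1].

(** Two consecutive polynomials have no common zero, so the data at [N] do not
    both vanish at 2; all bounds then extend to a neighbourhood by continuity. *)
Lemma near_edge : exists (A1 d r : R), [/\ 0 < A1, 0 < d, 0 < r &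
  forall x : R, `|x - 2| < r ->
   let A := `|u x N| + `|u x N.+1 - u x N| in
   A1 <= A /\ A <= 4 * A1 /\
   (growing_start -> exists sg : R, [/\ sg ^+ 2 = 1, 0 <= sg * u x N, sg * u x N <= sg * u x N.+1
     & d ^+ 2 <= (u x N.+1 - u x N) ^+ 2])].
Proof.
pose A2 := `|u 2 N| + `|u 2 N.+1 - u 2 N|.
have A20 : 0 < A2.
  rewrite lt_def addr_ge0 // andbT; apply/eqP => /eqP.
  rewrite paddr_eq0 // !normr_eq0 subr_eq0 => /andP[/eqP h1 /eqP h2].
  have := consecutive_neq0 orth jac a_gt0 2 N.
  by rewrite -/(u 2 N) -/(u 2 N.+1) h2 h1 expr0n /= addr0 ltxx.
have [eta [d [eta0 d0 etaA etag]]] : exists eta d : R, [/\ 0 < eta, 0 < d, eta <= A2 / 8 &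
  growing_start -> exists sg : R, [/\ sg ^+ 2 = 1, eta <= sg * u 2 N & d + 2 * eta <= sg * u 2 N.+1 - sg * u 2 N]].
  have [[sg [s1 s2 s3]]|ng] := pselect growing_start; last first.
    by exists (A2 / 8), 1; split => //; rewrite divr_gt0.
  pose D := sg * u 2 N.+1 - sg * u 2 N.
  have D0 : 0 < D by rewrite subr_gt0.
  exists (Num.min (A2 / 8) (Num.min (sg * u 2 N) (D / 4))), (D / 2).
  split; [by rewrite !lt_min divr_gt0 //= s2 divr_gt0|by rewrite divr_gt0|by rewrite ge_min lexx|].
  move=> _; exists sg; split => //; first by rewrite !ge_min lexx orbT.
  have : Num.min (A2 / 8) (Num.min (sg * u 2 N) (D / 4)) <= D / 4 by rewrite !ge_min lexx !orbT.
  rewrite -/D; lra.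
have cont n : exists2 r : R, 0 < r & forall y, `|y - 2| < r -> `|u 2 n - u y n| < eta.
  have := @continuous_horner R (p n) 2; move/cvgrPdist_lt => /(_ _ eta0) /nbhs_ballP [r /= r0 hr].
  by exists r => // y hy; apply: hr; rewrite /ball /= distrC.
have [r1 r10 hr1] := cont N; have [r2 r20 hr2] := cont N.+1.
exists (A2 / 2), d, (Num.min r1 r2); split => //; [by rewrite divr_gt0|by rewrite lt_min r10|].
move=> x; rewrite lt_min => /andP[/hr1 h1 /hr2 h2] A.
have h3 : `|(u 2 N.+1 - u 2 N) - (u x N.+1 - u x N)| <= 2 * eta.
  have := ler_normB (u 2 N.+1 - u x N.+1) (u 2 N - u x N).
  rewrite (_ : u 2 N.+1 - u x N.+1 - (u 2 N - u x N) = (u 2 N.+1 - u 2 N) - (u x N.+1 - u x N)); last by ring.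
  by move=> h; apply: (le_trans h); rewrite mulr_natl mulr2n; apply: lerD; exact: ltW.
have [E1 E2] := perturbed_size h1 h3 erefl etaA.
split; first exact: E1.
split; first exact: E2.
move=> /etag [sg [s1 s2 s3]]; exists sg.
have sn : `|sg| = 1.
  by move/eqP: s1; rewrite sqrf_eq1 => /orP[] /eqP ->; rewrite ?normrN normr1.
have k1 : `|sg * u 2 N - sg * u x N| < eta by rewrite -mulrBr normrM sn mul1r.
have k2 : `|(sg * u 2 N.+1 - sg * u 2 N) - (sg * u x N.+1 - sg * u x N)| <= 2 * eta.
  by rewrite -!mulrBr normrM sn mul1r.
have [q1 q2 q3] := perturbed_start d0 k1 k2 s2 s3.
split => //.
have -> : (u x N.+1 - u x N) ^+ 2 = (sg * u x N.+1 - sg * u x N) ^+ 2 by rewrite -mulrBr exprMn s1 mul1r.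
by apply: sqr_mono q3; exact: ltW.
Qed.

Lemma density_logs : exists (M e0 : R), [/\ 0 <= M, 0 < e0, e0 <= 4^-1 &
  forall eps, 0 < eps -> eps < e0 -> exists m, [/\ (N.+1 < m)%N, eps <= defect a b m, defect a b m.+1 < eps &
   let lG : R := ln (growth a b (2 - eps) N m) in
   `|ln (f (2 - eps))| <= M * ln eps^-1 + 2 * lG /\
   (growing_start -> `|ln (f (2 - eps)) + 2 * lG| <= M * ln eps^-1)]].
Proof.
have [K [C [c1 [kap [e0 [C0 c10 e00 e04 core]]]]]] := density_core.
have [A1 [d [r [A10 d0 r0 edge]]]] := near_edge.
have b0 := bet0.
exists (log_const K C c1 kap (10 ^+ 6) (10 ^+ 8) 50 A1 d), (Num.min e0 (Num.min r (expR (-1)))); split.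
- exact: log_const_ge0.
- by rewrite !lt_min e00 r0 expR_gt0.
- by rewrite ge_min e04.
move=> eps e1; rewrite !lt_min => /andP[e2 /andP[e3 e4]].
have [m [Nm m1 m2 [g1 D1 D2 [H1 H2 H3]]]] := core eps e1 e2.
exists m; split => //.
have e14 : eps < 4^-1 by exact: lt_le_trans e04.
set x := 2 - eps in D1 D2 H1 H2 H3 *.
have xr : `|x - 2| < r by rewrite /x addrAC subrr add0r normrN gtr0_norm.
have [hA1 [hA2 hg]] := edge x xr.
have L1 : 1 <= ln eps^-1.
  by rewrite lnVp // lerNr -(expRK (-1)); apply: ln_mono => //; exact: ltW.
have G1 : 1 <= growth a b x N m by exact: growth_ge1.
have s0 : 0 < size2 (u x) m.+1 by exact: (consecutive_neq0 orth jac a_gt0).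
have xI : x \in `](-2), 2[.
  exact: near2_itv.
have fx := f_gt0 xI.
have es : eps <= semi x.
  exact: near2_semi.
have [Q1 Q2] := log_estimates C0 c10 (exprn_gt0 6 (ltr0Sn R 9)) (exprn_gt0 8 (ltr0Sn R 9)) (ltr0Sn R 49) A10 d0 fx s0 G1 e1 L1 es D1 D2 H1 H2 hA1 hA2.
split; first exact: Q1.
move=> /hg [sg [s1 s2 s3 s4]]; apply: Q2.
apply: le_trans (H3 sg s1 s2 s3); apply: ler_wpM2r => //; exact: sqr_ge0.
Qed.

End GrowthDensity.

(** * Expansions in powers of one variable, uniform in another *)

Section TaylorPower.
Context {R : realType}.
Implicit Types (z p x y : R).

Lemma powR_bound p y : 2^-1 <= y -> y <= 2 -> y `^ p <= 2 `^ `|p|.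
Proof.
move=> y1 y2; have y0 : 0 < y by apply: lt_le_trans y1; rewrite invr_gt0.
have [p0|p0] := leP 0 p.
  rewrite ger0_norm //; apply: ge0_ler_powR; rewrite ?nnegrE ?(ltW y0) //.
rewrite ltr0_norm //.
have -> : y `^ p = y^-1 `^ (- p) by rewrite -(powR_inv1 (ltW y0)) -powRrM mulrNN mul1r.
apply: ge0_ler_powR; rewrite ?nnegrE ?invr_ge0 ?(ltW y0) ?oppr_ge0 ?(ltW p0) //.
by rewrite -[leRHS]invrK lef_pV2 // posrE ?invr_gt0.
Qed.

Lemma poly_primitive (P : {poly R}) : exists2 A : {poly R}, A^`() = P & A.[0] = 1.
Proof.
exists (1 + \poly_(i < (size P).+1) (if i is j.+1 then P`_j / j.+1%:R else 0)).
  rewrite derivD derivC add0r; apply/polyP => i; rewrite coef_deriv coef_poly ltnS.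
  case: ltnP => h; last by rewrite mul0rn nth_default.
  by rewrite -[LHS]mulr_natr divfK // pnatr_eq0.
rewrite hornerD hornerC horner_coef0 coef_poly /= addr0 //.
Qed.

(** Induction on the order: the derivative of [(1 + z) ^ p] is [p (1 + z) ^ (p - 1)],
    so an approximation of order [K] for the exponent [p - 1] is integrated
    into one of order [K + 1] for [p]. *)
Lemma taylor_power K p : exists (P : {poly R}) (C : R), [/\ P.[0] = 1, 0 <= C &
  forall z, `|z| <= 2^-1 -> `|(1 + z) `^ p - P.[z]| <= C * `|z| ^+ K].
Proof.
elim: K p => [|K IH] p.
  exists 1, (2 `^ `|p| + 1); split; [by rewrite hornerC|by rewrite addr_ge0 ?powR_ge0|].
  move=> z; rewrite ler_norml => /andP[z1 z2]; rewrite hornerC expr0 mulr1.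
  apply: le_trans (ler_normB _ _) _; rewrite normr1 lerD2r ger0_norm ?powR_ge0 //.
  by apply: powR_bound; lra.
have [P [C [P0 C0 hP]]] := IH (p - 1).
have [A dA A0] := poly_primitive (p *: P).
exists A, (`|p| * C); split => //; first by rewrite mulr_ge0.
move=> z hz; pose F x : R := (1 + x) `^ p - A.[x].
have dF x : `|x| <= 2^-1 -> is_derive x 1 F (p * ((1 + x) `^ (p - 1) - P.[x])).
  move=> /[dup]hx; rewrite ler_norml => /andP[x1 x2].
  have x0 : 0 < 1 + x by lra.
  have d1 : is_derive x 1 (fun y : R => 1 + y) 1.
    have H := @is_deriveD _ _ _ (cst (1 : R)) id x 1 0 1 (is_derive_cst _ _ _) (is_derive_id _ _).
    by apply: (is_derive_eq H); rewrite add0r.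
  have d2 := is_derive1_powR p x0.
  have d3 := @is_derive1_comp _ (fun y : R => y `^ p) (fun y : R => 1 + y) _ _ _ d2 d1.
  have d4 := is_derive_poly A x; rewrite dA in d4.
  have H := @is_deriveB _ _ _ _ _ x 1 _ _ d3 d4.
  by apply: (is_derive_eq H); rewrite mulr1 hornerZ; ring.
have F0 : F 0 = 0 by rewrite /F addr0 A0 powR1 subrr.
have main a b : a < b -> (forall x, a <= x <= b -> `|x| <= `|z|) -> `|F b - F a| <= `|p| * C * `|z| ^+ K * (b - a).
  move=> ab hab.
  have [c cab E] : exists2 c, c \in `]a, b[ & F b - F a = (p * ((1 + c) `^ (p - 1) - P.[c])) * (b - a).
    apply: (@MVT _ F (fun c => p * ((1 + c) `^ (p - 1) - P.[c]))) => //.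
      move=> x; rewrite in_itv /= => /andP[x1 x2]; apply: dF.
      by apply: le_trans (hab x _) hz; rewrite !ltW.
    apply: continuous_in_subspaceT => x; rewrite inE /= in_itv /= => xab.
    apply: differentiable_continuous; apply/derivable1_diffP.
    have H := dF x (le_trans (hab x xab) hz); exact: ex_derive.
  move: cab; rewrite in_itv /= => /andP[c1 c2].
  have hc : `|c| <= `|z| by apply: hab; rewrite !ltW.
  rewrite E !normrM (gtr0_norm (_ : 0 < b - a)) ?subr_gt0 // ler_wpM2r ?subr_ge0 ?(ltW ab) //.
  rewrite -mulrA ler_wpM2l // (le_trans (hP c (le_trans hc hz))) // ler_wpM2l //.
  by apply: lerXn2r; rewrite ?nnegrE.
have [z0|z0|->] := ltgtP z 0.
- have := main z 0 z0; rewrite F0 sub0r normrN sub0r exprSr mulrA (ltr0_norm z0).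
  by apply => x /andP[x1 x2]; rewrite ler0_norm // lerN2.
- have := main 0 z z0; rewrite F0 !subr0 exprSr mulrA (gtr0_norm z0).
  by apply => x /andP[x1 x2]; rewrite ger0_norm.
- by rewrite addr0 powR1 A0 subrr normr0 expr0n mulr0.
Qed.

End TaylorPower.

Section Expansions.
Context {R : realType}.
Implicit Types (h g : R -> R -> R) (r t d M w c : R) (s : seq (R * nat * R)).

(** A finite sum of monomials [c r^m t^w], with natural exponents of [r] and
    real exponents of [t]. The variable [r] ranges over the unit interval and
    [t] tends to 0. *)
Definition expansion s r t : R := \sum_(x <- s) x.1.1 * r ^+ x.1.2 * t `^ x.2.

Definition edge_bigO h M := exists C t0 : R, [/\ 0 <= C, 0 < t0, t0 <= 1 &
  forall r t, 0 <= r -> r <= 1 -> 0 < t -> t < t0 -> `|h r t| <= C * t `^ M].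

Definition expands d M h := exists2 s, all (fun x => d <= x.2) s &
  edge_bigO (fun r t => h r t - expansion s r t) M.

Lemma powR_small t w d : 0 < t -> t <= 1 -> d <= w -> t `^ w <= t `^ d.
Proof. by move=> t0 t1 dw; apply: ger_powR => //; rewrite t0. Qed.

Lemma edge_bigO_le h M M' : M' <= M -> edge_bigO h M -> edge_bigO h M'.
Proof.
move=> MM [C [t0 [C0 t00 t01 H]]]; exists C, t0; split => // r t r0 r1 t0' tt.
by apply: le_trans (H r t r0 r1 t0' tt) _; rewrite ler_wpM2l // powR_small //; lra.
Qed.

Lemma edge_bigOD h g M : edge_bigO h M -> edge_bigO g M -> edge_bigO (fun r t => h r t + g r t) M.
Proof.
move=> [C [t0 [C0 t00 t01 H]]] [C' [t0' [C0' t00' t01' H']]].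
exists (C + C'), (Num.min t0 t0'); split; rewrite ?addr_ge0 ?lt_min ?t00 ?ge_min ?t01 //.
move=> r t r0 r1 tp; rewrite lt_min => /andP[h1 h2].
by apply: le_trans (ler_normD _ _) _; rewrite mulrDl lerD // ?H ?H'.
Qed.

Lemma edge_bigOM h g M M' : edge_bigO h M -> edge_bigO g M' -> edge_bigO (fun r t => h r t * g r t) (M + M').
Proof.
move=> [C [t0 [C0 t00 t01 H]]] [C' [t0' [C0' t00' t01' H']]].
exists (C * C'), (Num.min t0 t0'); split; rewrite ?mulr_ge0 ?lt_min ?t00 ?ge_min ?t01 //.
move=> r t r0 r1 tp; rewrite lt_min => /andP[h1 h2].
rewrite normrM powRD; last by apply/implyP => _; rewrite gt_eqF.
by rewrite mulrACA ler_pM // ?H ?H'.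
Qed.

Lemma edge_bigO_ext h g M : (forall r t, 0 < t -> h r t = g r t) -> edge_bigO h M -> edge_bigO g M.
Proof.
move=> hg [C [t0 [C0 t00 t01 H]]]; exists C, t0; split => // r t r0 r1 tp tt.
by rewrite -hg // H.
Qed.

Lemma edge_bigO_monomial c m w : edge_bigO (fun r t => c * r ^+ m * t `^ w) w.
Proof.
exists `|c|, 1; split => // r t r0 r1 t0 t1.
rewrite !normrM (ger0_norm (powR_ge0 _ _)) ler_wpM2r ?powR_ge0 //.
by rewrite (ger0_norm (exprn_ge0 _ r0)) ler_piMr // exprn_ile1.
Qed.

Lemma expansion_bigO d s : all (fun x => d <= x.2) s -> edge_bigO (expansion s) d.
Proof.
elim: s => [|x s IH] /= => [_|/andP[dx /IH H]].
  by exists 0, 1; split => // r t _ _ _ _; rewrite /expansion big_nil normr0 mul0r.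
apply: (@edge_bigO_ext (fun r t => x.1.1 * r ^+ x.1.2 * t `^ x.2 + expansion s r t)).
  by move=> r t _; rewrite /expansion big_cons.
by apply: edge_bigOD => //; apply: edge_bigO_le dx (edge_bigO_monomial _ _ _).
Qed.

Lemma expands_bigO d M h : d <= M -> expands d M h -> edge_bigO h d.
Proof.
move=> dM [s sd H].
apply: (@edge_bigO_ext (fun r t => (h r t - expansion s r t) + expansion s r t)).
  by move=> r t _; rewrite subrK.
by apply: edge_bigOD; [exact: edge_bigO_le dM H|exact: expansion_bigO].
Qed.

Lemma bigO_expands d M h : edge_bigO h M -> expands d M h.
Proof.
move=> H; exists [::] => //; apply: edge_bigO_ext H => r t _.
by rewrite /expansion big_nil subr0.
Qed.

Lemma expands_ext d M h g : (forall r t, 0 < t -> h r t = g r t) -> expands d M h -> expands d M g.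
Proof.
by move=> hg [s sd H]; exists s => //; apply: edge_bigO_ext H => r t t0; rewrite hg.
Qed.

Lemma expands_le d M d' M' h : d' <= d -> M' <= M -> expands d M h -> expands d' M' h.
Proof.
move=> dd MM [s sd H]; exists s; last exact: edge_bigO_le H.
by apply: sub_all sd => x; apply: le_trans.
Qed.

Lemma expandsD d M h g : expands d M h -> expands d M g -> expands d M (fun r t => h r t + g r t).
Proof.
move=> [s sd H] [s' sd' H']; exists (s ++ s'); first by rewrite all_cat sd sd'.
apply: edge_bigO_ext (edge_bigOD H H') => r t _.
by rewrite /expansion big_cat /=; ring.
Qed.

Lemma expands_cst M c : expands 0 M (fun _ _ => c).
Proof.
exists [:: (c, 0%N, 0)]; first by rewrite /= lexx.
exists 0, 1; split => // r t _ _ _ _.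
by rewrite /expansion big_seq1 /= expr0 powRr0 !mulr1 subrr normr0 mul0r.
Qed.

Lemma expandsM d d' M h g : 0 <= d -> d <= M -> 0 <= d' -> d' <= M ->
  expands d M h -> expands d' M g -> expands (d + d') M (fun r t => h r t * g r t).
Proof.
move=> d0 dM d0' dM' Eh Eg; have bg := expands_bigO dM' Eg.
case: Eh => s sd H; case: Eg => s' sd' H'.
exists [seq ((x.1.1 * y.1.1, (x.1.2 + y.1.2)%N), x.2 + y.2) | x <- s, y <- s'].
  apply/allP => z /allpairsP[[x y] /= [xs ys ->]] /=.
  by apply: lerD; [exact: (allP sd)|exact: (allP sd')].
have bs := expansion_bigO sd.
have H1 : edge_bigO (fun r t => (h r t - expansion s r t) * g r t) M.
  by apply: edge_bigO_le (edge_bigOM H bg); rewrite lerDl.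
have H2 : edge_bigO (fun r t => expansion s r t * (g r t - expansion s' r t)) M.
  by apply: edge_bigO_le (edge_bigOM bs H'); rewrite lerDr.
apply: edge_bigO_ext (edge_bigOD H1 H2) => r t t0.
rewrite [in RHS]/expansion big_allpairs_dep /=.
have -> : \sum_(i <- s) \sum_(j <- s') i.1.1 * j.1.1 * r ^+ (i.1.2 + j.1.2) * t `^ (i.2 + j.2) = expansion s r t * expansion s' r t.
  rewrite /expansion big_distrl /=; apply: eq_bigr => x _; rewrite big_distrr /=.
  apply: eq_bigr => y _; rewrite exprD powRD; last by apply/implyP => _; rewrite gt_eqF.
  ring.
ring.
Qed.

Lemma expands_monomial c m w d M h : expands d M h ->
  expands (w + d) (w + M) (fun r t => c * r ^+ m * t `^ w * h r t).
Proof.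
case=> s sd H.
exists [seq ((c * x.1.1, (m + x.1.2)%N), w + x.2) | x <- s].
  by rewrite all_map; apply: sub_all sd => x /=; rewrite lerD2l.
apply: edge_bigO_ext (edge_bigOM (edge_bigO_monomial c m w) H) => r t t0.
rewrite mulrBr; congr (_ - _); rewrite /expansion big_distrr big_map; apply: eq_bigr => x _ /=.
by rewrite exprD powRD; [ring|apply/implyP => _; rewrite gt_eqF].
Qed.

Lemma expands_poly (P : {poly R}) d M h : 0 <= d -> d <= M -> expands d M h ->
  expands 0 M (fun r t => P.[h r t]).
Proof.
move=> d0 dM H; have M0 := le_trans d0 dM.
elim/poly_ind: P => [|P c IH].
  by apply: expands_ext (expands_cst M 0) => r t _; rewrite horner0.
apply: (@expands_ext _ _ (fun r t => P.[h r t] * h r t + c)).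
  by move=> r t _; rewrite hornerMXaddC.
apply: expandsD (expands_cst _ _); apply: expands_le (expandsM (lexx 0) M0 d0 dM IH H) => //.
by rewrite add0r.
Qed.

(** Only finitely many terms of the Taylor series of the power matter, as [h] is
    [O(t^d)] with [d] positive. *)
Lemma expands_pow (p : R) d M h : 0 < d -> d <= M -> expands d M h ->
  expands d M (fun r t => (1 + h r t) `^ p - 1).
Proof.
move=> d0 dM H; have M0 : 0 <= M by apply: le_trans dM; exact: ltW.
pose K := (Num.truncn (M / d)).+1.
have KM : M <= d * K%:R by rewrite mulrC -ler_pdivrMr // ltW // truncnS_gt.
have [P [C [P0 C0 hP]]] := taylor_power K p.
have [Q PE] : exists Q : {poly R}, P = Q * 'X + 1.
  elim/poly_ind: P P0 {hP} => [|Q c _]; first by rewrite horner0 => /esym/eqP; rewrite oner_eq0.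
  by rewrite hornerMXaddC mulr0 add0r => ->; exists Q.
have E1 : expands d M (fun r t => Q.[h r t] * h r t).
  by have := expandsM (lexx 0) M0 (ltW d0) dM (expands_poly Q (ltW d0) dM H) H; rewrite add0r.
apply: (@expands_ext _ _ (fun r t => Q.[h r t] * h r t + ((1 + h r t) `^ p - P.[h r t]))).
  by move=> r t _; rewrite PE hornerMXaddC; ring.
apply: expandsD => //; apply: bigO_expands.
have [C1 [t0 [C10 t00 t01 hb]]] := expands_bigO dM H.
pose t1 := Num.min t0 ((2 * (C1 + 1))^-1 `^ d^-1).
have C2 : 0 < 2 * (C1 + 1) by rewrite mulr_gt0 // ltr_wpDl.
exists (C * C1 ^+ K), t1; split.
- by rewrite mulr_ge0 // exprn_ge0.
- by rewrite lt_min t00 powR_gt0 // invr_gt0.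
- by rewrite ge_min t01.
move=> r t r0 r1 tp; rewrite lt_min => /andP[tt0 tt1].
have b1 := hb r t r0 r1 tp tt0.
have td : t `^ d <= (2 * (C1 + 1))^-1.
  apply: (@le_trans _ _ (((2 * (C1 + 1))^-1 `^ d^-1) `^ d)).
    by apply: ge0_ler_powR; rewrite ?nnegrE ?powR_ge0 ?(ltW d0) ?(ltW tp) ?(ltW tt1).
  by rewrite -powRrM mulVf ?gt_eqF // powRr1 // invr_ge0 ltW.
have b2 : `|h r t| <= 2^-1.
  apply: le_trans b1 _; apply: le_trans (ler_wpM2l C10 td) _.
  rewrite invfM mulrCA ler_piMr ?invr_ge0 // ler_pdivrMr ?ltr_wpDl // mul1r lerDl //.
apply: le_trans (hP _ b2) _; rewrite -mulrA ler_wpM2l //.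
apply: (@le_trans _ _ ((C1 * t `^ d) ^+ K)); first by apply: lerXn2r; rewrite ?nnegrE ?mulr_ge0 ?powR_ge0.
rewrite exprMn ler_wpM2l ?exprn_ge0 // -powR_mulrn ?powR_ge0 // -powRrM powR_small //; lra.
Qed.

Lemma expands_sum (I : Type) (l : seq I) (F : I -> R -> R -> R) d M :
  (forall i, expands d M (F i)) -> expands d M (fun r t => \sum_(i <- l) F i r t).
Proof.
move=> HF; elim: l => [|i l IH].
  by apply: (@expands_ext _ _ (fun r t => 0)); [move=> r t _; rewrite big_nil|exists [::] => //; exists 0, 1; split => // r t *; rewrite /expansion big_nil subrr normr0 mul0r].
apply: (@expands_ext _ _ (fun r t => F i r t + \sum_(j <- l) F j r t)); last exact: expandsD.
by move=> r t _; rewrite big_cons.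
Qed.

(** Bootstrapping: an expansion of [z] with error [t ^ (k d)], inserted in the
    right-hand side of the equation, gives one with error [t ^ ((k + 1) d)]. *)
Lemma expands_fixpoint (z : R -> R -> R) (l : seq (R * nat * R * R)) M (zlo zhi t0 : R) :
  0 < M -> 0 < zlo -> 0 < t0 -> (forall x, x \in l -> 0 < x.1.2) ->
  (forall r t, 0 <= r -> r <= 1 -> 0 < t -> t < t0 -> zlo <= z r t <= zhi) ->
  edge_bigO (fun r t => z r t - 1 - \sum_(x <- l) x.1.1.1 * r ^+ x.1.1.2 * t `^ x.1.2 * z r t `^ x.2) M ->
  forall p, exists d, [/\ 0 < d, d <= M & expands d M (fun r t => z r t `^ p - 1)].
Proof.
move=> M0 zlo0 t00 l0 zb Z.
have [w [w0 wM wl]] : exists w : R, [/\ 0 < w, w <= M & forall x, x \in l -> w <= x.1.2].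
  elim: l l0 {Z} => [|x l IH] l0; first by exists M.
  have [|w [w0 wM wl]] := IH; first by move=> y yl; apply: l0; rewrite in_cons yl orbT.
  exists (Num.min w x.1.2); split; first by rewrite lt_min w0 l0 // mem_head.
    by rewrite ge_min wM.
  by move=> y; rewrite in_cons => /orP[/eqP ->|/wl h]; rewrite ge_min ?lexx ?orbT // h.
pose L := (Num.truncn (M / w)).+1; pose d := M / L%:R.
have d0 : 0 < d by rewrite divr_gt0.
have dw : d <= w by rewrite /d ler_pdivrMr // mulrC -ler_pdivrMr // ltW // truncnS_gt.
have LM : L%:R * d = M by rewrite mulrC divfK // pnatr_eq0.
have zq q : edge_bigO (fun r t => z r t `^ q) 0.
  exists (zlo `^ q + zhi `^ q), (Num.min 1 t0); split; rewrite ?addr_ge0 ?powR_ge0 ?lt_min ?ltr01 ?ge_min ?lexx //.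
  move=> r t r0 r1 tp; rewrite lt_min => /andP[_ tt].
  have /andP[z1 z2] := zb r t r0 r1 tp tt.
  have z0 : 0 < z r t by exact: lt_le_trans z1.
  have h0 : 0 < zhi by exact: lt_le_trans z2.
  rewrite powRr0 mulr1 ger0_norm ?powR_ge0 //.
  have [q0|q0] := leP 0 q.
    by apply: (@le_trans _ _ (zhi `^ q)); rewrite ?lerDr ?powR_ge0 //; apply: ge0_ler_powR; rewrite ?nnegrE ?(ltW z0) ?(ltW h0).
  apply: (@le_trans _ _ (zlo `^ q)); rewrite ?lerDl ?powR_ge0 // -[q]opprK powR_neg_le //.
  by rewrite oppr_ge0 ltW.
have step k (E : forall q, expands 0 (k%:R * d) (fun r t => z r t `^ q)) : (k < L)%N -> expands d (k.+1%:R * d) (fun r t => z r t - 1).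
  move=> kL.
  apply: (@expands_ext _ _ (fun r t => \sum_(x <- l) (if x \in l then x.1.1.1 * r ^+ x.1.1.2 * t `^ x.1.2 * z r t `^ x.2 else 0)
     + (z r t - 1 - \sum_(x <- l) x.1.1.1 * r ^+ x.1.1.2 * t `^ x.1.2 * z r t `^ x.2))).
    move=> r t _; rewrite addrC (_ : \sum_(x <- l) (if _ then _ else _) = \sum_(x <- l) x.1.1.1 * r ^+ x.1.1.2 * t `^ x.1.2 * z r t `^ x.2) ?subrK //.
    by apply: eq_big_seq => x ->.
  apply: expandsD; last first.
    by apply: bigO_expands; apply: edge_bigO_le Z; rewrite -LM ler_pM2r // ler_nat.
  apply: expands_sum => x; have [xl|_] := boolP (x \in l); last first.
    exists [::] => //; exists 0, 1; split => // r t *; by rewrite /expansion big_nil subrr normr0 mul0r.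
  apply: expands_le (expands_monomial _ _ _ (E x.2)); rewrite ?addr0 ?(le_trans dw (wl _ xl)) //.
  by rewrite -[k.+1]add1n natrD mulrDl mul1r lerD2r (le_trans dw (wl _ xl)).
have main k : (k < L)%N -> expands d (k.+1%:R * d) (fun r t => z r t - 1).
  elim: k => [|k IH] kL.
    by apply: step => // q; apply: bigO_expands; rewrite mul0r.
  apply: step => // q; have {}IH := IH (ltnW kL).
  have dk : d <= k.+1%:R * d by rewrite ler_peMl ?ler1n // ltW.
  have H := expands_pow q d0 dk IH.
  have dk0 : 0 <= k.+1%:R * d by rewrite mulr_ge0 // ltW.
  apply: expands_ext (expandsD (expands_cst _ 1) (expands_le (ltW d0) (lexx _) H)) => r t _.
  by rewrite addrC subrK [1 + _]addrC subrK.
move=> p; exists d; have := main L.-1; rewrite prednK // ltnSn LM => /(_ isT) H.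
have dM : d <= M by exact: le_trans dw wM.
split => //; apply: expands_ext (expands_pow p d0 dM H) => r t _.
by rewrite [1 + _]addrC subrK.
Qed.

End Expansions.

(** * Counting indices above a level *)

Section Counting.
Context {R : realType}.
Implicit Types (W A : nat -> R) (bet C K r t : R).

(** [W] is the sequence whose level is asked for, of leading term
    [C n^(- bet)]; [A] perturbs it by a small multiple. *)
Definition regular_levels W A bet C K (N : nat) :=
  forall n, (N <= n)%N -> [/\ W n.+1 <= W n, W n <= W n.+1 + K * n%:R `^ (- (1 + bet)),
    0 <= A n.+1, A n.+1 <= A n & [/\ A n <= 2^-1, A n <= A n.+1 + K * n%:R^-1,
    C / 2 * n%:R `^ (- bet) <= W n & W n <= 2 * C * n%:R `^ (- bet)]].

Lemma powRV (x p : R) : 0 <= x -> (x^-1) `^ p = x `^ (- p).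
Proof. by move=> x0; rewrite -(powR_inv1 x0) -powRrM mulN1r. Qed.

Lemma level_index W A bet C K N r t : 0 < bet -> 0 < C -> (0 < N)%N ->
  regular_levels W A bet C K N -> 0 <= r -> r <= 1 -> 0 < t -> t <= W N ->
  exists m, [/\ (N <= m)%N, t <= W m + r * t * A m & W m.+1 + r * t * A m.+1 < t].
Proof.
move=> b0 C0 N0 reg r0 r1 t0 tN.
have rt0 : 0 <= r * t by rewrite mulr_ge0 // ltW.
have rt1 : r * t <= t by rewrite ger_pMl.
have ex : exists n, (N < n)%N && (W n + r * t * A n < t).
  pose y := (t / (8 * C)) `^ (- bet^-1).
  pose n := maxn N (Num.truncn y).
  have Nn : (N <= n)%N by rewrite leq_maxl.
  exists n.+1; rewrite ltnS Nn /=.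
  have [_ _ _ _ [A1 _ _ W2]] := reg n.+1 (leqW Nn).
  have tc : 0 < t / (8 * C) by rewrite divr_gt0 // mulr_gt0.
  have y0 : 0 < y by rewrite powR_gt0.
  have yn : y <= n.+1%:R by apply: le_trans (ltW (truncnS_gt _)) _; rewrite ler_nat ltnS leq_maxr.
  have h : n.+1%:R `^ (- bet) <= t / (8 * C).
    apply: le_trans (powR_neg_le y0 yn (ltW b0)) _.
    by rewrite /y -powRrM mulrNN mulVf ?gt_eqF // powRr1 // ltW.
  have h2 : 2 * C * n.+1%:R `^ (- bet) <= t / 4.
    have -> : t / 4 = 2 * C * (t / (8 * C)) by field; rewrite gt_eqF.
    by rewrite ler_pM2l // mulr_gt0.
  have h3 : r * t * A n.+1 <= t * 2^-1.
    by apply: (@le_trans _ _ (r * t * 2^-1)); [exact: ler_wpM2l|rewrite ler_wpM2r].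
  clear - W2 h2 h3 t0; lra.
case: (ex_minnP ex) => m /andP[Nm hm] mmin.
have [k mE] : exists k, m = k.+1 by case: m Nm {hm mmin} => // k _; exists k.
subst m; exists k; split => //.
rewrite leNgt; apply/negP => hk.
have kN : (N < k)%N.
  move: Nm; rewrite ltnS leq_eqVlt => /orP[/eqP E|//].
  subst k; exfalso; move: hk; rewrite ltNge => /negP; apply; apply: le_trans tN _; rewrite lerDl mulr_ge0 //.
  by have [_ _ h1 h2 _] := reg N (leqnn N); exact: le_trans h1 h2.
by have := mmin k; rewrite kN hk => /(_ isT); rewrite ltnn.
Qed.

Lemma level_ratio W A bet C K N r t m : 0 < bet -> 0 < C -> (0 < N)%N ->
  regular_levels W A bet C K N -> 0 <= r -> r <= 1 -> 0 < t -> (N <= m)%N ->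
  t <= W m + r * t * A m -> W m.+1 + r * t * A m.+1 < t ->
  4^-1 <= C * m%:R `^ (- bet) / t <= 2 * 2 `^ bet.
Proof.
move=> b0 C0 N0 reg r0 r1 t0 Nm h1 h2.
have rt0 : 0 <= r * t by rewrite mulr_ge0 // ltW.
have rt1 : r * t <= t by rewrite ger_pMl.
have [_ _ A0 A1 [A2 _ _ W2]] := reg m Nm.
have [_ _ _ _ [_ _ W1 _]] := reg m.+1 (leqW Nm).
have m0 : 0 < m%:R :> R by rewrite ltr0n (leq_trans N0).
have hA : r * t * A m <= t * 2^-1.
  by apply: (@le_trans _ _ (r * t * 2^-1)); [exact: ler_wpM2l|rewrite ler_wpM2r].
have hA0 : 0 <= r * t * A m.+1 by rewrite mulr_ge0.
have hm : (2 * m%:R) `^ (- bet) <= m.+1%:R `^ (- bet).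
  apply: powR_neg_le (ltW b0); first by rewrite ltr0n.
  by rewrite -natrM ler_nat; move: N0 Nm; clear; lia.
rewrite powRM ?(ltW m0) // in hm.
have p0 : 0 < 2 `^ bet :> R by rewrite powR_gt0.
have pm : 0 < m%:R `^ (- bet) by rewrite powR_gt0.
apply/andP; split.
  rewrite ler_pdivlMr //; clear - W2 h1 hA; lra.
rewrite ler_pdivrMr //.
have h3 : C / 2 * (2 `^ (- bet) * m%:R `^ (- bet)) <= t.
  apply: le_trans (ltW h2); apply: (@le_trans _ _ (W m.+1)); last by rewrite lerDl.
  by apply: le_trans W1; rewrite ler_pM2l // divr_gt0.
have := ler_wpM2l (ltW (mulr_gt0 (ltr0Sn R 1) p0)) h3.
apply: le_trans; rewrite [2 `^ (- bet)]powRN le_eqVlt; apply/orP; left; apply/eqP; field.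
by rewrite gt_eqF.
Qed.

Definition power_terms (l : seq (R * R)) (n : nat) : R := \sum_(x <- l) x.1 * n%:R `^ (- x.2).

(** A power of the index is a monomial in [t] and in the unknown [z], which is
    close to 1: this is the substitution that turns the level equation into a
    fixed-point equation for [z]. *)
Lemma index_power bet C z t (m : nat) w : 0 < bet -> 0 < C -> 0 < t -> (0 < m)%N ->
  z = C * m%:R `^ (- bet) / t -> m%:R `^ (- w) = C `^ (- (w / bet)) * t `^ (w / bet) * z `^ (w / bet).
Proof.
move=> b0 C0 t0 m0 ->; have mR : 0 < m%:R :> R by rewrite ltr0n.
have p0 : 0 < m%:R `^ (- bet) by rewrite powR_gt0.
rewrite -mulrA -powRM ?(ltW t0) //; last by rewrite mulr_ge0 ?mulr_ge0 ?invr_ge0 ?(ltW C0) ?(ltW t0) ?powR_ge0.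
have -> : t * (C * m%:R `^ (- bet) / t) = C * m%:R `^ (- bet) by field; rewrite gt_eqF.
rewrite powRM ?(ltW C0) ?(ltW p0) // mulrA (powRN C) mulVf ?gt_eqF ?powR_gt0 // mul1r -powRrM.
by congr (_ `^ _); field; rewrite gt_eqF.
Qed.

Lemma level_equation (S eW eA Y t r K z1 q zhi C : R) :
  0 < t -> 0 <= r -> r <= 1 -> 0 <= K -> 0 < C -> 0 <= q ->
  t <= Y -> Y <= t + K * (q * (t * z1 / C)) + r * t * (K * q) ->
  `|eW| <= K * (q * (t * z1 / C)) -> `|eA| <= K * q -> 0 <= z1 -> z1 <= zhi ->
  Y = S * t + eW + r * t * eA ->
  `|S - 1| <= (2 * K * zhi / C + 2 * K) * q.
Proof.
move=> t0 r0 r1 K0 C0 q0 Y1 Y2 eW1 eA1 z0 z1' YE.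
have -> : S - 1 = ((Y - t) - eW - r * t * eA) / t by rewrite YE; field; rewrite gt_eqF.
rewrite normrM [`|t^-1|]gtr0_norm ?invr_gt0 // ler_pdivrMr //.
have h1 : K * (q * (t * z1 / C)) <= K * (q * (t * zhi / C)).
  by rewrite !ler_wpM2l // ler_wpM2r ?invr_ge0 ?(ltW C0) // ler_wpM2l // ltW.
have h2 : r * t * (K * q) <= t * (K * q) by rewrite ler_wpM2r ?mulr_ge0 // ger_pMl.
have h3 : `|r * t * eA| <= t * (K * q).
  apply: le_trans h2; rewrite normrM ger0_norm ?mulr_ge0 ?(ltW t0) //.
  by rewrite ler_wpM2l // mulr_ge0 ?(ltW t0).
have h4 : (2 * K * zhi / C + 2 * K) * q * t = 2 * (K * (q * (t * zhi / C))) + 2 * (t * (K * q)).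
  by field; rewrite gt_eqF.
rewrite h4; move: h1 h2 h3 eW1 Y1 Y2.
set a := K * (q * (t * zhi / C)); set b := K * (q * (t * z1 / C)); set c := r * t * (K * q).
set d := t * (K * q); set e := r * t * eA.
move: a b c d e => a b c d e; rewrite !ler_norml => h1 h2 /andP[h3 h3'] /andP[h5 h5'] h6 h7.
by apply/andP; split; lra.
Qed.

Lemma level_mono W A bet C K N r t i j : regular_levels W A bet C K N -> 0 <= r -> 0 < t ->
  (N <= i)%N -> (i <= j)%N -> W j + r * t * A j <= W i + r * t * A i.
Proof.
move=> reg r0 t0 Ni /subnK <-; elim: (j - i)%N => // k IH; apply: le_trans IH; rewrite addSn.
have [h1 _ _ h2 _] := reg (k + i)%N (leq_trans Ni (leq_addl _ _)).
by apply: lerD => //; rewrite ler_wpM2l // mulr_ge0 // ltW.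
Qed.

Lemma level_index_unique W A bet C K N r t m m' : regular_levels W A bet C K N -> 0 <= r -> 0 < t ->
  (N <= m)%N -> (N <= m')%N -> t <= W m + r * t * A m -> W m.+1 + r * t * A m.+1 < t ->
  t <= W m' + r * t * A m' -> W m'.+1 + r * t * A m'.+1 < t -> m = m'.
Proof.
move=> reg r0 t0.
have mono := level_mono reg r0 t0.
wlog: m m' / (m <= m')%N => [H|].
  by case: (leqP m m') => [h|/ltnW h] *; [exact: H|symmetry; exact: H].
rewrite leq_eqVlt => /orP[/eqP //|h] Nm _ _ h1 h2 _.
have := mono m.+1 m' (leqW Nm) h; move=> /(le_lt_trans)/(_ h1)/(le_lt_trans h2).
by rewrite ltxx.
Qed.

(** The turning index [m] solves [W m + r t A m = t] up to the variation of
    both sides over one step, a relative error of order [1 / m]. Divided by [t]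
    and written in terms of [z = C m^(- bet) / t], it is an equation to which
    [expands_fixpoint] applies with error [t^(1 / bet)]; multiplied by
    [m], of order [t^(- 1 / bet)], this error is bounded. *)
Lemma count_expansion W A bet C K N (lw la : seq (R * R)) :
  0 < bet -> 0 < C -> 0 <= K -> (0 < N)%N ->
  (forall x, x \in lw -> bet < x.2) -> (forall x, x \in la -> 0 < x.2) ->
  regular_levels W A bet C K N ->
  (forall n, (N <= n)%N -> `|W n - C * n%:R `^ (- bet) - power_terms lw n| <= K * n%:R `^ (- (1 + bet))) ->
  (forall n, (N <= n)%N -> `|A n - power_terms la n| <= K * n%:R^-1) ->
  exists s : seq (R * nat * R), exists Cst t0 d : R, [/\ 0 < d, 0 <= Cst, 0 < t0, t0 <= 1 & all (fun x => d <= x.2) s /\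
  forall r t m, 0 <= r -> r <= 1 -> 0 < t -> t < t0 -> (N <= m)%N ->
    t <= W m + r * t * A m -> W m.+1 + r * t * A m.+1 < t ->
    `|m%:R - (C / t) `^ bet^-1 * (1 + expansion s r t)| <= Cst].
Proof.
move=> b0 C0 K0 N0 hlw hla reg eW eA.
have WN0 : 0 < W N.
  have [_ _ _ _ [_ _ h _]] := reg N (leqnn N); apply: lt_le_trans h.
  by rewrite !mulr_gt0 ?invr_gt0 // powR_gt0 ?ltr0n.
pose P (rt : R * R) (m : nat) := 0 <= rt.1 -> rt.1 <= 1 -> 0 < rt.2 -> rt.2 < W N ->
  [/\ (N <= m)%N, rt.2 <= W m + rt.1 * rt.2 * A m & W m.+1 + rt.1 * rt.2 * A m.+1 < rt.2].
have /choice [mf hmf] : forall rt, exists m, P rt m.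
  move=> [r t]; have [[r0 [r1 [tp tt]]]|h] := pselect (0 <= r /\ r <= 1 /\ 0 < t /\ t < W N).
    by have [m hm] := level_index b0 C0 N0 reg r0 r1 tp (ltW tt); exists m.
  by exists 0%N => /= r0 r1 tp tt; exfalso; apply: h.
pose z r t : R := C * (mf (r, t))%:R `^ (- bet) / t.
pose zhi : R := 2 * 2 `^ bet.
have zb r t : 0 <= r -> r <= 1 -> 0 < t -> t < W N -> 4^-1 <= z r t <= zhi.
  move=> r0 r1 tp tt; have [h1 h2 h3] := hmf (r, t) r0 r1 tp tt.
  exact: level_ratio b0 C0 N0 reg r0 r1 tp h1 h2 h3.
have M0 : 0 < bet^-1 by rewrite invr_gt0.
(* The monomials [c r^m t^w z^q] of the fixed-point equation; those coming
   from [W] lose one power of [t] in the division by [t]. *)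
pose l : seq (R * nat * R * R) :=
  [seq (- x.1 * C `^ (- (x.2 / bet)), 0%N, x.2 / bet - 1, x.2 / bet) | x <- lw] ++
  [seq (- x.1 * C `^ (- (x.2 / bet)), 1%N, x.2 / bet, x.2 / bet) | x <- la].
have l0 x : x \in l -> 0 < x.1.2.
  rewrite mem_cat => /orP[] /mapP[y hy ->] /=.
    by rewrite subr_gt0 ltr_pdivlMr // mul1r hlw.
  by rewrite divr_gt0 // hla.
have zhi0 : 0 < zhi by rewrite mulr_gt0 // powR_gt0.
pose K1 := (zhi / C) `^ bet^-1.
have eqn : edge_bigO (fun r t => z r t - 1 - \sum_(x <- l) x.1.1.1 * r ^+ x.1.1.2 * t `^ x.1.2 * z r t `^ x.2) bet^-1.
  exists ((2 * K * zhi / C + 2 * K) * K1), (Num.min 1 (W N)); split.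
  - by rewrite mulr_ge0 ?powR_ge0 // addr_ge0 ?mulr_ge0 ?invr_ge0 ?(ltW C0) ?(ltW zhi0).
  - by rewrite lt_min ltr01.
  - by rewrite ge_min lexx.
  move=> r t r0 r1 tp; rewrite lt_min => /andP[_ tt].
  have [h1 h2 h3] := hmf (r, t) r0 r1 tp tt.
  have /andP[z1 z2] := zb r t r0 r1 tp tt.
  have zE : z r t = C * (mf (r, t))%:R `^ (- bet) / t by [].
  move: zE; set m := mf (r, t) in h1 h2 h3 *; set zz := z r t in z1 z2 *; move=> zE; rewrite /= in h2 h3.
  have m0 : (0 < m)%N by exact: leq_trans h1.
  have mR : 0 < m%:R :> R by rewrite ltr0n.
  have zz0 : 0 <= zz by apply: le_trans z1; rewrite invr_ge0.
  have qE : m%:R^-1 <= K1 * t `^ bet^-1.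
    rewrite -(powR_inv1 (ltW mR)) (index_power 1 b0 C0 tp m0 zE) div1r mulrAC ler_wpM2r ?powR_ge0 //.
    rewrite -powRV ?(ltW C0) // /K1 powRM ?invr_ge0 ?(ltW C0) ?(ltW zhi0) // powRV ?(ltW C0) // mulrC ler_wpM2r ?powR_ge0 //.
    by apply: ge0_ler_powR; rewrite ?nnegrE ?invr_ge0 ?(ltW b0) ?(ltW zhi0) //.
  have qb : m%:R `^ (- (1 + bet)) = m%:R^-1 * (t * zz / C).
    rewrite opprD powRD; last by apply/implyP => _; rewrite gt_eqF.
    rewrite powR_inv1 ?(ltW mR) //; congr (_ * _); rewrite zE; field; by rewrite !gt_eqF.
  have [_ W1 A0 A1 [_ A2 _ _]] := reg m h1.
  apply: le_trans (_ : _ <= (2 * K * zhi / C + 2 * K) * m%:R^-1) _; last first.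
    rewrite -[leRHS]mulrA ler_wpM2l // addr_ge0 ?mulr_ge0 ?invr_ge0 ?(ltW C0) ?(ltW zhi0) //.
  rewrite addrAC.
  have q0 : 0 <= m%:R^-1 :> R by rewrite invr_ge0 ltW.
  apply: (level_equation tp r0 r1 K0 C0 q0 h2 _ _ (eA m h1) zz0 z2 _ (eW := W m - C * m%:R `^ (- bet) - power_terms lw m)).
  - rewrite -qb; move: h3 W1; set X := K * _ => h3 W1.
    have : r * t * A m <= r * t * A m.+1 + r * t * (K * m%:R^-1).
      by rewrite -mulrDr ler_wpM2l // mulr_ge0 // ltW.
    clear - h3 W1; lra.
  - by rewrite -qb; exact: eW.
  - rewrite /l big_cat !big_map /=.
    have -> : \sum_(i <- lw) - i.1 * C `^ (- (i.2 / bet)) * r ^+ 0 * t `^ (i.2 / bet - 1) * zz `^ (i.2 / bet) = - (power_terms lw m / t).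
      rewrite /power_terms mulr_suml -sumrN; apply: eq_bigr => i _.
      rewrite (index_power i.2 b0 C0 tp m0 zE) powRB; last by apply/implyP => _; rewrite gt_eqF.
      by rewrite powRr1 ?(ltW tp) //; field; rewrite gt_eqF.
    have -> : \sum_(i <- la) - i.1 * C `^ (- (i.2 / bet)) * r ^+ 1 * t `^ (i.2 / bet) * zz `^ (i.2 / bet) = - (r * power_terms la m).
      rewrite /power_terms mulr_sumr -sumrN; apply: eq_bigr => i _.
      by rewrite (index_power i.2 b0 C0 tp m0 zE); ring.
    by rewrite zE; field; rewrite gt_eqF.
have z40 : 0 < 4^-1 :> R by rewrite invr_gt0.
have [d [d0 dM [s sd [C2 [t2 [C20 t20 t21 Hs]]]]]] := expands_fixpoint M0 z40 WN0 l0 zb eqn (- bet^-1).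
exists s, (C `^ bet^-1 * C2), (Num.min t2 (W N)), d; split => //.
- by rewrite mulr_ge0 ?powR_ge0.
- by rewrite lt_min t20.
- by rewrite ge_min t21.
split => // r t m r0 r1 tp; rewrite lt_min => /andP[tt2 ttW] Nm h2 h3.
have [g1 g2 g3] := hmf (r, t) r0 r1 tp ttW.
have <- := level_index_unique reg r0 tp g1 Nm g2 g3 h2 h3.
have m0 : (0 < mf (r, t))%N by exact: leq_trans g1.
have E := index_power (-1) b0 C0 tp m0 (erefl (z r t)).
rewrite opprK powRr1 ?ler0n // mulN1r opprK in E.
have CT : (C / t) `^ bet^-1 = C `^ bet^-1 * t `^ (- bet^-1).
  by rewrite powRM ?invr_ge0 ?(ltW C0) ?(ltW tp) // powRV // ltW.
rewrite E CT -mulrBr normrM ger0_norm ?mulr_ge0 ?powR_ge0 // -!mulrA ler_wpM2l ?powR_ge0 //.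
have := Hs r t r0 r1 tp tt2; rewrite -addrA -opprD => hh.
apply: le_trans (ler_wpM2l (powR_ge0 t (- bet^-1)) hh) _.
by rewrite mulrCA powRN mulVf ?mulr1 // gt_eqF // powR_gt0.
Qed.

End Counting.

(** * Orders of decay *)

Section PowerOrder.
Context {R : realType}.
Implicit Types (g h s : nat -> R) (p q w L : R).

(** The sequence [g] is equivalent to [L n^(- p)], with [L = 0] allowed. *)
Definition order_lim g p L := n%:R `^ p * g n @[n --> \oo] --> L.

Lemma cvg_near_ext (f g : nat -> R) (l : R) : (\forall n \near \oo, f n = g n) ->
  f n @[n --> \oo] --> l -> g n @[n --> \oo] --> l.
Proof. by move=> fg H; apply: cvg_trans H; apply: near_eq_cvg; apply: filterS fg => n ->. Qed.

Lemma limM (f g : nat -> R) (l m : R) : f n @[n --> \oo] --> l -> g n @[n --> \oo] --> m ->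
  f n * g n @[n --> \oo] --> l * m.
Proof. exact: cvgM. Qed.

Lemma cvg_natr_pow p : p < 0 -> n%:R `^ p @[n --> \oo] --> (0 : R).
Proof.
move=> p0; apply/cvgrPdist_le => e e0; near=> n.
have n0 : (0 < n)%N by near: n; exact: nbhs_infty_gt.
have nR : 0 < n%:R :> R by rewrite ltr0n.
rewrite sub0r normrN ger0_norm ?powR_ge0 //.
have ey : 0 < e `^ p^-1 by rewrite powR_gt0.
have yn : e `^ p^-1 <= n%:R.
  apply: le_trans (ltW (truncnS_gt _)) _; rewrite ler_nat; near: n; exact: nbhs_infty_ge.
rewrite -[p]opprK; apply: le_trans (powR_neg_le ey yn _) _; first by rewrite oppr_ge0 ltW.
by rewrite opprK -powRrM mulVf ?lt_eqF // powRr1 // ltW.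
Unshelve. all: end_near.
Qed.

Lemma order_lim_ext g h p L : (\forall n \near \oo, g n = h n) -> order_lim g p L -> order_lim h p L.
Proof.
move=> gh; apply: cvg_near_ext; near=> n; have -> // : g n = h n by near: n.
Unshelve. all: end_near.
Qed.

Lemma order_lim_lower g p q L : q < p -> order_lim g p L -> order_lim g q 0.
Proof.
move=> qp H; have q0 : q - p < 0 by rewrite subr_lt0.
rewrite /order_lim -(mul0r L); apply: cvg_near_ext (limM (cvg_natr_pow q0) H); near=> n.
have n0 : (0 < n)%N by near: n; exact: nbhs_infty_gt.
by rewrite mulrA -powRD ?subrK //; apply/implyP => _; rewrite gt_eqF // ltr0n.
Unshelve. all: end_near.
Qed.

Lemma order_limD g h p L L' : order_lim g p L -> order_lim h p L' -> order_lim (fun n => g n + h n) p (L + L').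
Proof.
by move=> H H'; apply: cvg_ext (limD H H') => n; rewrite mulrDr.
Qed.

Lemma order_limZ g p L c : order_lim g p L -> order_lim (fun n => c * g n) p (c * L).
Proof.
by move=> H; apply: cvg_ext (limZ (c := c) H) => n; exact: mulrCA.
Qed.

Arguments order_limZ [g p L] c _.

Lemma order_lim0 p : order_lim (fun=> 0) p 0.
Proof. by rewrite /order_lim; under eq_fun do rewrite mulr0; exact: cvg_cst. Qed.

Lemma order_lim_pow w : order_lim (fun n => n%:R `^ (- w)) w 1.
Proof.
have : (fun=> 1 : R) n @[n --> \oo] --> (1 : R) by exact: cvg_cst.
apply: cvg_trans; apply: near_eq_cvg; near=> n.
have n0 : (0 < n)%N by near: n; exact: nbhs_infty_gt.
by rewrite -powRD ?subrr ?powRr0 //; apply/implyP => _; rewrite gt_eqF // ltr0n.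
Unshelve. all: end_near.
Qed.

Lemma pow_increment w (n : nat) : 0 < w -> (0 < n)%N ->
  w * n.+1%:R `^ (- (1 + w)) <= n%:R `^ (- w) - n.+1%:R `^ (- w) <= w * n%:R `^ (- (1 + w)).
Proof.
move=> w0 n0; have nR : 0 < n%:R :> R by rewrite ltr0n.
have d (x : R) : 0 < x -> is_derive x 1 (fun y : R => y `^ (- w)) (- w * x `^ (- (1 + w))).
  by move=> x0; have H := is_derive1_powR (- w) x0; apply: (is_derive_eq H); congr (_ * _ `^ _); ring.
have nn : n%:R < n.+1%:R :> R by rewrite ltr_nat.
have [c] : exists2 c, c \in `]n%:R, n.+1%:R[ & (fun y : R => y `^ (- w)) n.+1%:R - (fun y : R => y `^ (- w)) n%:R = (- w * c `^ (- (1 + w))) * (n.+1%:R - n%:R).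
  apply: (@MVT R (fun y : R => y `^ (- w)) (fun c : R => - w * c `^ (- (1 + w)))) => //.
    by move=> x; rewrite in_itv /= => /andP[x1 _]; apply: d; exact: lt_trans x1.
  apply: continuous_in_subspaceT => x; rewrite inE /= in_itv /= => /andP[x1 _].
  apply: differentiable_continuous; apply/derivable1_diffP.
  by have H := d x (lt_le_trans nR x1); exact: ex_derive.
rewrite in_itv /= => /andP[c1 c2] E.
have -> : n%:R `^ (- w) - n.+1%:R `^ (- w) = w * c `^ (- (1 + w)).
  by apply: oppr_inj; rewrite opprB E -[n.+1]addn1 natrD; ring.
have w1 : 0 <= 1 + w by lra.
rewrite !ler_pM2l // !powR_neg_le ?(ltW c1) ?(ltW c2) //; exact: lt_trans c1.
Qed.

(** The mean value theorem for [x^(- w)] on [n, n + 1]. *)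
Lemma order_lim_increment w : 0 < w -> order_lim (fun n => n%:R `^ (- w) - n.+1%:R `^ (- w)) (1 + w) w.
Proof.
move=> w0; have nR (n : nat) : (0 < n)%N -> 0 < n%:R :> R by rewrite ltr0n.
have w1 : 0 <= 1 + w by lra.
have lo : w * (1 + n%:R^-1) `^ (- (1 + w)) @[n --> \oo] --> w.
  rewrite -[X in _ --> X]mulr1; apply: cvgM; first exact: cvg_cst.
  have c1 : (1 + n%:R^-1 : R) @[n --> \oo] --> (1 : R).
    rewrite -[X in _ --> X]addr0; apply: cvgD; first exact: cvg_cst.
    apply: cvg_trans (cvg_natr_pow (_ : -1 < 0)); last by rewrite ltrN10.
    by apply: near_eq_cvg; apply: nearW => n; rewrite powR_inv1.
  have c2 : {for (1 : R), continuous (fun y : R => y `^ (- (1 + w)))}.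
    apply: differentiable_continuous; apply/derivable1_diffP.
    by apply: derivable_powR; rewrite in_itv /= ltr01.
  have p1 : (1 : R) `^ (- (1 + w)) = 1 by rewrite powR1.
  rewrite -[X in _ --> X]p1.
  exact: (@continuous_cvg _ _ _ _ _ (fun n : nat => 1 + n%:R^-1 : R) (fun y : R => y `^ (- (1 + w))) 1 c2 c1).
apply: (squeeze_cvgr _ lo (cvg_cst w)).
near=> n; have n0 : (0 < n)%N by near: n; exact: nbhs_infty_gt.
have /andP[h1 h2] := pow_increment w0 n0.
have p0 : 0 < n%:R `^ (1 + w) by rewrite powR_gt0 // nR.
have E : n%:R `^ (1 + w) * n%:R `^ (- (1 + w)) = 1 by rewrite powRN mulfV // gt_eqF.
apply/andP; split.
  apply: le_trans (ler_wpM2l (ltW p0) h1); rewrite mulrCA ler_pM2l //.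
  have -> : n.+1%:R = n%:R * (1 + n%:R^-1) :> R.
    by rewrite mulrDr mulr1 mulfV ?gt_eqF ?nR // -natr1.
  by rewrite powRM ?ler0n ?addr_ge0 ?invr_ge0 // mulrA E mul1r.
by apply: le_trans (ler_wpM2l (ltW p0) h2) _; rewrite mulrCA E mulr1.
Unshelve. all: end_near.
Qed.

Lemma order_lim_le g p L c : order_lim g p L -> L < c -> \forall n \near \oo, g n <= c * n%:R `^ (- p).
Proof.
move=> H Lc; have := cvgr_lt L H _ Lc => h; near=> n.
have n0 : (0 < n)%N by near: n; exact: nbhs_infty_gt.
have p0 : 0 < n%:R `^ p :> R by rewrite powR_gt0 // ltr0n.
rewrite powRN ler_pdivlMr // mulrC ltW //; near: n; exact: h.
Unshelve. all: end_near.
Qed.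

Lemma order_lim_ge g p L c : order_lim g p L -> c < L -> \forall n \near \oo, c * n%:R `^ (- p) <= g n.
Proof.
move=> H Lc; have := cvgr_gt L H _ Lc => h; near=> n.
have n0 : (0 < n)%N by near: n; exact: nbhs_infty_gt.
have p0 : 0 < n%:R `^ p :> R by rewrite powR_gt0 // ltr0n.
rewrite powRN ler_pdivrMr // mulrC ltW //; near: n; exact: h.
Unshelve. all: end_near.
Qed.

Lemma order_lim_terms (l : seq (R * R)) p : (forall x, x \in l -> p <= x.2) ->
  order_lim (power_terms l) p (\sum_(x <- l | x.2 == p) x.1).
Proof.
elim: l => [_|x l IH hl].
  by rewrite big_nil; apply: order_lim_ext (order_lim0 p); apply: nearW => n; rewrite /power_terms big_nil.
have {}IH := IH (fun y yl => hl y (mem_behead (s := x :: l) yl)).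
have xp := hl x (mem_head _ _).
have X : order_lim (fun n => x.1 * n%:R `^ (- x.2)) p (if x.2 == p then x.1 else 0).
  have := order_limZ x.1 (order_lim_pow x.2); rewrite mulr1.
  case: eqP => [-> //|/eqP xn]; apply: order_lim_lower; by rewrite lt_neqAle eq_sym xn.
rewrite big_cons; have := order_limD X IH; case: eqP => _; rewrite ?add0r => H;
  by apply: order_lim_ext H; apply: nearW => n; rewrite /power_terms big_cons.
Qed.

Lemma order_lim_terms_increment (l : seq (R * R)) p : 0 < p -> (forall x, x \in l -> p <= x.2) ->
  order_lim (fun n => power_terms l n - power_terms l n.+1) (1 + p) (p * \sum_(x <- l | x.2 == p) x.1).
Proof.
move=> p0; elim: l => [_|x l IH hl].
  by rewrite big_nil mulr0; apply: order_lim_ext (order_lim0 _); apply: nearW => n; rewrite /power_terms !big_nil subrr.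
have {}IH := IH (fun y yl => hl y (mem_behead (s := x :: l) yl)).
have xp := hl x (mem_head _ _).
have X : order_lim (fun n => x.1 * (n%:R `^ (- x.2) - n.+1%:R `^ (- x.2))) (1 + p) (p * (if x.2 == p then x.1 else 0)).
  have := order_limZ x.1 (order_lim_increment (lt_le_trans p0 xp)).
  case: eqP => [-> |/eqP xn]; first by rewrite mulrC.
  by rewrite mulr0; apply: order_lim_lower; rewrite ltrD2l lt_neqAle eq_sym xn.
rewrite big_cons; have := order_limD X IH; rewrite -mulrDr; case: eqP => _; rewrite ?add0r => H;
  by apply: order_lim_ext H; apply: nearW => n; rewrite /power_terms !big_cons; ring.
Qed.

Lemma order_lim_shift g p : 0 < p -> order_lim g p 0 -> order_lim (fun n => g n.+1) p 0.
Proof.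
move=> p0 H; have H1 : n.+1%:R `^ p * g n.+1 @[n --> \oo] --> (0 : R).
  by have := cvg_shift1 1 H; apply: cvg_ext => n; rewrite addn1.
apply/cvgr0Pnorm_le => e e0; have /cvgr0Pnorm_le/(_ e e0) := H1; apply: filterS => n.
apply: le_trans; rewrite !normrM ler_wpM2r // !ger0_norm ?powR_ge0 //.
by apply: ge0_ler_powR; rewrite ?nnegrE ?(ltW p0) // ler_nat.
Qed.

Lemma order_lim_littleo (e : nat -> R) w : e =o_\oo (fun n : nat => n%:R `^ (- 1 - w)) -> order_lim e (1 + w) 0.
Proof.
move=> /eqoP H; apply/cvgr0Pnorm_le => d d0; have := H d d0 => h; near=> n.
have n0 : (0 < n)%N by near: n; exact: nbhs_infty_gt.
have : `|e n| <= d * `|n%:R `^ (- 1 - w) : R| by near: n; exact: h.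
rewrite normrM (ger0_norm (powR_ge0 _ (- 1 - w))) (ger0_norm (powR_ge0 _ (1 + w))) => h1.
have p0 : 0 < n%:R `^ (1 + w) :> R by rewrite powR_gt0 // ltr0n.
rewrite mulrC -ler_pdivlMr // -powRN opprD //.
Unshelve. all: end_near.
Qed.

(** What is used of an expansion, for either of the two sequences; [g] is the
    distance to the limit, and [L] its coefficient at the order [bet]. *)
Lemma power_expansion_limits (s : nat -> R) (l : R) (N0 : nat) (o : option (power_sum R)) (bet : R) :
  power_expansion s l N0 o -> 0 < bet -> (bet%:E <= lead_expo o)%E ->
  let g n := l - s n in let L := if lead_expo o == bet%:E then lead_coeff o else 0 in
  exists lst : seq (R * R), [/\ forall x, x \in lst -> bet <= x.2,
    order_lim (fun n => g n - power_terms lst n) (1 + bet) 0,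
    order_lim g bet L, order_lim (fun n => g n - g n.+1) (1 + bet) (bet * L) &
    \sum_(x <- lst | x.2 == bet) x.1 = L /\ \forall n \near \oo, 0 <= g n /\ g n.+1 <= g n].
Proof.
move=> ex b0 bo g L; case: o ex bo @L => [P|] ex bo L; last first.
  have g0 : \forall n \near \oo, g n = 0.
    by exists N0 => // n /= hn; rewrite /g ex // subrr.
  have g1 : \forall n \near \oo, g n - g n.+1 = 0.
    by exists N0 => // n /= hn; rewrite /g !ex ?subrr //; exact: leqW.
  exists [::]; rewrite /L /=; split => //.
  - by apply: order_lim_ext (order_lim0 _); apply: filterS g0 => n ->; rewrite /power_terms big_nil subrr.
  - by apply: order_lim_ext (order_lim0 _); apply: filterS g0 => n ->.
  - by rewrite mulr0; apply: order_lim_ext (order_lim0 _); apply: filterS g1 => n ->.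
  - split; first by rewrite big_nil.
    by exists N0 => // n /= hn; rewrite /g !ex ?subrr //; exact: leqW.
case: ex => -[t0 tinc c0] [e /order_lim_littleo eo sE].
pose lst := [seq (ps_coef P j, ps_expo P j) | j : 'I_(ps_len P).+1].
pose tau := ps_lead_expo P.
have lstE n : power_terms lst n = \sum_(j < (ps_len P).+1) ps_coef P j * n%:R `^ (- ps_expo P j).
  by rewrite /power_terms big_map big_enum.
have tle j : tau <= ps_expo P j.
  have [->|jn] := eqVneq j ord0; first exact: lexx.
  by apply: ltW; apply: tinc; rewrite lt0n.
have ltau x : x \in lst -> tau <= x.2 by case/mapP => j _ -> /=.
have bt : bet <= tau by rewrite -lee_fin.
have sumtau : \sum_(x <- lst | x.2 == tau) x.1 = ps_lead_coef P.
  rewrite big_map /= big_enum_cond /= (bigD1 ord0) //= big1 ?addr0 // => j /andP[/eqP h1 h2].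
  have := tinc ord0 j; rewrite lt0n h2 => /(_ isT); rewrite -/(ps_lead_expo P) -/tau h1 ltxx //.
have gE : \forall n \near \oo, g n - power_terms lst n = - 1 * e n.
  by exists N0 => // n /= hn; rewrite /g sE // lstE; ring.
have G0 : order_lim (fun n => g n - power_terms lst n) (1 + tau) 0.
  by have := order_limZ (- 1) eo; rewrite mulr0; apply: order_lim_ext; apply: filterS gE => n ->.
have tau0 : 0 < 1 + tau by apply: addr_gt0.
have G1 : order_lim g tau (ps_lead_coef P).
  have T := order_lim_terms ltau; rewrite sumtau in T.
  have lt1 : tau < 1 + tau by rewrite ltrDr.
  have := order_limD (order_lim_lower lt1 G0) T; rewrite add0r; apply: order_lim_ext.
  by apply: nearW => n; rewrite subrK.
have G2 : order_lim (fun n => g n - g n.+1) (1 + tau) (tau * ps_lead_coef P).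
  have T := order_lim_terms_increment t0 ltau; rewrite sumtau in T.
  have := order_limD (order_limD G0 (order_limZ (- 1) (order_lim_shift tau0 G0))) T.
  rewrite mulr0 addr0 add0r; apply: order_lim_ext; apply: nearW => n; ring.
have pos : \forall n \near \oo, 0 <= g n /\ g n.+1 <= g n.
  have h1 := order_lim_ge G1 c0.
  have h2 := order_lim_ge G2 (mulr_gt0 t0 c0).
  by apply: filterS2 h1 h2 => n; rewrite !mul0r => u1 u2; split; [exact: u1|rewrite -subr_ge0; exact: u2].
have Lsum : \sum_(x <- lst | x.2 == bet) x.1 = L.
  rewrite /L /= eqe -/tau; have [<-//|tb] := eqVneq tau bet.
  rewrite big_seq_cond big_pred0 // => x; apply/negbTE/negP => /andP[/ltau h /eqP E].
  by move: tb; rewrite eq_le bt -E h.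
exists lst; split => //.
- by move=> x /ltau; exact: le_trans.
- move: bt; rewrite le_eqVlt => /orP[/eqP ->//|h]; apply: order_lim_lower G0; by rewrite ltrD2l.
- rewrite /L /= eqe -/tau; have [<-//|tb] := eqVneq tau bet.
  by apply: order_lim_lower G1; rewrite lt_neqAle eq_sym tb.
- rewrite /L /= eqe -/tau; have [<-//|tb] := eqVneq tau bet.
  by rewrite mulr0; apply: order_lim_lower G2; rewrite ltrD2l lt_neqAle eq_sym tb.
Qed.

End PowerOrder.
Arguments order_limZ {R} [g p L] c _.

(** * Eventual properties of the coefficients *)

Section EdgeFacts.
Context {R : realType}.
Implicit Types (a b : nat -> R) (bet C K : R).

(** All bounds on the coefficients that the recurrence and the counting need,
    with the same constants at every later starting index. *)
Record edge_facts a b bet C c0 K (lw la : seq (R * R)) (N : nat) : Prop := EdgeFacts {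
  ef_regular : edge_regular a b N;
  ef_step : forall n, (N <= n)%N -> c0 * n%:R `^ (- (1 + bet)) <= step a b n;
  ef_defect : forall n, (N <= n)%N -> 0 < defect a b n <= 2 * C * n%:R `^ (- bet);
  ef_levels : regular_levels (defect a b) (fun n => 1 - a n) bet C K N;
  ef_defect_terms : forall n, (N <= n)%N ->
    `|defect a b n - C * n%:R `^ (- bet) - power_terms lw n| <= K * n%:R `^ (- (1 + bet));
  ef_a_terms : forall n, (N <= n)%N -> `|1 - a n - power_terms la n| <= K * n%:R^-1 }.

Lemma power_terms_split (l : seq (R * R)) bet n : 
  power_terms l n = (\sum_(x <- l | x.2 == bet) x.1) * n%:R `^ (- bet) + power_terms [seq x <- l | x.2 != bet] n.
Proof.
rewrite /power_terms big_filter (bigID (fun x => x.2 == bet)) /=; congr (_ + _).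
by rewrite mulr_suml; apply: eq_bigr => x /eqP ->.
Qed.

Lemma edge_facts_hold a b N0 (oa ob : option (power_sum R)) bet :
  power_expansion a 1 N0 oa -> power_expansion b 0 N0 ob ->
  (Order.min (lead_expo ob) (lead_expo oa))%E = bet%:E ->
  [/\ 0 < bet, 0 < C1 oa ob, a n @[n --> \oo] --> (1 : R), b n @[n --> \oo] --> (0 : R) &
   exists c0 K (lw la : seq (R * R)), [/\ 0 < c0, 0 <= K, forall x, x \in lw -> bet < x.2,
     forall x, x \in la -> 0 < x.2 & \forall N \near \oo, edge_facts a b bet (C1 oa ob) c0 K lw la N]].
Proof.
move=> exa exb betE.
have b0 : 0 < bet.
  rewrite -lte_fin -betE lt_min; apply/andP; split.
    by case: ob exb {betE} => [P|] /=; [case=> -[]|rewrite ltry].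
  by case: oa exa {betE} => [P|] /=; [case=> -[]|rewrite ltry].
have ba : (bet%:E <= lead_expo oa)%E by rewrite -betE ge_min lexx orbT.
have bb : (bet%:E <= lead_expo ob)%E by rewrite -betE ge_min lexx.
have [la [la0 A0 A1 A2 [A3 A4]]] := power_expansion_limits exa b0 ba.
have [lb [lb0 B0 B1 B2 [B3 B4]]] := power_expansion_limits exb b0 bb.
set La := (if lead_expo oa == bet%:E then _ else _) in A1 A2 A3.
set Lb := (if lead_expo ob == bet%:E then _ else _) in B1 B2 B3.
have CE : 2 * La + Lb = C1 oa ob.
  rewrite /La /Lb /C1 -betE; case: ltgtP => h.
  - by rewrite eqxx (gt_eqF h) addr0.
  - by rewrite (gt_eqF h) eqxx mulr0 add0r.
  - by rewrite h eqxx.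
have c0a : (lead_expo oa < +oo)%E -> 0 < lead_coeff oa.
  by case: oa exa {betE ba A1 A2 A3 La CE} => [P|] //= [[_ _ c0] _] _.
have c0b : (lead_expo ob < +oo)%E -> 0 < lead_coeff ob.
  by case: ob exb {betE bb B1 B2 B3 Lb CE} => [P|] //= [[_ _ c0] _] _.
have C0 : 0 < C1 oa ob.
  rewrite /C1; move: betE c0a c0b; clear; case: (ltgtP (lead_expo oa) (lead_expo ob)) => h betE c0a c0b.
  - by rewrite mulr_gt0 // c0a // betE ltry.
  - by rewrite c0b // betE ltry.
  - by rewrite addr_gt0 ?mulr_gt0 ?c0a ?c0b // ?betE -?h ?betE ltry.
have W1 : order_lim (defect a b) bet (C1 oa ob).
  rewrite -CE; apply: order_lim_ext (order_limD (order_limZ 2 A1) B1).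
  by apply: nearW => n; rewrite /defect; ring.
have W2 : order_lim (step a b) (1 + bet) (bet * C1 oa ob).
  have -> : bet * C1 oa ob = 2 * (bet * La) + bet * Lb by rewrite -CE; ring.
  apply: order_lim_ext (order_limD (order_limZ 2 A2) B2).
  by apply: nearW => n; rewrite /step; ring.
have b10 : 0 < 1 + bet by exact: addr_gt0.
have lb1 : bet < 1 + bet by rewrite ltrDr.
have cv0 (g : nat -> R) (L : R) : order_lim g bet L -> g n @[n --> \oo] --> (0 : R).
  by move=> /(order_lim_lower b0); apply: cvg_ext => n; rewrite powRr0 mul1r.
have cva : a n @[n --> \oo] --> (1 : R).
  rewrite -[X in _ --> X]subr0; apply: cvg_ext (limB (cvg_cst (1 : R)) (cv0 _ _ A1)) => n; ring.
have cvb : b n @[n --> \oo] --> (0 : R).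
  rewrite -[X in _ --> X](subrr (0 : R)); apply: cvg_ext (limB (cvg_cst (0 : R)) (cv0 _ _ B1)) => n; ring.
split => //.
pose lw := [seq (2 * x.1, x.2) | x <- la & x.2 != bet] ++ [seq x <- lb | x.2 != bet].
exists (bet * C1 oa ob / 2), (2 * bet * C1 oa ob + `|La| * bet + 1), lw, la.
have WT n : defect a b n - C1 oa ob * n%:R `^ (- bet) - power_terms lw n =
   2 * (1 - a n - power_terms la n) + (0 - b n - power_terms lb n).
  have E : power_terms lw n = 2 * power_terms [seq x <- la | x.2 != bet] n + power_terms [seq x <- lb | x.2 != bet] n.
    rewrite /lw /power_terms big_cat big_map mulr_sumr; congr (_ + _).
    by apply: eq_bigr => x _; rewrite mulrA.
  by rewrite E -CE (power_terms_split la bet) (power_terms_split lb bet) A3 B3 /defect; ring.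
have W3 : order_lim (fun n => defect a b n - C1 oa ob * n%:R `^ (- bet) - power_terms lw n) (1 + bet) 0.
  have := order_limD (order_limZ 2 A0) B0; rewrite mulr0 addr0; apply: order_lim_ext.
  by apply: nearW => n; rewrite WT.
have K1 : 1 <= 2 * bet * C1 oa ob + `|La| * bet + 1.
  by rewrite lerDr addr_ge0 ?mulr_ge0 // ltW.
split.
- by rewrite divr_gt0 // mulr_gt0.
- exact: le_trans ler01 K1.
- move=> x; rewrite mem_cat => /orP[/mapP[y]|]; rewrite mem_filter => /andP[yb yl].
    by move=> -> /=; rewrite lt_neqAle eq_sym yb la0.
  by rewrite lt_neqAle eq_sym yb lb0.
- by move=> x /la0; exact: lt_le_trans.
have near_all (P : nat -> Prop) : (\forall n \near \oo, P n) -> \forall N \near \oo, forall n, (N <= n)%N -> P n.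
  by move=> [M _ h]; exists M => // N /= hN n hn; apply: h; rewrite /= (leq_trans hN).
have q1 : \forall n \near \oo, 2^-1 <= a n.
  have h : 2^-1 < 1 :> R by lra.
  by apply: filterS (cvgr_gt 1 cva _ h) => n /ltW.
have q2 : \forall n \near \oo, - 2^-1 <= b n.
  have h : - 2^-1 < 0 :> R by lra.
  by apply: filterS (cvgr_gt 0 cvb _ h) => n /ltW.
have st0 : bet * C1 oa ob / 2 < bet * C1 oa ob.
  by rewrite gtr_pMr ?mulr_gt0 // invf_lt1 // ltr1n.
have q3 := order_lim_ge W2 st0.
have q4 : \forall n \near \oo, step a b n <= (2 * bet * C1 oa ob + `|La| * bet + 1) * n%:R `^ (- (1 + bet)).
  apply: order_lim_le W2 _.
  rewrite -addrA -mulrA mulr_natl mulr2n -addrA ltrDl addrA ltr_wpDl // addr_ge0 ?mulr_ge0 // ltW //.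
have q5 : \forall n \near \oo, C1 oa ob / 2 * n%:R `^ (- bet) <= defect a b n.
  by apply: order_lim_ge W1 _; rewrite gtr_pMr // invf_lt1 // ltr1n.
have q6 : \forall n \near \oo, defect a b n <= 2 * C1 oa ob * n%:R `^ (- bet).
  by apply: order_lim_le W1 _; rewrite ltr_pMl // ltr1n.
have lim_abs (g : nat -> R) : order_lim g (1 + bet) 0 -> \forall n \near \oo, `|g n| <= 1 * n%:R `^ (- (1 + bet)).
  move=> H; apply: filterS2 (order_lim_le H ltr01) (order_lim_ge H (ltrN10 R)) => n h1 h2.
  by rewrite ler_norml h1 -mulNr h2.
have q7 := lim_abs _ W3; have q8 := lim_abs _ A0.
have q9 : \forall n \near \oo, a n.+1 - a n <= (`|La| * bet + 1) * n%:R `^ (- (1 + bet)).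
  have h : bet * La < `|La| * bet + 1 by rewrite mulrC; apply: le_lt_trans (ler_wpM2r (ltW b0) (ler_norm La)) _; rewrite ltrDl.
  by apply: filterS (order_lim_le A2 h) => n; have -> : 1 - a n - (1 - a n.+1) = a n.+1 - a n by ring.
have q10 : \forall n \near \oo, (0 < n)%N by exact: nbhs_infty_gt.
have all1 := near_all _ (filterI q1 (filterI q2 (filterI q3 (filterI q4 (filterI q5 q6))))).
have all2 := near_all _ (filterI q7 (filterI q8 (filterI q9 (filterI q10 (filterI A4 B4))))).
case: all1 => M1 _ H1'; case: all2 => M2 _ H2'; exists (maxn M1 M2) => // N /=; rewrite geq_max => /andP[hN1 hN2].
have H1 := H1' N hN1; have H2 := H2' N hN2; clear H1' H2'.
have N00 : (0 < N)%N by have [_ [_ [_ [h _]]]] := H2 N (leqnn N).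
have NR n : (N <= n)%N -> 0 < n%:R :> R by move=> h; rewrite ltr0n (leq_trans N00).
have up n : (N <= n)%N -> n%:R `^ (- (1 + bet)) <= n%:R^-1 :> R.
  move=> h; rewrite -(powR_inv1 (ltW (NR n h))) opprD.
  have n1 : 1 <= n%:R :> R by rewrite ler1n -(ltr0n R) NR.
  by rewrite ler_powR // gerDl oppr_le0 ltW.
have K0 := le_trans ler01 K1.
split.
- move=> n /[dup]hn hN; have [h1 [h2 _]] := H1 n hn; have [_ [_ [_ [_ [[h3 h4] [h5 h6]]]]]] := H2 n hn.
  by split => //; [rewrite -subr_ge0|move: h4; rewrite lerD2l lerN2|
    split; [rewrite -oppr_ge0 -sub0r|move: h6; rewrite !sub0r lerN2]].
- by move=> n hn; have [_ [_ [h _]]] := H1 n hn.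
- move=> n hn; have [_ [_ [_ [_ [h1 h2]]]]] := H1 n hn; rewrite h2 andbT; apply: lt_le_trans h1.
  apply: mulr_gt0; [by rewrite divr_gt0|by apply: powR_gt0; exact: NR].
- move=> n hn; have [u1 [_ [u3 [u4 [u5 u6]]]]] := H1 n hn.
  have [_ [_ [v3 [_ [[v4 v5] _]]]]] := H2 n hn; have [_ [_ [_ [_ [[v6 _] _]]]]] := H2 n.+1 (leqW hn).
  have sE : step a b n = defect a b n - defect a b n.+1 by rewrite /step /defect; ring.
  have s0 : 0 <= step a b n.
    by apply: le_trans u3; rewrite mulr_ge0 ?powR_ge0 // ltW // divr_gt0 // mulr_gt0.
  split => //.
  + by rewrite -subr_ge0 -sE.
  + by rewrite addrC -lerBlDr -sE.
  + split => //; first by rewrite lerBlDr [leLHS]splitr div1r lerD2l.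
    have h : (`|La| * bet + 1) * n%:R `^ (- (1 + bet)) <= (2 * bet * C1 oa ob + `|La| * bet + 1) * n%:R^-1.
      apply: ler_pM; rewrite ?powR_ge0 ?up //; first by rewrite addr_ge0 // mulr_ge0 // ltW.
      by rewrite -addrA lerDr mulr_ge0 ?mulr_ge0 // ltW.
    by rewrite -lerBlDl (_ : 1 - a n - (1 - a n.+1) = a n.+1 - a n); [exact: le_trans v3 h|ring].
- move=> n hn; have [h _] := H2 n hn; apply: le_trans h _; by rewrite ler_wpM2r ?powR_ge0.
- move=> n hn; have [_ [h _]] := H2 n hn; apply: le_trans h _; rewrite mul1r.
  by apply: le_trans (up n hn) _; rewrite ler_peMl // invr_ge0 ltW // NR.
Qed.

End EdgeFacts.

(** * Integrals over the half-line *)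

Section HalfLine.
Context {R : realType}.
Local Notation leb := (@lebesgue_measure R).
Implicit Types (G : R -> R) (p q x c s : R).

Lemma powR_cont p x : 0 < x -> {for x, continuous (fun y : R => y `^ p)}.
Proof.
move=> x0; apply: differentiable_continuous; apply/derivable1_diffP.
by apply: derivable_powR; rewrite in_itv /= x0.
Qed.

Lemma ge0_integral_scale (D : set R) (h : R -> R) c : measurable D -> measurable_fun D h ->
  (forall x, D x -> 0 <= h x) -> 0 <= c ->
  (\int[leb]_(x in D) (c * h x)%:E = c%:E * \int[leb]_(x in D) (h x)%:E)%E.
Proof.
move=> mD mh h0 c0; rewrite -(@ge0_integralZl _ _ _ leb D mD (fun x => (h x)%:E) _ c%:E) //.
exact/measurable_EFinP.
Qed.

Lemma scaled_EFin (c y : R) (X : \bar R) : 0 < c -> (c%:E * X = y%:E)%E -> X = (c^-1 * y)%:E.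
Proof.
move=> c0 H; have : (c^-1%:E * (c%:E * X) = c^-1%:E * y%:E)%E by rewrite H.
by rewrite muleA -EFinM mulVf ?gt_eqF // mul1e.
Qed.

Lemma half_line_meas G : {in `]0, +oo[, continuous G} -> measurable_fun (`]0%R, +oo[ : set R) G.
Proof.
move=> cG; apply: open_continuous_measurable_fun; first exact: interval_open.
by move=> x; rewrite inE /= => hx; apply: cG.
Qed.

Lemma half_line_lim G c : 0 < c -> (forall x, 0 < x -> 0 <= G x) -> {in `]0, +oo[, continuous G} ->
  (\int[leb]_(x in `[(c * n.+1%:R^-1)%R, +oo[) (G x)%:E)%E @[n --> \oo] --> (\int[leb]_(x in `]0%R, +oo[) (G x)%:E)%E.
Proof.
move=> c0 G0 cG.
have mG := half_line_meas cG.
have pos n : 0 < c * n.+1%:R^-1 by rewrite mulr_gt0 // invr_gt0.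
have U : \bigcup_n [set` `[(c * n.+1%:R^-1)%R, +oo[] = `]0, +oo[%classic :> set R.
  apply/seteqP; split => x /=.
    by move=> [n _] /=; rewrite !in_itv /= !andbT; apply: lt_le_trans.
  rewrite in_itv /= andbT => x0; exists (Num.truncn (x / c)^-1) => //=.
  rewrite in_itv /= andbT mulrC -ler_pdivlMr // -[leRHS]invrK lef_pV2 ?posrE ?invr_gt0 ?divr_gt0 //.
  exact: ltW (truncnS_gt _).
rewrite -U; apply: ge0_nondecreasing_set_cvg_integral.
- apply/nondecreasing_seqP => n; rewrite subsetEset => x /=; rewrite !in_itv /= !andbT.
  by apply: le_trans; rewrite ler_pM2l // lef_pV2 ?posrE // ler_nat.
- by move=> n; exact: measurable_itv.
- move=> n; apply/measurable_EFinP; apply: (measurable_funS _ _ mG) => //.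
  by move=> x /=; rewrite !in_itv /= !andbT; apply: lt_le_trans.
- by move=> n x; rewrite /= in_itv /= andbT => h; rewrite lee_fin G0 // (lt_le_trans _ h).
Qed.

(** The change of variables is made on closed half-lines bounded away from 0,
    whose starting point then tends to 0. *)
Lemma dilation G c : 0 < c -> (forall x, 0 < x -> 0 <= G x) -> {in `]0, +oo[, continuous G} ->
  (\int[leb]_(x in `]0%R, +oo[) (G x)%:E = \int[leb]_(x in `]0%R, +oo[) (c * G (c * x))%:E)%E.
Proof.
move=> c0 G0 cG.
pose F : R -> R := fun x => c * x.
have cF : continuous F by exact: mulrl_continuous.
have dF : derive1 F = fun=> c.
  by apply/funext => x; rewrite derive1E deriveM // derive_cst scaler0 addr0 derive_id; apply: mulr1.
have cG2 : {in `]0, +oo[, continuous (fun x => c * G (c * x))}.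
  move=> x; rewrite in_itv /= andbT => x0; apply: cvgM; first exact: cvg_cst.
  apply: (@continuous_comp _ _ _ F G); first exact: cF.
  by apply: cG; rewrite in_itv /= andbT mulr_gt0.
have G20 x : 0 < x -> 0 <= c * G (c * x) by move=> x0; rewrite mulr_ge0 ?(ltW c0) // G0 // mulr_gt0.
have L1 := half_line_lim c0 G0 cG.
have L2 := half_line_lim ltr01 G20 cG2.
rewrite -(cvg_lim (@ereal_hausdorff R) L1) -(cvg_lim (@ereal_hausdorff R) L2).
congr (limn _); apply/funext => n.
have a0 : 0 < n.+1%:R^-1 :> R by rewrite invr_gt0.
have H := @increasing_ge0_integration_by_substitutiony R F G n.+1%:R^-1.
rewrite /F -/F dF in H; rewrite mul1r H.
- apply: eq_integral => x _; congr EFin; rewrite /= /GRing.mul_fun /=; exact: mulrC.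
- by move=> x y _ _ xy; rewrite ltr_pM2l.
- by move=> x _; exact: cvg_cst.
- exact: is_cvg_cst.
- exact: is_cvg_cst.
- split; first by move=> x _; exact: derivableM.
  by apply: cvg_at_right_filter; exact: cF.
- apply/cvgryPge => A; exists (A / c); split; first exact: num_real.
  by move=> x; rewrite ltr_pdivrMr // mulrC => /ltW.
- apply/continuous_within_itvcyP; split.
    move=> x; rewrite in_itv /= andbT => h; apply: cG; rewrite in_itv /= andbT.
    by apply: lt_trans h; rewrite mulr_gt0.
  by apply: cvg_at_right_filter; apply: cG; rewrite in_itv /= andbT mulr_gt0.
- move=> x; rewrite in_itv /= andbT => h; apply: G0; apply: lt_trans h; rewrite mulr_gt0 //.
Qed.

Lemma powR_cvgy0 p : p < 0 -> w `^ p @[w --> +oo%R] --> (0 : R).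
Proof.
move=> p0; apply/cvgrPdist_le => e e0; near=> w.
have w0 : 0 < w by near: w; exact: nbhs_pinfty_gt.
rewrite sub0r normrN ger0_norm ?powR_ge0 //.
have ew : e `^ p^-1 <= w by near: w; apply: nbhs_pinfty_ge; exact: num_real.
rewrite -[p]opprK; apply: (@le_trans _ _ ((e `^ p^-1) `^ (- - p))).
  by apply: powR_neg_le; rewrite ?powR_gt0 // oppr_ge0 ltW.
by rewrite opprK -powRrM mulVf ?lt_eqF // powRr1 // ltW.
Unshelve. all: end_near.
Qed.

Lemma powR_tail p x : 1 < p -> 0 < x ->
  (\int[leb]_(w in `[x, +oo[) (w `^ (- p))%:E = (x `^ (1 - p) / (p - 1))%:E)%E.
Proof.
move=> p1 x0.
pose F : R -> R := fun w => - (p - 1)^-1 * w `^ (1 - p).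
have dF (w : R) : 0 < w -> is_derive w 1 F (w `^ (- p)).
  move=> w0; have d := is_derive1_powR (1 - p) w0.
  have H := @is_deriveZ _ _ _ _ (- (p - 1)^-1) w 1 _ d.
  apply: (is_derive_eq H); rewrite /GRing.scale /=.
  have -> : 1 - p - 1 = - p by ring.
  by field; rewrite gt_eqF // subr_gt0.
rewrite (@ge0_continuous_FTC2y R _ F x 0).
- by congr EFin; rewrite /F; ring.
- by move=> w _; exact: powR_ge0.
- apply/continuous_within_itvcyP; split.
    by move=> w; rewrite in_itv /= andbT => h; apply: powR_cont; exact: lt_trans h.
  by apply: cvg_at_right_filter; exact: powR_cont.
- rewrite -(mulr0 (- (p - 1)^-1)); apply: cvgM; first exact: cvg_cst.
  by apply: powR_cvgy0; rewrite subr_lt0.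
- by move=> w h; have /dF H : 0 < w by [exact: lt_trans h]; exact: ex_derive.
- by apply: cvg_at_right_filter; apply: differentiable_continuous; apply/derivable1_diffP; have H := dF _ x0; exact: ex_derive.
- move=> w; rewrite in_itv /= andbT => h; rewrite derive1E.
  by have /dF H : 0 < w by [exact: lt_trans h]; exact: derive_val.
Qed.

Lemma powR_exp_le p : exists2 C : R, 0 < C & forall t : R, 1 <= t -> t `^ p * expR (- t) <= C * t `^ (-2).
Proof.
pose n := (Num.truncn `|p + 2|).+1.
exists n.+1`!%:R; first by rewrite ltr0n fact_gt0.
move=> t t1; have t0 : 0 < t by exact: lt_le_trans t1.
rewrite expRN ler_pdivrMr ?expR_gt0 // mulrAC.
have pn : p + 2 <= n.+1%:R.
  apply: le_trans (ler_norm _) _; apply: ltW; apply: lt_trans (truncnS_gt _) _.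
  by rewrite ltr_nat.
have h : t `^ (p + 2) <= n.+1`!%:R * expR t.
  apply: (@le_trans _ _ (t ^+ n.+1)); first by rewrite -(powR_mulrn _ (ltW t0)) ler_powR.
  rewrite mulrC -ler_pdivrMr ?ltr0n ?fact_gt0 //.
  by apply: le_trans (expR_ge1Dxn n (ltW t0)); rewrite lerDr.
rewrite -[p](addrK 2) powRB; last by apply/implyP => _; rewrite gt_eqF.
rewrite powRN; apply: ler_wpM2r => //; rewrite invr_ge0 powR_ge0 //.
Qed.

(** The bound by the derivative of [- s^-1 / (1 + t ^ s)] controls both ends of
    the half-line at once. *)
Lemma Gamma_dominated s : 0 < s -> exists2 C : R, 0 < C &
  forall t : R, 0 < t -> t `^ (s - 1) * expR (- t) <= C * (t `^ (s - 1) / (1 + t `^ s) ^+ 2).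
Proof.
move=> s0; have [C C0 hC] := powR_exp_le (2 * s).
exists (4 + 4 * C); first by rewrite addr_gt0 // mulr_gt0.
move=> t t0; rewrite [leRHS]mulrCA ler_pM2l ?powR_gt0 //.
have ts := powR_ge0 t s.
rewrite ler_pdivlMr; last by rewrite exprn_gt0 // ltr_pwDl.
have e0 := expR_gt0 (- t).
have [t1|t1] := leP t 1.
  have e1 : expR (- t) <= 1 by rewrite -expR0 ler_expR oppr_le0 ltW.
  have ts1 : t `^ s <= 1 by apply: powR_le1 => //; exact: ltW.
  nra.
have ts1 : 1 <= t `^ s by rewrite -(powRr0 t) ler_powR // ltW.
have h := hC t (ltW t1); rewrite mulrC [2 * s]mulrC powRrM powR_mulrn ?powR_ge0 // in h.
have t2 : t `^ (-2) <= 1.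
  by have := powR_neg_le ltr01 (ltW t1) (ler0n R 2); rewrite powR1.
have Y1 : (1 + t `^ s) ^+ 2 <= 4 * (t `^ s) ^+ 2 by nra.
have h2 : expR (- t) * (t `^ s) ^+ 2 <= C by apply: le_trans h _; rewrite ger_pMr.
nra.
Qed.

Lemma Gamma_majorant_cont s : {in `]0, +oo[, continuous (fun t : R => t `^ (s - 1) / (1 + t `^ s) ^+ 2)}.
Proof.
move=> w; rewrite in_itv /= andbT => w0.
have D0 : 0 < 1 + w `^ s by rewrite ltr_pwDl // powR_ge0.
apply: cvgM; first exact: powR_cont.
apply: cvgV; first by rewrite expf_neq0 // gt_eqF.
apply: (@continuous_comp _ _ _ (fun t : R => 1 + t `^ s) (fun y : R => y ^+ 2)); last exact: exprn_continuous.
by apply: cvgD; [exact: cvg_cst|exact: powR_cont].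
Qed.

Lemma Gamma_majorant s (d : R) : 0 < s -> 0 < d ->
  (\int[leb]_(t in `[d, +oo[) (t `^ (s - 1) / (1 + t `^ s) ^+ 2)%:E <= (s^-1)%:E)%E.
Proof.
move=> s0 d0; pose F : R -> R := fun t => - s^-1 * (1 + t `^ s)^-1.
have D0 (t : R) : 0 < 1 + t `^ s by rewrite ltr_pwDl // powR_ge0.
have dF (t : R) : 0 < t -> is_derive t 1 F (t `^ (s - 1) / (1 + t `^ s) ^+ 2).
  move=> t0; have d1 := is_derive1_powR s t0.
  have d2 : is_derive t 1 (fun t : R => 1 + t `^ s) (0 + s * t `^ (s - 1)) by exact: is_deriveD.
  have d3 := @is_deriveV _ _ t _ 1 (lt0r_neq0 (D0 t)) d2.
  have H := @is_deriveZ _ _ _ _ (- s^-1) t 1 _ d3.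
  apply: (is_derive_eq H); rewrite /GRing.scale /=.
  by field; rewrite !gt_eqF.
rewrite (@ge0_continuous_FTC2y R _ F d 0).
- rewrite -EFinB lee_fin sub0r /F mulNr opprK ger_pMr ?invr_gt0 // invf_le1 // lerDl powR_ge0 //.
- by move=> w dw; rewrite divr_ge0 ?powR_ge0 // sqr_ge0.
- apply/continuous_within_itvcyP.
  have c (w : R) : 0 < w -> {for w, continuous (fun t : R => t `^ (s - 1) / (1 + t `^ s) ^+ 2)}.
    by move=> w0; apply: Gamma_majorant_cont; rewrite in_itv /= w0.
  split; first by move=> w; rewrite in_itv /= andbT => h; apply: c; exact: lt_trans h.
  by apply: cvg_at_right_filter; exact: c.
- have H : (fun t : R => t `^ (- s) * - s^-1) x @[x --> +oo%R] --> (0 * - s^-1 : R).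
    by apply: cvgM; [apply: powR_cvgy0; rewrite oppr_lt0|exact: cvg_cst].
  rewrite mul0r in H.
  apply/cvgrPdist_le => e e0; move/cvgrPdist_le : H => /(_ _ e0) H.
  near=> t; have t0 : 0 < t by near: t; exact: nbhs_pinfty_gt.
  have : `|0 - t `^ (- s) * - s^-1| <= e by near: t.
  rewrite !sub0r !normrN normrM ger0_norm ?powR_ge0 // /F normrM mulrC.
  apply: le_trans; rewrite ler_wpM2l // gtr0_norm ?invr_gt0 // powRN lef_pV2 ?posrE ?powR_gt0 //.
  by rewrite lerDr.
- by move=> w h; have /dF H : 0 < w by [exact: lt_trans h]; exact: ex_derive.
- by apply: cvg_at_right_filter; apply: differentiable_continuous; apply/derivable1_diffP; have H := dF _ d0; exact: ex_derive.
- move=> w; rewrite in_itv /= andbT => h; rewrite derive1E.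
  by have /dF H : 0 < w by [exact: lt_trans h]; exact: derive_val.
Unshelve. all: end_near.
Qed.

Lemma Gamma_integrand_cont s : {in `]0, +oo[, continuous (fun t : R => t `^ (s - 1) * expR (- t))}.
Proof.
move=> t; rewrite in_itv /= andbT => t0; apply: cvgM; first exact: powR_cont.
by apply: (@continuous_comp _ _ _ -%R (@expR R)); [exact: opp_continuous|exact: continuous_expR].
Qed.

Lemma Gamma_integrand_ge0 s (t : R) : 0 < t -> 0 <= t `^ (s - 1) * expR (- t).
Proof. by move=> _; rewrite mulr_ge0 ?powR_ge0 // expR_ge0. Qed.

(** Finiteness: as a real-valued integral, [Gamma s] would otherwise be a dummy
    value. *)
Lemma Gamma_fin s : 0 < s -> (\int[leb]_(t in `]0%R, +oo[) (t `^ (s - 1) * expR (- t))%:E)%E = (Gamma s)%:E.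
Proof.
move=> s0; have [C C0 hC] := Gamma_dominated s0.
have ge0 (A : set R) : A `<=` `]0, +oo[ -> (0 <= \int[leb]_(t in A) (t `^ (s - 1) * expR (- t))%:E)%E.
  by move=> hA; apply: integral_ge0 => t /hA; rewrite /= in_itv /= andbT => t0; rewrite lee_fin Gamma_integrand_ge0.
rewrite /Gamma /Rintegral fineK // ge0_fin_numE; last exact: ge0.
apply: (@le_lt_trans _ _ (C * s^-1)%:E); last exact: ltry.
have L := half_line_lim ltr01 (@Gamma_integrand_ge0 s) (@Gamma_integrand_cont s).
rewrite -(cvg_lim (@ereal_hausdorff R) L); apply: lime_le; first by apply/cvg_ex; eexists; exact: L.
apply: nearW => n; rewrite mul1r; have n0 : 0 < n.+1%:R^-1 :> R by rewrite invr_gt0.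
have sub : `[n.+1%:R^-1, +oo[ `<=` (`]0, +oo[ : set R).
  by move=> x /=; rewrite !in_itv /= !andbT; apply: lt_le_trans.
have mM : measurable_fun (`[n.+1%:R^-1, +oo[ : set R) (fun t : R => t `^ (s - 1) / (1 + t `^ s) ^+ 2).
  by apply: measurable_funS sub _ => //; apply: half_line_meas; exact: Gamma_majorant_cont.
apply: (@le_trans _ _ (\int[leb]_(t in `[n.+1%:R^-1%R, +oo[) (C * (t `^ (s - 1) / (1 + t `^ s) ^+ 2))%:E)%E).
  apply: ge0_le_integral => //.
  - by move=> t /sub; rewrite /= in_itv /= andbT => t0; rewrite lee_fin Gamma_integrand_ge0.
  - apply/measurable_EFinP; apply: (measurable_funS _ sub) => //.
    by apply: half_line_meas; exact: Gamma_integrand_cont.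
  - by apply/measurable_EFinP; exact: measurable_funM.
  - by move=> t /sub; rewrite /= in_itv /= andbT => t0; rewrite lee_fin hC.
rewrite ge0_integral_scale ?(ltW C0) //; last first.
  by move=> t _; rewrite divr_ge0 ?powR_ge0 // sqr_ge0.
by rewrite EFinM lee_pmul2l //; exact: Gamma_majorant.
Qed.

Lemma Gamma_gt0 s : 0 < s -> 0 < Gamma s.
Proof.
move=> s0; rewrite -lte_fin -Gamma_fin //.
pose c : R := 2^-1 * expR (- 2).
have c0 : 0 < c by rewrite mulr_gt0 // expR_gt0.
have sub : `[1, 2] `<=` (`]0, +oo[ : set R).
  by move=> t /=; rewrite !in_itv /= andbT => /andP[t1 _]; exact: lt_le_trans t1.
have mG := half_line_meas (@Gamma_integrand_cont s).
apply: (@lt_le_trans _ _ (\int[leb]_(t in `[1%R, 2%R]) c%:E)%E).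
  rewrite integral_cst //= lebesgue_measure_itv /= lte_fin ltr1n /= -EFinB -EFinM lte_fin mulr_gt0 // subr_gt0 ltr1n.
apply: (@le_trans _ _ (\int[leb]_(t in `[1%R, 2%R]) (t `^ (s - 1) * expR (- t))%:E)%E).
  apply: ge0_le_integral => //.
  - by move=> t _; rewrite lee_fin ltW.
  - by apply/measurable_EFinP; exact: (measurable_funS _ sub).
  - move=> t /=; rewrite in_itv /= => /andP[t1 t2]; rewrite lee_fin.
    have t0 : 0 < t by exact: lt_le_trans t1.
    apply: ler_pM; rewrite ?expR_ge0 ?invr_ge0 //; last by rewrite ler_expR lerN2.
    apply: (@le_trans _ _ (t `^ (-1))); last by rewrite ler_powR // lerBrDr addrC subrr ltW.
    by rewrite powR_inv1 ?(ltW t0) // lef_pV2 ?posrE //; exact: t0.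
apply: ge0_subset_integral => //; first exact/measurable_EFinP.
by move=> t /=; rewrite in_itv /= andbT => t0; rewrite lee_fin Gamma_integrand_ge0.
Qed.

Lemma measurable_gauss_scaled (t : R) (D : set R) : measurable_fun D (fun w : R => expR (- (t * w ^+ 2))).
Proof.
apply: measurable_funTS; apply: measurableT_comp => //.
by apply: measurableT_comp => //; apply: measurable_funM => //; exact: measurable_funX.
Qed.

Lemma gauss_scaled (t : R) : 0 < t ->
  (\int[leb]_(w in `]0%R, +oo[) (expR (- (t * w ^+ 2)))%:E = (Num.sqrt pi / 2 * t `^ (- 2^-1))%:E)%E.
Proof.
move=> t0; pose c := t `^ (2^-1); have c0 : 0 < c by rewrite powR_gt0.
have cc : c ^+ 2 = t by rewrite /c powR12_sqrt ?(ltW t0) // sqr_sqrtr // ltW.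
have H : (\int[leb]_(w in `]0%R, +oo[) (gauss_fun w)%:E = (Num.sqrt pi / 2)%:E)%E.
  rewrite -integral0y_gauss integral_itv_obnd_cbnd //.
  by apply/measurable_EFinP; apply: measurable_funTS; exact: measurable_gauss_fun.
rewrite (dilation c0) in H; last 2 first.
- by move=> x _; exact: gauss_fun_ge0.
- by move=> x _; exact: continuous_gauss_fun.
have E : (\int[leb]_(w in `]0%R, +oo[) (c * gauss_fun (c * w))%:E =
    c%:E * \int[leb]_(w in `]0%R, +oo[) (expR (- (t * w ^+ 2)))%:E)%E.
  have mh := @measurable_gauss_scaled t `]0, +oo[.
  have S := @ge0_integral_scale `]0, +oo[ _ c _ mh (fun w _ => expR_ge0 _) (ltW c0).
  apply: (eq_trans _ (S (measurable_itv _))); apply: eq_integral => w _; by rewrite /gauss_fun exprMn cc.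
rewrite E in H.
rewrite (scaled_EFin c0 H); congr EFin; rewrite powRN -/c; ring.
Qed.

Lemma Gamma_scaled s (k : R) : 0 < s -> 0 < k ->
  (\int[leb]_(t in `]0%R, +oo[) (t `^ (s - 1) * expR (- (k * t)))%:E = (Gamma s * k `^ (- s))%:E)%E.
Proof.
move=> s0 k0; have H := Gamma_fin s0.
rewrite (dilation k0) in H; last 2 first.
- exact: Gamma_integrand_ge0.
- exact: Gamma_integrand_cont.
have E : (\int[leb]_(t in `]0%R, +oo[) (k * ((k * t) `^ (s - 1) * expR (- (k * t))))%:E =
    (k `^ s)%:E * \int[leb]_(t in `]0%R, +oo[) (t `^ (s - 1) * expR (- (k * t)))%:E)%E.
  have mh : measurable_fun (`]0, +oo[ : set R) (fun t => t `^ (s - 1) * expR (- (k * t))).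
    apply: measurable_funM; first by apply: measurable_funTS; exact: measurable_powR.
    by apply: measurable_funTS; apply: measurableT_comp => //; apply: measurableT_comp => //; exact: measurable_funM.
  have h0 (t : R) : `]0, +oo[%classic t -> 0 <= t `^ (s - 1) * expR (- (k * t)).
    by move=> _; rewrite mulr_ge0 ?powR_ge0 ?expR_ge0.
  have S := @ge0_integral_scale `]0, +oo[ _ (k `^ s) _ mh h0 (powR_ge0 _ _).
  apply: (eq_trans _ (S (measurable_itv _))); apply: eq_integral => t; rewrite inE /= in_itv /= andbT => t0; congr EFin.
  by rewrite powRM ?(ltW k0) ?(ltW t0) // !mulrA mulr_powRB1 // ltW.
rewrite E in H; have ks : 0 < k `^ s by rewrite powR_gt0.
rewrite (scaled_EFin ks H); congr EFin; rewrite powRN; ring.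
Qed.

Lemma gauss_layer s (t : R) : 0 < t ->
  (\int[leb]_(x in `]0%R, +oo[) (t `^ (s - 1) * expR (- (t * (1 + x ^+ 2))))%:E =
    (Num.sqrt pi / 2 * (t `^ (s - 2^-1 - 1) * expR (- t)))%:E)%E.
Proof.
move=> t0; have mgs := @measurable_gauss_scaled t `]0, +oo[.
have c0 : 0 <= t `^ (s - 1) * expR (- t) by rewrite mulr_ge0 ?powR_ge0 ?expR_ge0.
have S2 := ge0_integral_scale (measurable_itv _) mgs (fun w _ => expR_ge0 _) c0.
transitivity (\int[leb]_(w in `]0%R, +oo[) (t `^ (s - 1) * expR (- t) * expR (- (t * w ^+ 2)))%:E)%E.
  by apply: eq_integral => w _; rewrite -mulrA -expRD mulrDr mulr1 opprD.
rewrite S2 gauss_scaled // -EFinM; congr EFin.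
have -> : s - 2^-1 - 1 = (s - 1) + - 2^-1 by ring.
rewrite [t `^ (s - 1 + - 2^-1)]powRD; first by ring.
by apply/implyP => _; rewrite gt_eqF.
Qed.

Lemma integral_indic_mul (D : set R) (g : R -> R) :
  (\int[leb]_x (\1_D x * g x)%:E = \int[leb]_(x in D) (g x)%:E)%E.
Proof.
rewrite [RHS]integral_mkcond; apply: eq_integral => x _.
by rewrite patchE indicE; case: ifP => _; rewrite ?mul1r ?mul0r.
Qed.

(** Both sides of the identity, multiplied by [Gamma s], are the integral of
    [t ^ (s - 1) exp (- t (1 + w ^ 2))] over the quadrant, computed in the two
    possible orders. *)
Lemma half_line_beta s : 2^-1 < s ->
  (\int[leb]_(w in `]0%R, +oo[) ((1 + w ^+ 2) `^ (- s))%:E =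
   (Num.sqrt pi / 2 * Gamma (s - 2^-1) / Gamma s)%:E)%E.
Proof.
move=> s2; have s0 : 0 < s by apply: lt_trans s2; rewrite invr_gt0.
have s20 : 0 < s - 2^-1 by rewrite subr_gt0.
have G0 := Gamma_gt0 s0.
pose D : set R := `]0, +oo[%classic.
pose h (w t : R) : R := \1_D w * (\1_D t * (t `^ (s - 1) * expR (- (t * (1 + w ^+ 2))))).
have h0 w t : 0 <= h w t by rewrite !mulr_ge0 ?powR_ge0 ?expR_ge0.
have mD : measurable D by exact: measurable_itv.
have k0 (w : R) : 0 < 1 + w ^+ 2 by rewrite ltr_pwDl // sqr_ge0.
have mi : measurable_fun [set: R] (\1_D : R -> R) by exact: measurable_indic.
have mh : measurable_fun [set: R * R] (fun z => (h z.1 z.2)%:E).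
  apply/measurable_EFinP; apply: measurable_funM; first exact: (measurableT_comp mi measurable_fst).
  apply: measurable_funM; first exact: (measurableT_comp mi measurable_snd).
  apply: measurable_funM; first by apply: (measurableT_comp (measurable_powR _)).
  apply: measurableT_comp => //; apply: measurableT_comp => //; apply: measurable_funM => //.
  by apply: measurable_funD => //; apply: measurable_funX.
have T := @fubini_tonelli _ _ _ _ R leb leb _ mh (fun z => h0 z.1 z.2).
have mb : measurable_fun D (fun w : R => (1 + w ^+ 2) `^ (- s)).
  apply: measurable_funTS; apply: (measurableT_comp (measurable_powR _)).
  by apply: measurable_funD => //; exact: measurable_funX.
have L : (\int[leb]_w \int[leb]_t (h w t)%:E = (Gamma s)%:E * \int[leb]_(w in D) ((1 + w ^+ 2) `^ (- s))%:E)%E.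
  have S := @ge0_integral_scale D _ (Gamma s) mD mb (fun w _ => powR_ge0 _ _) (ltW G0).
  rewrite -S -integral_indic_mul; apply: eq_integral => w _; rewrite /h.
  have [wD|wD] := boolP (w \in D); last first.
    by rewrite indicE (negPf wD) mul0r; under eq_integral do rewrite mul0r; exact: integral0.
  rewrite indicE wD mul1r; under eq_integral do rewrite mul1r.
  rewrite integral_indic_mul; apply: (eq_trans _ (Gamma_scaled s0 (k0 w))).
  by apply: eq_integral => t _; rewrite [t * _]mulrC.
have Rr : (\int[leb]_t \int[leb]_w (h w t)%:E = (Num.sqrt pi / 2 * Gamma (s - 2^-1))%:E)%E.
  have mg : measurable_fun D (fun t : R => t `^ (s - 2^-1 - 1) * expR (- t)).
    exact: half_line_meas (@Gamma_integrand_cont _).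
  have g0 (t : R) : D t -> 0 <= t `^ (s - 2^-1 - 1) * expR (- t) by move=> _; rewrite mulr_ge0 ?powR_ge0 ?expR_ge0.
  have p0 : 0 <= Num.sqrt pi / 2 :> R by rewrite divr_ge0 // sqrtr_ge0.
  have S := @ge0_integral_scale D _ _ mD mg g0 p0.
  have S' : (\int[leb]_(t in D) (Num.sqrt pi / 2 * (t `^ (s - 2^-1 - 1) * expR (- t)))%:E = (Num.sqrt pi / 2 * Gamma (s - 2^-1))%:E)%E.
    by apply: (eq_trans S); rewrite (Gamma_fin s20) -EFinM.
  rewrite -S' -integral_indic_mul.
  - apply: eq_integral => t _; rewrite /h.
    have [tD|tD] := boolP (t \in D); last first.
      rewrite indicE (negPf tD) mul0r; under eq_integral do rewrite mul0r mulr0; exact: integral0.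
    rewrite indicE tD mul1r; under eq_integral do rewrite mul1r.
    rewrite integral_indic_mul.
    by move: tD; rewrite inE /D /= in_itv /= andbT => t0; exact: gauss_layer.
rewrite (scaled_EFin G0 (etrans (esym L) (etrans T Rr))); congr EFin; exact: mulrC.
Qed.

End HalfLine.

(** * Integrals that become singular at the edge *)

Section EdgeIntegral.
Context {R : realType}.
Local Notation leb := (@lebesgue_measure R).
Implicit Types (th e v x : R) (m : nat).

(** The monomial [r^m t^(- th)] with [t = v^2 + e] and [r = v^2 / t]. *)
Definition edge_kernel m th e v : R := (v ^+ 2 / (v ^+ 2 + e)) ^+ m * (v ^+ 2 + e) `^ (- th).

Definition edge_int m th v1 e : R := \int[leb]_(v in `[0, v1]) edge_kernel m th e v.

Lemma sqr_pos e v : 0 < e -> 0 < v ^+ 2 + e.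
Proof. by move=> e0; rewrite ltr_wpDl // sqr_ge0. Qed.

Lemma edge_ratio e v : 0 < e -> 0 <= v ^+ 2 / (v ^+ 2 + e) <= 1.
Proof.
move=> e0; have h := sqr_pos v e0.
by rewrite divr_ge0 ?sqr_ge0 ?(ltW h) //= ler_pdivrMr // mul1r lerDl ltW.
Qed.

Lemma edge_kernel_ge0 m th e v : 0 < e -> 0 <= edge_kernel m th e v.
Proof. by move=> e0; have /andP[h _] := edge_ratio v e0; rewrite mulr_ge0 ?powR_ge0 // exprn_ge0. Qed.

Lemma edge_kernel_le m th e v : 0 < e -> edge_kernel m th e v <= (v ^+ 2 + e) `^ (- th).
Proof.
move=> e0; have /andP[h0 h1] := edge_ratio v e0.
by rewrite ger_pMl ?powR_gt0 ?sqr_pos // exprn_ile1.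
Qed.

Lemma edge_kernel_cont m th e : 0 < e -> continuous (edge_kernel m th e).
Proof.
move=> e0 v; have h := sqr_pos v e0.
have c2 : {for v, continuous (fun w : R => w ^+ 2)} by exact: exprn_continuous.
have c1 : {for v, continuous (fun w : R => w ^+ 2 + e)} by apply: cvgD => //; exact: cvg_cst.
apply: cvgM.
  apply: (@continuous_comp _ _ _ (fun w : R => w ^+ 2 / (w ^+ 2 + e)) (fun y : R => y ^+ m)); last exact: exprn_continuous.
  by apply: cvgM => //; apply: cvgV => //; rewrite gt_eqF.
apply: (@continuous_comp _ _ _ (fun w : R => w ^+ 2 + e) (fun y : R => y `^ (- th))) => //.
exact: powR_cont.
Qed.

Lemma edge_kernel_fin m th : 2^-1 < th ->
  (\int[leb]_(v in `]0%R, +oo[) (edge_kernel m th 1 v)%:E \is a fin_num)%E.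
Proof.
move=> th2; rewrite ge0_fin_numE; last by apply: integral_ge0 => v _; rewrite lee_fin edge_kernel_ge0.
have := half_line_beta th2; set y := (X in X%:E) => H.
apply: (@le_lt_trans _ _ y%:E); last exact: ltry.
rewrite -H; apply: ge0_le_integral => //.
- by move=> v _; rewrite lee_fin edge_kernel_ge0.
- by apply/measurable_EFinP; apply: measurable_funTS; apply: continuous_measurable_fun; exact: edge_kernel_cont.
- apply/measurable_EFinP; apply: measurable_funTS; apply: (measurableT_comp (measurable_powR _)).
  by apply: measurable_funD => //; exact: measurable_funX.
- by move=> v _; rewrite lee_fin addrC edge_kernel_le.
Qed.

Definition edge_coef m th : R := fine (\int[leb]_(v in `]0%R, +oo[) (edge_kernel m th 1 v)%:E)%E.

Lemma edge_coef0 th : 2^-1 < th -> edge_coef 0 th = Num.sqrt pi / 2 * Gamma (th - 2^-1) / Gamma th.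
Proof.
move=> th2; rewrite /edge_coef -[RHS](congr1 fine (half_line_beta th2)); congr fine.
by apply: eq_integral => v _; rewrite /edge_kernel expr0 mul1r addrC.
Qed.

Lemma edge_kernel_scale m th e v : 0 < e -> 
  Num.sqrt e * edge_kernel m th e (Num.sqrt e * v) = e `^ (2^-1 - th) * edge_kernel m th 1 v.
Proof.
move=> e0; rewrite /edge_kernel [(_ * v) ^+ 2]exprMn sqr_sqrtr ?(ltW e0) //.
have -> : e * v ^+ 2 + e = e * (v ^+ 2 + 1) by ring.
rewrite powRM ?(ltW e0) ?(ltW (sqr_pos _ _)) // -powR12_sqrt ?(ltW e0) //.
rewrite powRD; last by apply/implyP => _; rewrite gt_eqF.
rewrite -mulf_div divff ?gt_eqF // mul1r; ring.
Qed.

Lemma edge_kernel_total m th e : 2^-1 < th -> 0 < e ->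
  (\int[leb]_(v in `]0%R, +oo[) (edge_kernel m th e v)%:E = (edge_coef m th * e `^ (2^-1 - th))%:E)%E.
Proof.
move=> th2 e0; have s0 : 0 < Num.sqrt e by rewrite sqrtr_gt0.
rewrite (dilation s0); last 2 first.
- by move=> v _; exact: edge_kernel_ge0.
- by move=> v _; exact: edge_kernel_cont.
have mk : measurable_fun (`]0, +oo[ : set R) (edge_kernel m th 1).
  by apply: measurable_funTS; apply: continuous_measurable_fun; exact: edge_kernel_cont.
have S := ge0_integral_scale (measurable_itv _) mk (fun v _ => edge_kernel_ge0 _ _ v ltr01) (powR_ge0 e (2^-1 - th)).
transitivity (\int[leb]_(v in `]0%R, +oo[) (e `^ (2^-1 - th) * edge_kernel m th 1 v)%:E)%E.
  by apply: eq_integral => v _; rewrite edge_kernel_scale.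
rewrite S mulrC EFinM; congr (_ * _)%E; rewrite /edge_coef fineK //; exact: edge_kernel_fin.
Qed.

(** The integral over the whole half-line scales exactly like [e^(1/2 - th)];
    the tail beyond [v1] is bounded, uniformly in [e], by that of [v^(-2 th)]. *)
Lemma edge_int_singular m th v1 : 2^-1 < th -> 0 < v1 ->
  exists C : R, forall e, 0 < e -> `|edge_int m th v1 e - edge_coef m th * e `^ (2^-1 - th)| <= C.
Proof.
move=> th2 v10; exists (v1 `^ (1 - 2 * th) / (2 * th - 1)) => e e0.
have T := edge_kernel_total m th2 e0.
have ck : continuous (edge_kernel m th e) by exact: edge_kernel_cont.
have mk : measurable_fun [set: R] (edge_kernel m th e) by exact: continuous_measurable_fun.
have k0 v : (0 <= (edge_kernel m th e v)%:E)%E by rewrite lee_fin edge_kernel_ge0.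
have U : `]0, +oo[%classic = `]0, v1] `|` `]v1, +oo[ :> set R.
  apply/seteqP; split => x /=; rewrite !in_itv /= ?andbT.
    by move=> x0; have [h|h] := leP x v1; [left; rewrite x0|right].
  by move=> [/andP[]//|]; apply: lt_trans.
have mU : measurable_fun (`]0, v1] `|` `]v1, +oo[ : set R) (fun v => (edge_kernel m th e v)%:E).
  by apply/measurable_EFinP; exact: measurable_funTS.
have dU : [disjoint (`]0, v1] : set R) & `]v1, +oo[].
  apply/disj_setPS => x /= []; rewrite !in_itv /= andbT => /andP[_ h1] h2.
  by move: (le_lt_trans h1 h2); rewrite ltxx.
have T2 := ge0_integral_setU leb (measurable_itv _) (measurable_itv _) mU (fun v _ => k0 v) dU.
rewrite U in T; have {}T := etrans (esym T2) T.
have J : (\int[leb]_(v in `]0%R, v1]) (edge_kernel m th e v)%:E = (edge_int m th v1 e)%:E)%E.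
  rewrite /edge_int /Rintegral fineK; last by apply: integrable_fin_num => //; exact: cont_integrable_itv.
  by rewrite -integral_itv_obnd_cbnd //; apply/measurable_EFinP; exact: measurable_funTS.
have tl : (\int[leb]_(v in `]v1, +oo[) (edge_kernel m th e v)%:E <= (v1 `^ (1 - 2 * th) / (2 * th - 1))%:E)%E.
  have p1 : 1 < 2 * th by lra.
  rewrite -(powR_tail p1 v10) -[leRHS]integral_itv_obnd_cbnd; last first.
    by apply/measurable_EFinP; apply: measurable_funTS; exact: measurable_powR.
  apply: ge0_le_integral => //.
  - by apply/measurable_EFinP; exact: measurable_funTS.
  - by apply/measurable_EFinP; apply: measurable_funTS; exact: measurable_powR.
  - move=> v /=; rewrite in_itv /= andbT => h; have v0 : 0 < v by exact: lt_trans h.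
    rewrite lee_fin; apply: le_trans (edge_kernel_le _ _ _ e0) _.
    rewrite -mulrN powRrM powR_mulrn ?(ltW v0) //; apply: powR_neg_le; rewrite ?exprn_gt0 ?lerDl ?ltW //.
    by apply: lt_trans th2; rewrite invr_gt0.
have tl0 : (0 <= \int[leb]_(v in `]v1, +oo[) (edge_kernel m th e v)%:E)%E by apply: integral_ge0 => v _; exact: k0.
move: T tl tl0; rewrite J; set Y := (\int[leb]_(v in `]v1, +oo[) _)%E.
case: Y => [y| |] //; rewrite -EFinD !lee_fin => -[E] y1 y0.
by rewrite -E opprD addrA subrr sub0r normrN ger0_norm.
Qed.

(** The kernel is at most a multiple of [1 / (v + sqrt e)], whose integral is
    a logarithm. *)
Lemma edge_int_mild m th v1 : th <= 2^-1 -> 0 < v1 ->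
  exists C : R, forall e, 0 < e -> e < expR (-1) -> `|edge_int m th v1 e| <= C * ln e^-1.
Proof.
move=> th2 v10; pose C1 := (v1 ^+ 2 + 1) `^ (2^-1 - th).
have C10 : 0 <= C1 by exact: powR_ge0.
exists (2 * C1 * (`|ln (v1 + 1)| + 1)) => e e0 e1.
have se0 : 0 < Num.sqrt e by rewrite sqrtr_gt0.
have e1' : e <= 1 by apply: ltW; apply: lt_le_trans e1 _; rewrite -expR0 ler_expR oppr_le0.
have se1 : Num.sqrt e <= 1 by rewrite -sqrtr1 ler_wsqrtr.
pose g v : R := (v + Num.sqrt e)^-1.
have gpos v : 0 <= v -> 0 < v + Num.sqrt e by move=> v0; rewrite ltr_wpDl.
have gc : {within `[0, v1], continuous g}.
  apply: continuous_in_subspaceT => v; rewrite inE /= in_itv /= => /andP[v0 _].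
  apply: cvgV; first by rewrite gt_eqF // gpos.
  by apply: cvgD => //; exact: cvg_cst.
pose G v : R := ln (v + Num.sqrt e).
have dG v : 0 <= v -> is_derive v 1 G (g v).
  move=> v0.
  have d1 : is_derive v 1 (fun w : R => w + Num.sqrt e) 1.
    by apply: is_derive_eq; rewrite addr0.
  have d2 : is_derive (v + Num.sqrt e) 1 (@ln R) (v + Num.sqrt e)^-1 by apply: is_derive1_ln; exact: gpos.
  have H := @is_derive1_comp _ (@ln R) (fun w : R => w + Num.sqrt e) _ _ _ d2 d1.
  by apply: (is_derive_eq H); rewrite mulr1.
have contG v : 0 <= v -> {for v, continuous G}.
  by move=> v0; apply: differentiable_continuous; apply/derivable1_diffP; have H := dG _ v0; exact: ex_derive.
have IG : (\int[leb]_(v in `[0%R, v1]) (g v)%:E = (G v1 - G 0)%:E)%E.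
  rewrite (@continuous_FTC2 R g G 0 v1) ?EFinB //.
  - split.
    + by move=> v; rewrite in_itv /= => /andP[/ltW /dG H _]; exact: ex_derive.
    + by apply: cvg_at_right_filter; exact: contG.
    + by apply: cvg_at_left_filter; apply: contG; exact: ltW.
  - by move=> v; rewrite in_itv /= => /andP[/ltW /dG H _]; rewrite derive1E; exact: derive_val.
have ck : continuous (edge_kernel m th e) by exact: edge_kernel_cont.
have J0 : 0 <= edge_int m th v1 e by apply: Rintegral_ge0 => v _; exact: edge_kernel_ge0.
rewrite ger0_norm // -lee_fin.
have -> : (edge_int m th v1 e)%:E = (\int[leb]_(v in `[0%R, v1]) (edge_kernel m th e v)%:E)%E.
  by rewrite /edge_int /Rintegral fineK //; apply: integrable_fin_num => //; exact: cont_integrable_itv.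
have mg : measurable_fun (`[0, v1] : set R) g by apply: subspace_continuous_measurable_fun.
have kg v : 0 <= v <= v1 -> edge_kernel m th e v <= 2 * C1 * g v.
  move=> /andP[v0 vv]; apply: le_trans (edge_kernel_le _ _ _ e0) _.
  have h := sqr_pos v e0.
  have -> : - th = (2^-1 - th) + - 2^-1 by ring.
  rewrite powRD; last by apply/implyP => _; rewrite gt_eqF.
  rewrite [2 * C1]mulrC -mulrA; apply: ler_pM; rewrite ?powR_ge0 //.
    apply: ge0_ler_powR; rewrite ?nnegrE ?subr_ge0 ?(ltW h) ?addr_ge0 ?sqr_ge0 //.
    by apply: lerD => //; rewrite ler_sqr ?nnegrE ?(ltW v10).
  rewrite powRN powR12_sqrt ?(ltW h) // -ler_pdivrMl // -invfM lef_pV2 ?posrE ?gpos ?mulr_gt0 ?sqrtr_gt0 //.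
  rewrite -(@ler_sqr _ (v + Num.sqrt e)) ?nnegrE ?(ltW (gpos _ v0)) ?mulr_ge0 ?sqrtr_ge0 //.
  rewrite exprMn sqr_sqrtr ?(ltW h) // sqrrD sqr_sqrtr ?(ltW e0) //.
  have := sqr_ge0 (v - Num.sqrt e); rewrite sqrrB sqr_sqrtr ?(ltW e0) // => hh; lra.
apply: (@le_trans _ _ (\int[leb]_(v in `[0%R, v1]) (2 * C1 * g v)%:E)%E).
  apply: ge0_le_integral => //.
  - by move=> v _; rewrite lee_fin edge_kernel_ge0.
  - by apply/measurable_EFinP; apply: measurable_funTS; exact: continuous_measurable_fun.
  - by apply/measurable_EFinP; apply: measurable_funM.
have g0 v : `[0, v1]%classic v -> 0 <= g v.
  by rewrite /= in_itv /= => /andP[v0 _]; rewrite invr_ge0 ltW // gpos.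
have S := ge0_integral_scale (measurable_itv _) mg g0 (mulr_ge0 (ler0n _ 2) C10).
rewrite S IG -EFinM lee_fin -[leRHS]mulrA ler_wpM2l ?mulr_ge0 //.
have L1 : 1 <= ln e^-1 by rewrite lnVp // lerNr -(expRK (-1)); apply: ln_mono => //; exact: ltW.
have l2 : G 0 = - (2^-1 * ln e^-1).
  by rewrite /G add0r -powR12_sqrt ?(ltW e0) // ln_powR lnVp // mulrN opprK.
have l3 : G v1 <= `|ln (v1 + 1)|.
  by apply: le_trans (ler_norm _); apply: ln_mono; [exact: gpos (ltW v10)|rewrite lerD2l].
have l4 := normr_ge0 (ln (v1 + 1)).
rewrite l2; nra.
Qed.

End EdgeIntegral.

(** * The growth product as an integral *)

Section WeightedCount.
Context {R : realType}.
Implicit Types (bet C r t d v : R) (s : seq (R * nat * R)).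

Definition weight v : R := (1 + v ^+ 2 / 4) `^ (- 2^-1).

Lemma weight_arg v : 1 <= 1 + v ^+ 2 / 4.
Proof. by rewrite lerDl divr_ge0 // sqr_ge0. Qed.

Lemma weight_ge0 v : 0 <= weight v. Proof. exact: powR_ge0. Qed.

Lemma weight_le1 v : weight v <= 1.
Proof.
have h := weight_arg v; rewrite /weight powRN invf_le1 ?powR_gt0 //; last lra.
by apply: (@le_trans _ _ ((1 + v ^+ 2 / 4) `^ 0)); [rewrite powRr0|rewrite ler_powR // invr_ge0].
Qed.

Lemma weight_cont : continuous weight.
Proof.
move=> v; have h : 0 < 1 + v ^+ 2 / 4 by have := weight_arg v; lra.
apply: (@continuous_comp _ _ _ (fun w : R => 1 + w ^+ 2 / 4) (fun y : R => y `^ (- 2^-1))); last exact: powR_cont.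
apply: cvgD; first exact: cvg_cst.
by apply: cvgM; [exact: exprn_continuous|exact: cvg_cst].
Qed.

(** The density of [ln (mult (v ^ 2))] in the variable [v]. *)
Lemma is_derive_ln_root_mul v : 0 <= v -> is_derive v 1 (fun w => 2 * ln (root_mul w)) (weight v).
Proof.
move=> v0; have h : 0 < 1 + v ^+ 2 / 4 by have := weight_arg v; lra.
pose q := Num.sqrt (1 + v ^+ 2 / 4).
have q0 : 0 < q by rewrite sqrtr_gt0.
have rE : root_mul v = v / 2 + q by [].
have r0 : 0 < root_mul v by rewrite rE ltr_wpDl // divr_ge0.
have d1 : is_derive v 1 (fun w : R => 1 + w ^+ 2 / 4) (v / 2).
  by apply: is_derive_eq; rewrite /GRing.scale /=; field.
have d2 : is_derive (1 + v ^+ 2 / 4) 1 Num.sqrt (2 * q)^-1 by apply: is_derive1_sqrt.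
have d3 := @is_derive1_comp _ Num.sqrt (fun w : R => 1 + w ^+ 2 / 4) _ _ _ d2 d1.
have d4 : is_derive v 1 (fun w : R => w / 2) (2^-1).
  by apply: is_derive_eq; rewrite /GRing.scale /=; field.
have d5 : is_derive v 1 (@root_mul R) (2^-1 + (2 * q)^-1 * (v / 2)).
  exact: (@is_deriveD _ _ _ _ _ v 1 _ _ d4 d3).
have d6 : is_derive (root_mul v) 1 (@ln R) (root_mul v)^-1 by apply: is_derive1_ln.
have d7 := @is_derive1_comp _ (@ln R) (@root_mul R) _ _ _ d6 d5.
have H := @is_deriveZ _ _ _ _ (2 : R) v 1 _ d7.
apply: (is_derive_eq H); rewrite /GRing.scale /= /weight powRN powR12_sqrt ?(ltW h) // -/q rE.
by field; rewrite !gt_eqF // -mulr_natr; rewrite rE in r0; lra.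
Qed.

Lemma expansion_expands d M s : all (fun x => d <= x.2) s -> expands d M (expansion s).
Proof.
by move=> sd; exists s => //; exists 0, 1; split => // r t *; rewrite subrr normr0 mul0r.
Qed.

(** The weight is [(1 + r t / 4)^(-1/2)] in the variables [r] and [t], hence
    has itself an expansion. *)
Lemma weighted_count bet C Cst t0 d s : 0 < bet -> 0 < C -> 0 < d -> 0 <= Cst -> 0 < t0 ->
  all (fun x => d <= x.2) s ->
  exists s2 : seq (R * nat * R), exists C2 t2 d2 : R, [/\ 0 < d2, all (fun x => d2 <= x.2) s2, 0 <= C2, 0 < t2 & t2 <= t0 /\
  forall r t x, 0 <= r -> r <= 1 -> 0 < t -> t < t2 ->
    `|x - (C / t) `^ bet^-1 * (1 + expansion s r t)| <= Cst ->
    `|x * (1 + r * t / 4) `^ (- 2^-1) - (C / t) `^ bet^-1 * (1 + expansion s2 r t)| <= C2].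
Proof.
move=> b0 C0 d0 Cst0 t00 sd; pose M := bet^-1; pose dd := Num.min d (Num.min 1 M).
have M0 : 0 < M by rewrite invr_gt0.
have dd0 : 0 < dd by rewrite !lt_min d0 ltr01.
have ddM : dd <= M by rewrite !ge_min lexx !orbT.
have E1 : expands dd M (expansion s).
  by apply: expansion_expands; apply: sub_all sd => x; apply: le_trans; rewrite ge_min lexx.
have E2 : expands dd M (fun r t => r * t / 4).
  apply: (@expands_ext _ _ _ (expansion [:: (4^-1, 1%N, 1)])).
    by move=> r t t0'; rewrite /expansion big_seq1 /= expr1 powRr1 ?(ltW t0') //; ring.
  by apply: expansion_expands; rewrite /= andbT !ge_min lexx orbT.
have E3 := expands_pow (- 2^-1) dd0 ddM E2.
have E4 : expands dd M (fun r t => expansion s r t * ((1 + r * t / 4) `^ (- 2^-1) - 1)).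
  apply: expands_le (expandsM (ltW dd0) ddM (ltW dd0) ddM E1 E3) => //.
  by rewrite lerDl ltW.
have [s2 sd2 [C1 [t1 [C10 t10 t11 H]]]] := expandsD (expandsD E1 E3) E4.
exists s2, (Cst + C `^ M * C1), (Num.min t0 t1), dd; split => //.
- by rewrite addr_ge0 // mulr_ge0 ?powR_ge0.
- by rewrite lt_min t00.
split; first by rewrite ge_min lexx.
move=> r t x r0 r1 tp; rewrite lt_min => /andP[_ tt] hx.
have {}H := H r t r0 r1 tp tt.
set g := (1 + r * t / 4) `^ (- 2^-1) in H *.
have g0 : 0 <= g by exact: powR_ge0.
have a1 : 1 <= 1 + r * t / 4 by rewrite lerDl divr_ge0 ?mulr_ge0 // ltW.
have g1 : g <= 1.
  rewrite /g powRN invf_le1 ?powR_gt0 //; last lra.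
  by apply: (@le_trans _ _ ((1 + r * t / 4) `^ 0)); [rewrite powRr0|rewrite ler_powR // invr_ge0].
have -> : x * g - (C / t) `^ bet^-1 * (1 + expansion s2 r t) =
  g * (x - (C / t) `^ bet^-1 * (1 + expansion s r t)) +
  (C / t) `^ bet^-1 * (expansion s r t + (g - 1) + expansion s r t * (g - 1) - expansion s2 r t) by ring.
apply: le_trans (ler_normD _ _) _; apply: lerD.
  by rewrite normrM ger0_norm //; apply: le_trans hx; rewrite ler_piMl.
rewrite normrM ger0_norm ?powR_ge0 //.
apply: le_trans (ler_wpM2l (powR_ge0 _ _) H) _.
rewrite powRM ?invr_ge0 ?(ltW C0) ?(ltW tp) // powRV ?(ltW tp) // -mulrA ler_wpM2l ?powR_ge0 //.
by rewrite mulrCA powRN mulVf ?mulr1 // gt_eqF // powR_gt0.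
Qed.

End WeightedCount.

Section LogGrowth.
Context {R : realType}.
Local Notation leb := (@lebesgue_measure R).
Implicit Types (v d : R).

Definition below d v : R := (v ^+ 2 <= d)%R%:R.

Lemma belowE d v : 0 <= d -> below d v = \1_(`[- Num.sqrt d, Num.sqrt d]%classic : set R) v.
Proof.
move=> d0; rewrite /below indicE.
have -> // : (v ^+ 2 <= d)%R = (v \in (`[- Num.sqrt d, Num.sqrt d]%classic : set R)).
apply/idP/idP.
  move=> h; rewrite inE /= in_itv /= -ler_norml -sqrtr_sqr ler_wsqrtr //.
rewrite inE /= in_itv /= -ler_norml -sqrtr_sqr => h.
by have := sqr_mono (sqrtr_ge0 _) h; rewrite !sqr_sqrtr // sqr_ge0.
Qed.

Lemma below_weight_integrable (v1 d : R) : 0 <= d ->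
  leb.-integrable `[0, v1] (fun v => (below d v * weight v)%:E).
Proof.
move=> d0.
have mw : measurable_fun [set: R] (@weight R) by apply: continuous_measurable_fun; exact: weight_cont.
have mb : measurable_fun [set: R] (below d).
  rewrite (_ : below d = \1_(`[- Num.sqrt d, Num.sqrt d]%classic : set R)); last by apply/funext => v; exact: belowE.
  exact: measurable_indic.
apply: measurable_bounded_integrable => //.
- by rewrite /= lebesgue_measure_itv; case: ifP => _; rewrite ?ltry // -EFinB ltry.
- by apply: measurable_funTS; apply: measurable_funM.
exists 1; split => // M M1 v _; apply: le_trans (ltW M1).
rewrite normrM ger0_norm ?ler0n // ger0_norm ?weight_ge0 // -[leRHS]mulr1 ler_pM ?ler0n ?weight_ge0 ?weight_le1 //.
by rewrite /below; case: (_ <= d).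
Qed.

(** [ln (mult d)] is [2 ln (root_mul (sqrt d))], a primitive of the weight
    taken at [sqrt d]; the factor [below] cuts the integral there. *)
Lemma ln_mult_int v1 d : 0 <= v1 -> 0 <= d -> d <= v1 ^+ 2 ->
  ln (mult d) = \int[leb]_(v in `[0, v1]) (below d v * weight v).
Proof.
move=> v10 d0 dv.
have dv' : Num.sqrt d <= v1 by rewrite -[v1]ger0_norm // -sqrtr_sqr ler_wsqrtr.
have -> : \int[leb]_(v in `[0, v1]) (below d v * weight v) = \int[leb]_(v in `[0, Num.sqrt d]) weight v.
  have -> : `[0, Num.sqrt d]%classic = `[0, v1] `&` (`[- Num.sqrt d, Num.sqrt d] : set R).
    apply/seteqP; split => v /=; rewrite !in_itv /=.
      move=> /andP[h1 h2]; split; rewrite ?h1 ?h2 ?(le_trans h2 dv') //= andbT.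
      by rewrite (le_trans _ h1) // oppr_le0 sqrtr_ge0.
    by move=> [/andP[-> _] /andP[_ ->]].
  rewrite Rintegral_mkcondr; apply: eq_Rintegral => v _.
  by rewrite patchE belowE // indicE; case: ifP => _; rewrite ?mul1r ?mul0r.
have [->|dn0] := eqVneq d 0.
  by rewrite sqrtr0 set_itv1 Rintegral_set1 /mult sqrtr0 /root_mul mul0r expr0n mul0r addr0 add0r sqrtr1 expr1n ln1.
have s0 : 0 < Num.sqrt d by rewrite sqrtr_gt0 lt_def dn0.
have rp v : 0 <= v -> 0 < root_mul v by move=> /root_mulP[h _ _]; exact: lt_le_trans h.
pose F v : R := 2 * ln (root_mul v).
have cF v : 0 <= v -> {for v, continuous F}.
  move=> v0; apply: differentiable_continuous; apply/derivable1_diffP.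
  by have H := is_derive_ln_root_mul v0; exact: ex_derive.
rewrite /Rintegral (@continuous_FTC2 R (@weight R) F 0 (Num.sqrt d)) //=.
- rewrite /F (_ : root_mul 0 = 1); last by rewrite /root_mul mul0r expr0n mul0r addr0 add0r sqrtr1.
  by rewrite ln1 mulr0 subr0 /mult lnX2 // rp // sqrtr_ge0.
- exact: continuous_subspaceT (@weight_cont R).
- split.
  + by move=> v; rewrite in_itv /= => /andP[/ltW /is_derive_ln_root_mul H _]; exact: ex_derive.
  + by apply: cvg_at_right_filter; exact: cF.
  + by apply: cvg_at_left_filter; apply: cF; exact: ltW.
- by move=> v; rewrite in_itv /= => /andP[/ltW /is_derive_ln_root_mul H _]; rewrite derive1E; exact: derive_val.
Qed.

Lemma sum_ln_mult_int v1 (l : seq R) : 0 <= v1 -> (forall d, d \in l -> 0 <= d <= v1 ^+ 2) ->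
  leb.-integrable `[0, v1] (fun v => ((\sum_(d <- l) below d v) * weight v)%:E) /\
  \sum_(d <- l) ln (mult d) = \int[leb]_(v in `[0, v1]) ((\sum_(d <- l) below d v) * weight v).
Proof.
move=> v10; elim: l => [|d l IH] hl.
  have E : (fun v : R => (\sum_(d <- [::]) below d v) * weight v) = fun=> 0.
    by apply/funext => v; rewrite big_nil mul0r.
  split; last by rewrite big_nil /= E Rintegral_cst // mul0r.
  by rewrite [X in _.-integrable _ X](_ : _ = fun=> 0%E) ?integrable0 //; apply/funext => v; rewrite big_nil mul0r.
have [|I1 I2] := IH; first by move=> e el; apply: hl; rewrite in_cons el orbT.
have /andP[d0 dv] := hl d (mem_head _ _).
have I3 := below_weight_integrable v1 d0.
have E : (fun v : R => (\sum_(e <- d :: l) below e v) * weight v) =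
   (fun v => below d v * weight v + (\sum_(e <- l) below e v) * weight v).
  by apply/funext => v; rewrite big_cons mulrDl.
split.
  rewrite [X in _.-integrable _ X](_ : _ = (fun v => (below d v * weight v)%:E) \+ (fun v => ((\sum_(e <- l) below e v) * weight v)%:E))%E.
    exact: integrableD.
  by apply/funext => v /=; rewrite big_cons mulrDl EFinD.
rewrite E RintegralD // -I2 big_cons -(ln_mult_int v10 d0 dv) //.
Qed.

Lemma count_le (i m m' : nat) : (\sum_(i <= k < m.+1) (k <= m')%N = (minn m' m).+1 - i)%N.
Proof.
elim: m => [|m IH].
  by case: i => [|i]; [rewrite big_nat1|rewrite big_geq]; lia.
have [h|h] := leqP i m.+1; last by rewrite big_geq //; lia.
rewrite big_nat_recr //= IH; case: (leqP m.+1 m') => ?; lia.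
Qed.

Lemma count_near (i m m' : nat) : (m' <= m)%N ->
  `|\sum_(i <= k < m.+1) (k <= m')%N%:R - m'%:R| <= i.+1%:R :> R.
Proof.
move=> h; rewrite -natr_sum count_le (minn_idPl h).
rewrite ler_norml; apply/andP; split.
  rewrite lerBrDr addrC lerBlDr -natrD ler_nat; lia.
rewrite lerBlDr -natrD ler_nat; lia.
Qed.

Lemma affine_error (c J Q P S1 S2 L C' C : R) : `|J - Q * P| <= C' -> `|S1 - S2| <= C * L -> 1 <= L ->
  `|c * J + S1 - (c * Q * P + S2)| <= (`|c| * `|C'| + C) * L.
Proof.
move=> hJ hS L1.
have -> : c * J + S1 - (c * Q * P + S2) = c * (J - Q * P) + (S1 - S2) by ring.
apply: le_trans (ler_normD _ _) _; rewrite mulrDl; apply: lerD => //.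
rewrite normrM -mulrA ler_wpM2l //; apply: le_trans hJ _; apply: le_trans (ler_norm C') _.
by rewrite ler_peMr.
Qed.

(** Exponents [M - x.2 > 1/2] produce powers of [e], the others at most a
    logarithm. *)
Lemma edge_sum_asymptotics (M v1 : R) (l : seq (R * nat * R)) : 0 < v1 ->
  exists2 Cq : R, 0 <= Cq & forall e, 0 < e -> e < expR (-1) ->
  `|\sum_(x <- l) x.1.1 * edge_int x.1.2 (M - x.2) v1 e -
    \sum_(x <- l | (2^-1 < M - x.2)%R) x.1.1 * edge_coef x.1.2 (M - x.2) * e `^ (- (M - x.2 - 2^-1))| <= Cq * ln e^-1.
Proof.
move=> v10; elim: l => [|x l [C C0 IH]].
  by exists 0 => // e _ _; rewrite !big_nil subrr normr0 mul0r.
have L1 (e : R) : 0 < e -> e < expR (-1) -> 1 <= ln e^-1.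
  by move=> e0 e1; rewrite lnVp // lerNr -(expRK (-1)); apply: ln_mono => //; exact: ltW.
have [h|h] := ltP 2^-1 (M - x.2).
  have [C' hC'] := edge_int_singular x.1.2 h v10.
  exists (`|x.1.1| * `|C'| + C); first by rewrite addr_ge0 // mulr_ge0.
  move=> e e0 e1; rewrite !big_cons h.
  have := hC' e e0; rewrite (_ : 2^-1 - (M - x.2) = - (M - x.2 - 2^-1)); last by ring.
  by move=> hJ; apply: affine_error (IH e e0 e1) (L1 e e0 e1).
have [C' hC'] := edge_int_mild x.1.2 h v10.
exists (`|x.1.1| * `|C'| + C); first by rewrite addr_ge0 // mulr_ge0.
move=> e e0 e1; rewrite !big_cons (ltNge 2^-1) h /= -addrA.
apply: le_trans (ler_normD _ _) _; rewrite mulrDl; apply: lerD; last exact: IH.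
rewrite normrM -mulrA ler_wpM2l //; apply: le_trans (hC' e e0 e1) _.
by rewrite ler_wpM2r ?ler_norm // (le_trans ler01) // L1.
Qed.

Lemma edge_int_sum (M v1 e k : R) (l : seq (R * nat * R)) : 0 < e ->
  leb.-integrable `[0, v1] (EFin \o (fun v => \sum_(x <- l) k * (x.1.1 * edge_kernel x.1.2 (M - x.2) e v))) /\
  \int[leb]_(v in `[0, v1]) (\sum_(x <- l) k * (x.1.1 * edge_kernel x.1.2 (M - x.2) e v)) =
  k * \sum_(x <- l) x.1.1 * edge_int x.1.2 (M - x.2) v1 e.
Proof.
move=> e0; pose F (x : R * nat * R) (v : R) := k * (x.1.1 * edge_kernel x.1.2 (M - x.2) e v).
have cF x : continuous (F x).
  apply: contM; first exact: cst_continuous.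
  by apply: contM; [exact: cst_continuous|exact: edge_kernel_cont].
have cS (l' : seq (R * nat * R)) : continuous (fun v => \sum_(x <- l') F x v).
  elim: l' => [|x l' IH].
    by rewrite (_ : (fun v => _) = fun=> 0); [exact: cst_continuous|apply/funext => v; rewrite big_nil].
  rewrite (_ : (fun v => _) = fun v => F x v + \sum_(y <- l') F y v); first exact: contD.
  by apply/funext => v; rewrite big_cons.
have iI h : continuous h -> leb.-integrable `[0, v1] (EFin \o h) by exact: cont_integrable_itv.
split; first exact: iI.
elim: l => [|x l IH].
  rewrite big_nil mulr0 (_ : (fun v => _) = fun=> 0); last by apply/funext => v; rewrite big_nil.
  by rewrite Rintegral_cst // mul0r.
rewrite (_ : (fun v => _) = fun v => F x v + \sum_(y <- l) F y v); last by apply/funext => v; rewrite big_cons.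
rewrite RintegralD ?IH //; [|exact: iI|exact: iI].
rewrite big_cons mulrDr; congr (_ + _); rewrite /F.
have ck : continuous (edge_kernel x.1.2 (M - x.2) e) by exact: edge_kernel_cont.
rewrite RintegralZl //; last by apply: iI; apply: contM => //; exact: cst_continuous.
by rewrite RintegralZl //; exact: iI.
Qed.

Lemma kernel_expansion (M C e v : R) (s : seq (R * nat * R)) : 0 < C -> 0 < e ->
  (C / (v ^+ 2 + e)) `^ M * (1 + expansion s (v ^+ 2 / (v ^+ 2 + e)) (v ^+ 2 + e)) =
  \sum_(x <- (1, 0%N, 0) :: s) C `^ M * (x.1.1 * edge_kernel x.1.2 (M - x.2) e v).
Proof.
move=> C0 e0; have t0 := sqr_pos v e0; set t := v ^+ 2 + e in t0 *.
rewrite powRM ?invr_ge0 ?(ltW C0) ?(ltW t0) // powRV ?(ltW t0) // -mulrA -mulr_sumr; congr (_ * _).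
rewrite big_cons /= mul1r /edge_kernel expr0 mul1r subr0 mulrDr mulr1; congr (_ + _).
rewrite /expansion mulr_sumr; apply: eq_bigr => x _; rewrite -/t.
rewrite opprB [x.2 - M]addrC powRD; last by apply/implyP => _; rewrite gt_eqF.
ring.
Qed.

End LogGrowth.

(** * Asymptotics of the growth product *)

Section GrowthAsymptotics.
Context {R : realType}.
Local Notation leb := (@lebesgue_measure R).
Implicit Types (a b : nat -> R) (bet C K eps v : R).

Lemma ln_growth a b x N m : ln (growth a b x N m) = \sum_(d <- [seq gap a b x k | k <- index_iota N.+2 m.+1]) ln (mult d).
Proof.
rewrite /growth big_map; elim: (index_iota _ _) => [|k l IH]; first by rewrite !big_nil ln1.
rewrite !big_cons lnMp ?IH ?mult_gt0 //.
by elim: l {IH} => [|j l IH]; rewrite ?big_nil // big_cons mulr_gt0 ?mult_gt0.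
Qed.

Lemma gap_level a b N k eps v : edge_regular a b N -> (N <= k)%N ->
  (v ^+ 2 <= gap a b (2 - eps) k) = (v ^+ 2 + eps <= defect a b k + v ^+ 2 * (1 - a k)).
Proof.
move=> hab h; have [a0 _ _ _ _] := hab k h; have ak : 0 < a k by lra.
rewrite (gap_defect hab) // ler_pdivlMr // mulrBr mulr1; apply/idP/idP; lra.
Qed.

(** Since [k |-> W k + r t (1 - a k)] is nonincreasing, the indices above the
    level are those up to [m'], and [m' <= m] because at [m'] the gap is
    nonnegative. *)
Lemma levels_counted a b bet C K N1 N m eps v s Cst t0 : 0 < bet -> 0 < C -> (0 < N1)%N ->
  edge_regular a b N1 -> regular_levels (defect a b) (fun n => 1 - a n) bet C K N1 ->
  (N1 <= N)%N -> (N1 <= m)%N -> 0 < eps -> defect a b m.+1 < eps ->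
  (forall r t m', 0 <= r -> r <= 1 -> 0 < t -> t < t0 -> (N1 <= m')%N ->
    t <= defect a b m' + r * t * (1 - a m') -> defect a b m'.+1 + r * t * (1 - a m'.+1) < t ->
    `|m'%:R - (C / t) `^ bet^-1 * (1 + expansion s r t)| <= Cst) ->
  v ^+ 2 + eps < t0 -> v ^+ 2 + eps <= defect a b N1 ->
  exists2 m' : nat, `|m'%:R - (C / (v ^+ 2 + eps)) `^ bet^-1 * (1 + expansion s (v ^+ 2 / (v ^+ 2 + eps)) (v ^+ 2 + eps))| <= Cst &
  `|\sum_(d <- [seq gap a b (2 - eps) k | k <- index_iota N.+2 m.+1]) below d v - m'%:R| <= N.+3%:R.
Proof.
move=> b0 C0 N10 hab reg NN Nm e0 hm count tt0 tN.
have t0' := sqr_pos v e0; have /andP[r0 r1] := edge_ratio v e0.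
set t := v ^+ 2 + eps in tt0 tN t0' r0 r1 *; set r := v ^+ 2 / t in r0 r1 *.
have rt : r * t = v ^+ 2 by rewrite /r divfK // gt_eqF.
have [m' [h1 h2 h3]] := level_index b0 C0 N10 reg r0 r1 t0' tN.
exists m'; first exact: count.
have mono := level_mono reg r0 t0'.
have mono0 i j : (N1 <= i)%N -> (i <= j)%N -> defect a b j <= defect a b i.
  by move=> hi hj; have := level_mono reg (lexx 0) t0' hi hj; rewrite !mul0r !addr0.
rewrite big_map.
have E k : (N.+2 <= k < m.+1)%N -> below (gap a b (2 - eps) k) v = (k <= m')%N%:R.
  move=> /andP[hk _]; have Nk : (N1 <= k)%N by apply: leq_trans NN (leq_trans _ hk); rewrite ltnW.
  rewrite /below (gap_level _ _ hab Nk) -/t -rt; congr (nat_of_bool _)%:R.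
  case: (leqP k m') => hkm.
    by apply: le_trans h2 _; exact: mono.
  apply/negbTE; rewrite -ltNge; apply: le_lt_trans h3; apply: mono => //; exact: leqW.
rewrite (eq_big_nat _ _ E); apply: count_near.
rewrite leqNgt; apply/negP => mm.
have d1 : defect a b m' < eps by apply: le_lt_trans hm; apply: mono0 => //; exact: leqW.
have [a1 _ _ _ _] := hab m' h1.
have v0 := sqr_ge0 v.
move: h2; rewrite rt /t => h2; have : 0 <= v ^+ 2 * a m' by rewrite mulr_ge0 //; lra.
move: d1 h2; clear; lra.
Qed.

Lemma Rintegral_dist (f g : R -> R) (v1 K : R) : 0 <= v1 ->
  leb.-integrable `[0, v1] (EFin \o f) -> leb.-integrable `[0, v1] (EFin \o g) ->
  (forall v, 0 <= v -> v <= v1 -> `|f v - g v| <= K) ->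
  `|\int[leb]_(v in `[0, v1]) f v - \int[leb]_(v in `[0, v1]) g v| <= K * v1.
Proof.
move=> v10 If Ig fg; rewrite -RintegralB //.
have Ifg : leb.-integrable `[0, v1] (EFin \o (fun v => f v - g v)).
  rewrite (_ : EFin \o _ = (EFin \o f) \- (EFin \o g))%E; first exact: integrableB.
  by apply/funext => v /=; rewrite EFinB.
apply: le_trans (le_normr_Rintegral _ Ifg) _ => //.
have -> : K * v1 = \int[leb]_(v in `[0, v1]) K.
  rewrite Rintegral_cst //= lebesgue_measure_itv /= lte_fin; case: ltP => [_|h] /=; first by rewrite subr0.
  by rewrite (_ : v1 = 0) // ; apply/eqP; rewrite eq_le h v10.
apply: le_Rintegral => //.
- exact: (integrable_norm Ifg).
- by apply: cont_integrable_itv; exact: cst_continuous.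
- by move=> v /=; rewrite in_itv /= => /andP[h1 h2]; exact: fg.
Qed.

Lemma scaled_error (k X S1 S2 Cp Cq L : R) : `|X - k * S1| <= Cp -> `|S1 - S2| <= Cq * L ->
  0 <= k -> 0 <= Cp -> 1 <= L -> `|X - k * S2| <= (Cp + k * Cq) * L.
Proof.
move=> D hq k0 Cp0 L1.
have -> : X - k * S2 = (X - k * S1) + k * (S1 - S2) by ring.
apply: le_trans (ler_normD _ _) _; rewrite mulrDl; apply: lerD.
  by apply: le_trans D _; rewrite ler_peMr.
by rewrite normrM ger0_norm // -mulrA ler_wpM2l.
Qed.

(** The number of gaps above [v^2] differs from its expansion by a constant
    uniformly in [v]; integrated over the bounded interval [0, v1], this stays
    bounded. *)
Lemma growth_asymptotics a b bet C K N1 (lw la : seq (R * R)) :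
  0 < bet -> 0 < C -> 0 <= K -> (0 < N1)%N ->
  (forall x, x \in lw -> bet < x.2) -> (forall x, x \in la -> 0 < x.2) ->
  edge_regular a b N1 -> regular_levels (defect a b) (fun n => 1 - a n) bet C K N1 ->
  (forall n, (N1 <= n)%N -> `|defect a b n - C * n%:R `^ (- bet) - power_terms lw n| <= K * n%:R `^ (- (1 + bet))) ->
  (forall n, (N1 <= n)%N -> `|1 - a n - power_terms la n| <= K * n%:R^-1) ->
  exists (s : seq (R * nat * R)) (w : R), [/\ 0 < w, forall x, x \in s -> 0 < x.2 &
   forall N, (N1 <= N)%N -> (forall n, (N <= n)%N -> defect a b n <= w) ->
   exists M e0 : R, [/\ 0 <= M, 0 < e0 & forall eps m, 0 < eps -> eps < e0 -> (N.+1 < m)%N ->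
     eps <= defect a b m -> defect a b m.+1 < eps ->
     `|ln (growth a b (2 - eps) N m) - C `^ bet^-1 * \sum_(x <- (1, 0%N, 0) :: s | (2^-1 < bet^-1 - x.2)%R)
        x.1.1 * edge_coef x.1.2 (bet^-1 - x.2) * eps `^ (- (bet^-1 - x.2 - 2^-1))| <= M * ln eps^-1]].
Proof.
move=> b0 C0 K0 N10 hlw hla hab reg eW eA.
have [s [Cst [t0 [d [d0 Cst0 t00 t01 [sd count]]]]]] := count_expansion b0 C0 K0 N10 hlw hla reg eW eA.
have [s2 [C2 [t2 [d2 [d20 sd2 C20 t20 [t2t0 wcount]]]]]] := weighted_count b0 C0 d0 Cst0 t00 sd.
have WN0 : 0 < defect a b N1.
  have [_ _ _ _ [_ _ h _]] := reg N1 (leqnn N1); apply: lt_le_trans h.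
  by rewrite !mulr_gt0 ?invr_gt0 // powR_gt0 ?ltr0n.
pose t3 := Num.min t2 (defect a b N1).
have t30 : 0 < t3 by rewrite lt_min t20.
pose v1 := Num.sqrt (t3 / 2).
have v1sq : v1 ^+ 2 = t3 / 2 by rewrite sqr_sqrtr // divr_ge0 // ltW.
have v10 : 0 < v1 by rewrite sqrtr_gt0 divr_gt0.
exists s2, (v1 ^+ 2 / 2); split.
- by rewrite v1sq !divr_gt0.
- by move=> x /(allP sd2) h; exact: lt_le_trans h.
move=> N NN hN.
have [Cq Cq0 hq] := edge_sum_asymptotics bet^-1 ((1, 0%N, 0) :: s2) v10.
pose Cp := (N.+3%:R + C2) * v1.
have Cp0 : 0 <= Cp by rewrite mulr_ge0 ?addr_ge0 ?ler0n // ltW.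
exists (Cp + C `^ bet^-1 * Cq), (Num.min (t3 / 2) (expR (-1))); split.
- by rewrite addr_ge0 // mulr_ge0 ?powR_ge0.
- by rewrite lt_min divr_gt0 // expR_gt0.
move=> eps m e0; rewrite lt_min => /andP[e1 e2] Nm m1 m2.
have L1 : 1 <= ln eps^-1 by rewrite lnVp // lerNr -(expRK (-1)); apply: ln_mono => //; exact: ltW.
have NN1 : (N1 <= m)%N by apply: leq_trans NN (ltnW (ltnW Nm)).
set l := [seq gap a b (2 - eps) k | k <- index_iota N.+2 m.+1].
have mono0 i j : (N1 <= i)%N -> (i <= j)%N -> defect a b j <= defect a b i.
  by move=> hi hj; have := level_mono reg (lexx 0) ltr01 hi hj; rewrite !mul0r !addr0.
have hl g : g \in l -> 0 <= g <= v1 ^+ 2.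
  case/mapP => k; rewrite mem_index_iota => /andP[k1 k2] ->.
  have Nk : (N <= k)%N by rewrite ltnW // ltnW.
  have Nk1 := leq_trans NN Nk.
  rewrite (gap_ge0 hab) // (gap_defect hab) // (le_trans m1 (mono0 _ _ Nk1 k2)) /=.
  have [a0 _ _ _ _] := hab k Nk1; have ak : 0 < a k by clear - a0; lra.
  rewrite ler_pdivrMr //; have := hN k Nk; have := sqr_ge0 v1.
  move: (v1 ^+ 2) (defect a b k) (a k) a0 e0 => X Y Z; clear; nra.
have [I1 I2] := sum_ln_mult_int (ltW v10) hl.
have [I3 I4] := edge_int_sum bet^-1 v1 (C `^ bet^-1) ((1, 0%N, 0) :: s2) e0.
rewrite ln_growth -/l I2.
have pw v : 0 <= v -> v <= v1 -> `|(\sum_(g <- l) below g v) * weight v -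
    \sum_(x <- (1, 0%N, 0) :: s2) C `^ bet^-1 * (x.1.1 * edge_kernel x.1.2 (bet^-1 - x.2) eps v)| <= N.+3%:R + C2.
  move=> vv0 vv1; rewrite -kernel_expansion //.
  have vsq : v ^+ 2 <= t3 / 2 by rewrite -v1sq sqr_mono.
  have tt3 : v ^+ 2 + eps < t3 by move: vsq e1; clear; lra.
  have tt2 : v ^+ 2 + eps < t2 by apply: lt_le_trans tt3 _; rewrite ge_min lexx.
  have ttW : v ^+ 2 + eps <= defect a b N1 by apply: le_trans (ltW tt3) _; rewrite ge_min lexx orbT.
  have [m' h1 h2] := levels_counted b0 C0 N10 hab reg NN NN1 e0 m2 count (lt_le_trans tt2 t2t0) ttW.
  have /andP[r0 r1] := edge_ratio v e0; have tp := sqr_pos v e0.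
  have := wcount _ _ _ r0 r1 tp tt2 h1.
  rewrite divfK ?gt_eqF // -/(weight v) => h3.
  rewrite -[X in `|X|](subrK (m'%:R * weight v)) -addrA addrCA addrA -addrA.
  apply: le_trans (_ : `|(\sum_(g <- l) below g v - m'%:R) * weight v| + _ <= _); last first.
    apply: lerD h3; rewrite normrM (ger0_norm (weight_ge0 v)); apply: le_trans h2.
    by rewrite ler_piMr // weight_le1.
  by apply: le_trans (ler_normD _ _); rewrite le_eqVlt; apply/orP; left; apply/eqP; congr `|_|; ring.
have D := Rintegral_dist (ltW v10) I1 I3 pw.
rewrite I4 in D; have {}hq := hq eps e0 e2.
exact: scaled_error D hq (powR_ge0 _ _) Cp0 L1.
Qed.

End GrowthAsymptotics.

(** * Merging equal exponents *)

Section Exponents.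
Context {R : realType}.
Implicit Types (l : seq (R * R)) (k q e : R).

Lemma sum_by_exponent l e : \sum_(k <- undup [seq x.2 | x <- l]) (\sum_(x <- l | x.2 == k) x.1) * e `^ (- k) =
  \sum_(x <- l) x.1 * e `^ (- x.2).
Proof.
transitivity (\sum_(k <- undup [seq x.2 | x <- l]) \sum_(x <- l | x.2 == k) x.1 * e `^ (- x.2)).
  by apply: eq_bigr => k _; rewrite mulr_suml; apply: eq_bigr => x /eqP ->.
rewrite (exchange_big_dep predT) //= big_seq [RHS]big_seq; apply: eq_bigr => x xl.
rewrite big_mkcond (bigD1_seq x.2) ?undup_uniq ?mem_undup ?map_f //= eqxx.
by rewrite big1 ?addr0 // => y yx; rewrite eq_sym (negPf yx).
Qed.

(** Distinct monomials may produce the same exponent; they are grouped, and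
    the dominant term, given apart, stays first. *)
Lemma decreasing_exponents l q k : 0 < k -> (forall x, x \in l -> 0 < x.2 < k) ->
  exists (m : nat) (Q kappa : 'I_m.+1 -> R),
   [/\ forall i j : 'I_m.+1, (i < j)%N -> kappa j < kappa i, forall i, 0 < kappa i, Q ord0 = q, kappa ord0 = k &
     forall e, \sum_(i < m.+1) Q i * e `^ (- kappa i) = q * e `^ (- k) + \sum_(x <- l) x.1 * e `^ (- x.2)].
Proof.
move=> k0 hl; pose ks := rev (sort (<=%O) (undup [seq x.2 | x <- l])).
have ks_mem y : y \in ks -> 0 < y < k.
  by rewrite mem_rev mem_sort mem_undup => /mapP[x xl ->]; exact: hl.
have srt : sorted (>%O) (k :: ks).
  rewrite /= path_sortedE; last by move=> x y z h1 h2; exact: lt_trans h2 h1.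
  apply/andP; split; first by apply/allP => y /ks_mem/andP[].
  by rewrite /ks rev_sorted sort_lt_sorted undup_uniq.
pose kap (i : 'I_(size ks).+1) : R := nth 0 (k :: ks) i.
pose Q (i : 'I_(size ks).+1) : R := if val i is 0%N then q else \sum_(x <- l | x.2 == kap i) x.1.
exists (size ks), Q, kap; split => //.
- move=> i j ij; have tr : transitive (>%O : rel R) by move=> x y z h1 h2; exact: lt_trans h2 h1.
  by apply: (sorted_ltn_nth tr 0 srt) => //; rewrite inE /=.
- move=> i; rewrite /kap; case: i => -[|i] hi //=.
  by have /ks_mem/andP[] : nth 0 ks i \in ks by apply: mem_nth; rewrite -ltnS.
- move=> e; rewrite big_ord_recl /Q /kap /=; congr (_ + _).
  have E : perm_eq ks (undup [seq x.2 | x <- l]) by rewrite /ks perm_rev perm_sort.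
  by rewrite -sum_by_exponent -(perm_big _ E) (big_nth 0) big_mkord.
Qed.

End Exponents.

(** * The density near the edge *)

Section Support.
Context {R : realType} (mu : probability (measurableTypeR R) R).

Lemma compactly_supported_itv : compactly_supported mu ->
  exists2 B : R, 2 <= B & mu (~` `[- B, B]%classic) = 0%E.
Proof.
move=> [K cK mK]; have [M [Mr hM]] := compact_bounded cK.
pose B := Num.max 2 (M + 1).
have B2 : 2 <= B by rewrite le_max lexx.
exists B => //; apply: (subset_measure0 _ _ _ mK).
- by apply: measurableC; exact: measurable_itv.
- by apply: measurableC; apply: closed_measurable; apply: compact_closed => //; exact: Rhausdorff.
- apply: subsetC => x Kx; rewrite /= in_itv /= -ler_norml; apply: hM => //.
  by rewrite /B lt_max ltrDl ltr01 orbT.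
Qed.

(** One application of the recurrence at 2: an increase in absolute value from
    [n] to [n + 1] forces an increase without change of sign from [n + 1] to
    [n + 2]. *)
Lemma growing_sign (p : nat -> {poly R}) (a b : nat -> R) (n : nat) :
  (forall n, 'X * p n = (if n is m.+1 then a n *: p m else 0) + b n.+1 *: p n + a n.+1 *: p n.+1) ->
  0 < a n.+1 -> a n.+1 <= a n.+2 -> 0 <= defect a b n.+2 ->
  `|(p n).[2]| < `|(p n.+1).[2]| -> growing_start p n.+1.
Proof.
move=> jac a1 a2 W0 h; have rc := poly_rec jac 2 n.
rewrite /growing_start /=; pose sg : R := Num.sg (p n.+1).[2].
have u0 : (p n.+1).[2] != 0 by rewrite -normr_gt0 (le_lt_trans _ h).
have vE : sg * (p n.+1).[2] = `|(p n.+1).[2]| by rewrite normrEsg.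
exists sg; rewrite vE; split.
- by rewrite /sg sqr_sg u0.
- by rewrite normr_gt0.
have v1 : `|sg * (p n).[2]| < `|(p n.+1).[2]| by rewrite normrM normr_sg u0 mul1r.
have rv : a n.+2 * (sg * (p n.+2).[2]) = (2 - b n.+2) * `|(p n.+1).[2]| - a n.+1 * (sg * (p n).[2]).
  by rewrite -vE mulrCA rc; ring.
have a0 : 0 < a n.+2 by exact: lt_le_trans a2.
rewrite -(ltr_pM2l a0) rv; move: v1 W0; rewrite /defect.
move: (sg * (p n).[2]) (`|(p n.+1).[2]|) (a n.+1) (a n.+2) (b n.+2) a1 a2 => y v a' a'' b' a1 a2.
rewrite ltr_norml => /andP[y1 y2] W0.
have v0 : 0 < v by lra.
nra.
Qed.

End Support.

Section Assembly.
Context {R : realType}.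
Implicit Types (M e eps : R).

Lemma edge_bigO_left (F : R -> R) M e0 : 0 < e0 ->
  (forall eps, 0 < eps -> eps < e0 -> `|F (2 - eps)| <= M * ln eps^-1) ->
  F =O_ (2^'-) (fun x : R => ln (2 - x)).
Proof.
move=> e00 H; apply/eqOP.
exists `|M|; split; first exact: num_real.
move=> k Mk.
have L : 2 - Num.min e0 1 < 2 by rewrite gtrBl lt_min e00 ltr01.
near=> x.
have x2 : x < 2 by near: x; exact: nbhs_left_lt.
have xl : 2 - Num.min e0 1 < x by near: x; exact: nbhs_left_gt.
have e0' : 0 < 2 - x by rewrite subr_gt0.
have : 2 - x < Num.min e0 1 by rewrite ltrBlDl addrC -ltrBlDl.
rewrite lt_min => /andP[h1 h2].
have := H (2 - x) e0' h1; rewrite subKr lnVp // => h.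
apply: le_trans h _; rewrite [`|ln _|]ler0_norm; last by rewrite -ln1 ler_ln ?posrE // ltW.
have n0 : 0 <= - ln (2 - x) by rewrite oppr_ge0 -ln1 ler_ln ?posrE // ltW.
by rewrite ler_wpM2r // (le_trans (ler_norm M)) // ltW.
Unshelve. all: end_near.
Qed.

End Assembly.

Lemma error_sum (R : realType) (M M' L F G S : R) : `|F + 2 * G| <= M * L -> `|G - S| <= M' * L ->
  `|F + 2 * S| <= (M + 2 * M') * L.
Proof.
move=> h1 h2; have -> : F + 2 * S = (F + 2 * G) - 2 * (G - S) by ring.
apply: le_trans (ler_normB _ _) _; rewrite [leRHS]mulrDl; apply: lerD => //.
by rewrite normrM ger0_norm // -mulrA ler_wpM2l.
Qed.

Section Density.
Context {R : realType} (mu : probability (measurableTypeR R) R) (B : R).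
Hypothesis B2 : (2 : R) <= B.
Hypothesis supp : mu (~` `[- B, B]%classic) = 0%E.
Variables (p : nat -> {poly R}) (a b : nat -> R).
Hypothesis orth : orthonormal_polys mu p.
Hypothesis jac : forall n, 'X * p n =
      (if n is m.+1 then a n *: p m else 0)
      + b n.+1 *: p n + a n.+1 *: p n.+1.
Hypothesis a_gt0 : forall n, (0 < n)%N -> 0 < a n.
Variable f : R -> R.
Hypothesis f_density : ac_density mu f.
Hypothesis f_cont : {in `](-2), 2[, continuous f}.
Hypothesis f_gt0 : {in `](-2), 2[, forall x, 0 < f x}.

(** The recurrence is elliptic at [2 - eps] from the start, with
    [ellip = eps]; there is no hyperbolic region. *)
Lemma free_case N0 : (forall n, (N0 <= n)%N -> a n = 1) -> (forall n, (N0 <= n)%N -> b n = 0) ->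
  exists M e0 : R, 0 < e0 /\ forall eps, 0 < eps -> eps < e0 -> `|ln (f (2 - eps))| <= M * ln eps^-1.
Proof.
move=> a1 b0; pose N := N0.+1.
have cva : a n @[n --> \oo] --> (1 : R).
  by apply: (@cvg_near_ext _ (fun=> 1)); [exists N0 => // n /= /a1 ->|exact: cvg_cst].
have cvb : b n @[n --> \oo] --> (0 : R).
  by apply: (@cvg_near_ext _ (fun=> 0)); [exists N0 => // n /= /b0 ->|exact: cvg_cst].
have hab : edge_regular a b N.
  move=> n /ltnW hn; rewrite !a1 ?(leqW hn) // !b0 ?(leqW hn) //; split; rewrite ?lexx //.
  - by rewrite invf_le1 // ler1n.
have [K [C [C0 HC]]] := elliptic_density B2 supp orth jac a_gt0 cva cvb hab f_density f_cont f_gt0.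
pose S : {poly R} := p N.+1 ^+ 2 + p N ^+ 2.
have SE x : S.[x] = size2 (fun n => (p n).[x]) N by rewrite /S /size2 !hornerE.
have S0 : 0 < S.[2] by rewrite SE; exact: (consecutive_neq0 orth jac a_gt0).
have [r r0 hr] : exists2 r : R, 0 < r & forall x, `|x - 2| < r -> S.[2] / 2 <= S.[x] <= 2 * S.[2].
  have S20 : 0 < S.[2] / 2 by rewrite divr_gt0.
  have := @continuous_horner R S 2; move/cvgrPdist_lt => /(_ _ S20) /nbhs_ballP [r /= r0 hr].
  exists r => // x hx; have : `|S.[2] - S.[x]| < S.[2] / 2 by apply: hr; rewrite /ball /= distrC.
  by case/(near_value S0) => ? _ ?; apply/andP.
pose M := log_const K C 1 1 (2 * S.[2]) (2 / S.[2]) 1 1 1.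
exists M, (Num.min 4^-1 (Num.min r (expR (-1)))); split.
  by rewrite !lt_min invr_gt0 ltr0n r0 expR_gt0.
move=> eps e0; rewrite !lt_min => /andP[e1 /andP[e2 e3]].
have xr : `|2 - eps - 2| < r by rewrite addrAC subrr add0r normrN gtr0_norm.
have /andP[s1 s2] := hr _ xr; rewrite (SE (2 - eps)) in s1 s2.
have e11 : eps <= 1 by apply: ltW; apply: lt_trans e1 _; rewrite invf_lt1 // ltr1n.
have x1 : 3 / 2 < 2 - eps by have [] := near_two e0 e1.
have x2 : 2 - eps < 2 by rewrite ltrBlDr ltrDl.
have el : eps <= ellip a b (2 - eps) N.
  by rewrite /ellip a1 ?b0 ?leqW // mulr1 addr0 subKr.
have [D1 D2] := HC N (2 - eps) eps (leqnn _) x1 x2 e0 e11 el.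
have L1 : 1 <= ln eps^-1 by rewrite lnVp // lerNr -(expRK (-1)); apply: ln_mono => //; exact: ltW.
set s := size2 _ N in s1 s2 D1 D2.
have s0 : 0 < s by apply: lt_le_trans s1; rewrite divr_gt0.
have gE : 1 * eps `^ 1 = eps by rewrite mul1r powRr1 // ltW.
have fx := f_gt0 (near2_itv e0 e1).
have c60 : 0 < 2 * S.[2] by rewrite mulr_gt0.
have c80 : 0 < 2 / S.[2] by rewrite divr_gt0.
have eps2 : eps ^+ 2 <= 1 by rewrite expr_le1 // ltW.
have := @log_estimates R K C 1 1 (2 * S.[2]) (2 / S.[2]) 1 1 1 (f (2 - eps)) s 1 1 eps (semi (2 - eps))
  C0 ltr01 c60 c80 ltr01 ltr01 ltr01 fx s0 (lexx 1) e0 L1 (near2_semi e0 e1).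
rewrite gE ln1 mulr0 addr0 => /(_ D1 D2); rewrite -/M.
case=> //.
- by rewrite expr1n !mulr1; apply: le_trans s2; rewrite ler_piMr // ltW.
- rewrite expr1n !mul1r; apply: le_trans eps2 _; rewrite mulrAC ler_pdivlMr // mul1r.
  by move: s1; rewrite ler_pdivrMr // mulrC.
- by rewrite mulr1 ler1n.
Qed.

(** At [bet = 2] the product is only bounded below by [C / 2], which may be less
    than 8. *)
Lemma quadratic_defect (bet C : R) (N1 : nat) : 0 < C -> bet < 2 ->
  (forall n, (N1 <= n)%N -> C / 2 * n%:R `^ (- bet) <= defect a b n) ->
  \forall N \near \oo, forall n, (N <= n)%N -> 8 <= n%:R ^+ 2 * defect a b n.
Proof.
move=> C0 b2 hW; have b20 : bet - 2 < 0 by rewrite subr_lt0.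
have C16 : 0 < C / 16 by rewrite divr_gt0.
have [M _ hM] : \forall n \near \oo, `|n%:R `^ (bet - 2) : R| <= C / 16.
  by move/cvgr0Pnorm_le : (cvg_natr_pow b20) => /(_ _ C16).
exists (maxn M (maxn N1 1)) => // N /=; rewrite !geq_max => /and3P[h1 h2 h3] n hn.
have n0 : 0 < n%:R :> R by rewrite ltr0n (leq_trans h3).
have n2 : 0 < n%:R ^+ 2 :> R by rewrite exprn_gt0.
have := hM n (leq_trans h1 hn); rewrite ger0_norm ?powR_ge0 // => h4.
apply: le_trans (ler_wpM2l (ltW n2) (hW n (leq_trans h2 hn))).
have p0 : 0 < n%:R `^ (bet - 2) :> R by rewrite powR_gt0.
have E : n%:R ^+ 2 * n%:R `^ (- bet) = (n%:R `^ (bet - 2))^-1 :> R.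
  rewrite -powRN -powR_mulrn ?(ltW n0) // -powRD; first by congr (_ `^ _); ring.
  by apply/implyP => _; rewrite gt_eqF.
rewrite mulrCA E ler_pdivlMr //; apply: le_trans (ler_wpM2l (ler0n _ 8) h4) _.
by rewrite le_eqVlt; apply/orP; left; apply/eqP; field.
Qed.

(** The triple [(1, 0, 0)] at the head of the list stands for the leading term 1
    of the count. *)
Definition edge_terms (C bet : R) (s : seq (R * nat * R)) (eps : R) : R :=
  C `^ bet^-1 * \sum_(x <- (1, 0%N, 0) :: s | (2^-1 < bet^-1 - x.2)%R)
    x.1.1 * edge_coef x.1.2 (bet^-1 - x.2) * eps `^ (- (bet^-1 - x.2 - 2^-1)).

(** Every large [N] serves as starting index of the recurrence; for the second
    claim it is taken such that the values at 2 increase there. *)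
Lemma power_case N0 (oa ob : option (power_sum R)) bet :
  power_expansion a 1 N0 oa -> power_expansion b 0 N0 ob ->
  (Order.min (lead_expo ob) (lead_expo oa))%E = bet%:E ->
  exists2 s : seq (R * nat * R), (forall x, x \in s -> 0 < x.2) &
   (2 <= bet -> exists M e0 : R, 0 < e0 /\ forall eps, 0 < eps -> eps < e0 ->
      `|ln (f (2 - eps))| <= M * ln eps^-1) /\
   (bet < 2 -> mu [set 2] = 0%E -> exists M e0 : R, 0 < e0 /\ forall eps, 0 < eps -> eps < e0 ->
      `|ln (f (2 - eps)) + 2 * edge_terms (C1 oa ob) bet s eps| <= M * ln eps^-1).
Proof.
move=> exa exb betE.
have [b0 C0 cva cvb [c0 [K [lw [la [c00 K0 hlw hla [Nf _ hN]]]]]]] := edge_facts_hold exa exb betE.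
pose N1 := maxn Nf 1.
have facts N : (N1 <= N)%N -> edge_facts a b bet (C1 oa ob) c0 K lw la N.
  by rewrite /N1 geq_max => /andP[h _]; exact: hN.
have F1 := facts N1 (leqnn _).
have N10 : (0 < N1)%N by rewrite /N1 leq_max leqnn orbT.
have [s [w [w0 s0 asym]]] := growth_asymptotics b0 C0 K0 N10 hlw hla
  (ef_regular F1) (ef_levels F1) (ef_defect_terms F1) (ef_a_terms F1).
exists s => //.
have [Nw _ hNw] : \forall N \near \oo, defect a b N <= w.
  have D0 : defect a b n @[n --> \oo] --> (0 : R).
    have -> : (0 : R) = 2 - 2 * 1 - 0 by ring.
    exact: limB (limB (cvg_cst (2 : R)) (limZ (c := 2) cva)) cvb.
  by apply: filterS (cvgr_lt 0 D0 _ w0) => n /ltW.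
have main N : (N1 <= N)%N -> (Nw <= N)%N -> exists M M' e0 : R, 0 < e0 /\ forall eps, 0 < eps -> eps < e0 ->
    exists lG : R, `|lG - edge_terms (C1 oa ob) bet s eps| <= M' * ln eps^-1 /\
     `|ln (f (2 - eps))| <= M * ln eps^-1 + 2 * lG /\
     (growing_start p N -> `|ln (f (2 - eps)) + 2 * lG| <= M * ln eps^-1).
  move=> NN NNw; have F := facts N NN.
  have Cw0 : 0 < 2 * C1 oa ob by rewrite mulr_gt0.
  have [M [e0 [M0 e00 e04 H]]] := density_logs B2 supp orth jac a_gt0 cva cvb f_density f_cont f_gt0
    (leq_trans N10 NN) (ef_regular F) b0 c00 Cw0 (ef_step F) (ef_defect F).
  have [M' [e1 [M'0 e10 G]]] := asym N NN (fun n hn => hNw n (leq_trans NNw hn)).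
  exists M, M', (Num.min e0 e1); split; first by rewrite lt_min e00.
  move=> eps ep; rewrite lt_min => /andP[h1 h2].
  have [m [Nm m1 m2 [A1 A2]]] := H eps ep h1.
  by exists (ln (growth a b (2 - eps) N m)); split; [exact: G|split].
split.
- move=> b2.
  have [M [M' [e0 [e00 H]]]] := main (maxn N1 Nw) (leq_maxl _ _) (leq_maxr _ _).
  exists (M + 2 * M'), e0; split => // eps ep h; have [lG [g1 [g2 _]]] := H eps ep h.
  have S0 : edge_terms (C1 oa ob) bet s eps = 0.
    rewrite /edge_terms big_seq_cond big_pred0 ?mulr0 // => x; apply/negbTE/negP => /andP[xs].
    have x0 : 0 <= x.2 by move: xs; rewrite in_cons => /orP[/eqP -> //|/s0/ltW].
    have : bet^-1 <= 2^-1 by rewrite lef_pV2 ?posrE.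
    by move=> h1; rewrite ltrBrDr ltNge (le_trans h1) // lerDl.
  rewrite S0 subr0 in g1; apply: le_trans g2 _; rewrite [leRHS]mulrDl lerD2l -mulrA ler_wpM2l //.
  exact: le_trans (ler_norm _) g1.
move=> b2 mu2.
have [Nq _ hNq] : \forall N \near \oo, forall n, (N <= n)%N -> 8 <= n%:R ^+ 2 * defect a b n.
  by apply: (quadratic_defect C0 b2 (N1 := N1)) => n hn; have [_ _ _ _ [_ _ h _]] := ef_levels F1 hn.
pose N2 := maxn N1 (maxn Nw Nq).
have N2h : [/\ (N1 <= N2)%N, (Nw <= N2)%N & (Nq <= N2)%N] by split; [exact: leq_maxl|exact: leq_trans (leq_maxl _ _) (leq_maxr _ _)|exact: leq_trans (leq_maxr _ _) (leq_maxr _ _)].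
have [N21 N2w N2q] := N2h.
have reg := ef_regular (facts N2 N21).
have [n Nn hn] : exists2 n, (N2 <= n)%N & `|(p n).[2]| < `|(p n.+1).[2]|.
  apply: (growing_at_edge supp orth jac (leq_trans N10 N21) _ mu2) => n hn.
  have [h1 h2 h3 _ [h4 _]] := reg n hn; split => //; last exact: (hNq n (leq_trans N2q hn) n).
  by apply: lt_le_trans h1; rewrite invr_gt0.
have N1n : (N1 <= n.+1)%N by apply: leqW (leq_trans N21 Nn).
have gs : growing_start p n.+1.
  have [h1 _ h3 _ _] := reg n.+1 (leqW Nn).
  apply: (growing_sign jac _ h3 _ hn); first by apply: lt_le_trans h1; rewrite invr_gt0.
  by have /andP[/ltW h _] := ef_defect F1 (leqW N1n).
have [M [M' [e0 [e00 H]]]] := main n.+1 N1n (leqW (leq_trans N2w Nn)).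
exists (M + 2 * M'), e0; split => // eps ep h; have [lG [g1 [_ /(_ gs) g2]]] := H eps ep h.
exact: error_sum g2 g1.
Qed.

End Density.

Lemma beta_prefactor (R : realType) (c p G1 G2 : R) : 2 * c * (p / 2 * G1 / G2) = c * (G1 * p / G2).
Proof. by transitivity (2 / 2 * (c * (G1 * p / G2))); [ring|rewrite divff // mul1r]. Qed.

Lemma edge_terms_cons (R : realType) (C bet : R) (s : seq (R * nat * R)) (eps : R) : 2^-1 < bet^-1 ->
  2 * edge_terms C bet s eps =
  2 * C `^ bet^-1 * edge_coef 0 bet^-1 * eps `^ (- (bet^-1 - 2^-1)) +
  \sum_(x <- [seq (2 * C `^ bet^-1 * x.1.1 * edge_coef x.1.2 (bet^-1 - x.2), bet^-1 - x.2 - 2^-1) |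
     x <- s & (2^-1 < bet^-1 - x.2)%R]) x.1 * eps `^ (- x.2).
Proof.
move=> h; rewrite /edge_terms big_cons /= subr0 h mul1r !mulrDr; congr (_ + _); first by ring.
rewrite big_map big_filter !mulr_sumr; apply: eq_bigr => x _ /=; ring.
Qed.

Theorem theorem3 (R : realType)
    (mu : probability (measurableTypeR R) R)
    (mu_compact : compactly_supported mu)
    (mu_nontrivial : nontrivial_measure mu)
    (a b : nat -> R)
    (ab_jacobi : jacobi_parameters mu a b)
    (a_gt0 : forall n, (0 < n)%N -> 0 < a n)
    (N0 : nat)
    (oa ob : option (power_sum R))
    (a_expansion : power_expansion a 1 N0 oa)
    (b_expansion : power_expansion b 0 N0 ob)
    (f : R -> R)
    (f_density : ac_density mu f)
    (f_continuous : {in `](-2), 2[, continuous f})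
    (f_gt0 : {in `](-2), 2[, forall x, 0 < f x}) :
  let beta : \bar R := Order.min (lead_expo ob) (lead_expo oa) in
  let s : R := (fine beta)^-1 in
  ((2%:E <= beta)%E ->
     (fun x : R => ln (f x)) =O_ (2^'-) (fun x : R => ln (2 - x)))
  /\
  ((beta < 2%:E)%E -> mu [set 2] = 0%E ->
     exists (m : nat) (Q kappa : 'I_m.+1 -> R),
       [/\ forall i j : 'I_m.+1, (i < j)%N -> kappa j < kappa i,
           forall i, 0 < kappa i,
           (fun x : R =>
              ln (f x) - (- \sum_(i < m.+1) Q i * (2 - x) `^ (- kappa i)))
             =O_ (2^'-) (fun x : R => ln (2 - x)),
           Q ord0 = C1 oa ob `^ s *
                      (Gamma (s - 2^-1) * Num.sqrt pi / Gamma s)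
         & kappa ord0 = s - 2^-1]).

Proof.
have [B B2 supp] := compactly_supported_itv mu_compact.
have [p orth jac] := ab_jacobi.
move=> beta s.
have [bE|[bet bE]] : beta = +oo%E \/ exists bet : R, beta = bet%:E.
  case E : beta => [r| |]; [by right; exists r|by left|].
  by exfalso; move: E; rewrite /beta; case: (oa) => [P|]; case: (ob) => [Q|] //=; rewrite ?minEle; case: ifP.
  have [a1 b0] : (forall n, (N0 <= n)%N -> a n = 1) /\ (forall n, (N0 <= n)%N -> b n = 0).
    have : (+oo <= beta)%E by rewrite bE.
    rewrite le_min !leye_eq; move: a_expansion b_expansion.
    by case: (oa) => [P|]; case: (ob) => [Q|].
  split; last by rewrite bE.
  move=> _; have [M [e0 [e00 H]]] := free_case B2 supp orth jac a_gt0 f_density f_continuous f_gt0 a1 b0.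
  exact: edge_bigO_left e00 H.
have sE : s = bet^-1 by rewrite /s bE.
have [terms tpos [Ha Hb]] := power_case B2 supp orth jac a_gt0 f_density f_continuous f_gt0 a_expansion b_expansion bE.
rewrite bE lee_fin lte_fin; split.
  by move=> /Ha [M [e0 [e00 H]]]; exact: edge_bigO_left e00 H.
move=> b2 mu2; have [M [e0 [e00 H]]] := Hb b2 mu2.
have [bet0 _ _ _ _] := edge_facts_hold a_expansion b_expansion bE.
have h : 2^-1 < bet^-1 by rewrite ltf_pV2 ?posrE.
have k0 : 0 < bet^-1 - 2^-1 by rewrite subr_gt0.
pose C := C1 oa ob.
pose l := [seq (2 * C `^ bet^-1 * x.1.1 * edge_coef x.1.2 (bet^-1 - x.2), bet^-1 - x.2 - 2^-1) |
     x <- terms & (2^-1 < bet^-1 - x.2)%R].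
have hl x : x \in l -> 0 < x.2 < bet^-1 - 2^-1.
  case/mapP => y; rewrite mem_filter => /andP[y1 /tpos y2] -> /=.
  by rewrite subr_gt0 y1 /= ltrD2r gtrBl.
have [m [Q [kap [kdec kpos Q0 kap0 sumE]]]] :=
  decreasing_exponents (2 * C `^ bet^-1 * edge_coef 0 bet^-1) k0 hl.
exists m, Q, kap; rewrite sE; split => //.
- apply: (edge_bigO_left e00) => eps ep he /=.
  by rewrite subKr opprK sumE -edge_terms_cons //; exact: H.
- by rewrite Q0 edge_coef0 //; exact: beta_prefactor.
Qed.
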